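(* Let $\mathcal T$ be the family of all trajectories of the switched system $\dot x=f(t,x,\sigma)$. Suppose that each $f_i$, $i\in\mathcal I$, is uniformly bounded and that there exists a function $\bar V:\mathbb R_{\ge0}\times\mathcal X\to\mathbb R_{\ge0}$ such that: (1) there exist $\phi_1,\phi_2\in\mathcal K$ such that $\phi_1(|\xi|)\le\bar V(t,\xi)\le\phi_2(|\xi|)$ for all $t\ge0$ and all $\xi\in\mathcal X$; (2) $\bar V$ is continuously differentiable and for all $i\in\mathcal I$, $t\ge0$, $\xi\in\mathcal X$, $$\frac{\partial\bar V}{\partial t}(t,\xi)+\frac{\partial\bar V}{\partial\xi}(t,\xi)f_i(t,\xi)\le-\eta_i(t,\xi),$$ where $\eta_i:\mathbb R_{\ge0}\times\mathcal X\to\mathbb R_{\ge0}$ is Lebesgue measurable in $t$ and continuous in $\xi$; (3) for every $(x,\sigma)\in\mathcal T$ and every $t_0(x)\le t<s<t_f(x)$ with $\sigma(t)=\sigma(s)$, $\bar V(t,x(t))\ge\bar V(s,x(s))$. Let $h$ be defined by $h(t,\xi,i)=\eta_i(t,\xi)$ for all $t\ge0$, $\xi\in\mathcal X$, $i\in\mathcal I$, write $h_i=\eta_i$, and suppose in addition that for all $i\in\mathcal I$: (i) $h_i(t,\xi)$ is uniformly bounded, measurable in $t$, continuous in $\xi$ uniformly in $t$, and precompact; (ii) $f_i=\hat f_i+\Delta f_i$, where (a) $\hat f_i(t,\xi)$ is uniformly bounded, measurable in $t$, continuous in $\xi$ uniformly in $t$, and precompact, and (b) $(h_i,\Delta f_i)$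 is a zeroing pair. Then the switched system is uniformly asymptotically stable (UAS) under arbitrary switchings (i.e. $\mathcal T$ is UAS) if for each $\gamma\in\Lambda$ the reduced limiting control system $$\Sigma_\gamma:\ \dot x=\hat F_\gamma(t,x)u,\quad y=\hat H_\gamma(t,x)u=0,\quad u\in\mathcal U,$$ is WZSD. If, in addition, $\mathcal X=\mathbb R^n$ and the functions $\phi_1,\phi_2$ in (1) are of class $\mathcal K_\infty$, then the switched system is globally uniformly asymptotically stable (GUAS) under arbitrary switchings (i.e. $\mathcal T$ is GUAS).
   Context: **Switched system.** $\mathcal I=\{1,\dots,N\}$; $\mathcal X\subset\mathbb R^n$ is an open neighborhood of the origin. A switching signal is a function $\sigma:\mathbb R\to\mathcal I$ that is piecewise constant (finitely many jumps in each compact interval) and right-continuous; $\mathcal S$ is the set of all of them. Given $f:\mathbb R_{\ge0}\times\mathcal X\times\mathcal I\to\mathbb R^n$ write $f_i(t,\xi)=f(t,\xi,i)$. The switched system is $\dot x(t)=f(t,x(t),\sigma(t))$, with output $y(t)=h(t,x(t),\sigma(t))$. Standing assumption: each $f_i$ is measurable in $t$ and continuous in $\xi$ and satisfies the Carathéodory conditions (in addition, on each compact subset of $\mathbb R_{\ge0}\times\mathcal X$, $|f_i(t,\xi)|\le m(t)$ for some integrable $m$). A solution corresponding to $\sigma$ is a locally absolutely continuous $x:[t_0(x),t_f(x))\to\mathcal X$, $0\le t_0(x)<t_f(x)\le\infty$, with $\dot x(t)=f(t,x(t),\sigma(t))$ a.e.; it is maximal if it cannot be extended to a solution (for the same $\sigma$)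 on $[t_0(x),t')$ with $t'>t_f(x)$. A trajectory is a pair $(x,\sigma)$ with $\sigma\in\mathcal S$ and $x$ a maximal solution corresponding to $\sigma$. **Stability.** $\alpha\in\mathcal K$ means $\alpha:\mathbb R_{\ge0}\to\mathbb R_{\ge0}$ is continuous, strictly increasing, $\alpha(0)=0$; $\alpha\in\mathcal K_\infty$ if in addition it is unbounded. $\beta\in\mathcal{KL}$ means $\beta:\mathbb R_{\ge0}\times\mathbb R_{\ge0}\to\mathbb R_{\ge0}$, $\beta(\cdot,t)\in\mathcal K_\infty$ for each $t\ge0$, and for each $r\ge0$, $\beta(r,t)$ decreases monotonically to $0$ as $t\to\infty$. $\mathcal T$ is UAS if there are $\beta\in\mathcal{KL}$ and $\delta_0>0$ such that for any $(x,\sigma)\in\mathcal T$ and $s\in[t_0(x),t_f(x))$ with $|x(s)|<\delta_0$, $|x(t)|\le\beta(|x(s)|,t-s)$ for all $s\le t<t_f(x)$. $\mathcal T$ is GUAS if $\mathcal X=\mathbb R^n$ and there is $\beta\in\mathcal{KL}$ such that this estimate holds for any $(x,\sigma)\in\mathcal T$ and any $s\in[t_0(x),t_f(x))$. **Regularity notions.** For $g:J\times\mathcal X\to\mathbb R^m$, $J$ an interval: $g$ is uniformly bounded if there is $J'\subset J$ with $|J\setminus J'|=0$ such that $g$ is bounded on $J'\times K$ for each compact $K\subset\mathcal X$; measurable in $t$ if $g(\cdot,\xi)$ is Lebesgue measurable for all $\xi$; continuous in $\xi$ if $g(t,\cdot)$ is continuous for almost all $t$; continuous in $\xi$ uniformly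 in $t$ if there is $J'\subset J$ with $|J\setminus J'|=0$ such that for every compact $K\subset\mathcal X$ there is $\omega_K\in\mathcal K$ with $|g(t,\xi)-g(t,\zeta)|\le\omega_K(|\xi-\zeta|)$ for all $t\in J'$, $\xi,\zeta\in K$. For $g:\mathbb R_{\ge0}\times\mathcal X\to\mathbb R^m$, a sequence $\gamma=\{t_k\}$ of nonnegative times is admissible for $g$ if $t_k\to\infty$ and there are $g_\gamma:\mathbb R\times\mathcal X\to\mathbb R^m$ and a null set $E_\gamma\subset\mathbb R$ with $\lim_k g(t_k+s,\xi)=g_\gamma(s,\xi)$ for all $\xi\in\mathcal X$, $s\in\mathbb R\setminus E_\gamma$; $g_\gamma$ is the limiting function and $\Lambda(g)$ the set of admissible sequences. $g$ is precompact if every sequence $t_k\to\infty$ in $\mathbb R_{\ge0}$ has a subsequence in $\Lambda(g)$. A pair $(g,\hat g)$ of functions on $\mathbb R_{\ge0}\times\mathcal X$ is a zeroing pair if for every sequence $t_k\to\infty$ in $\mathbb R_{\ge0}$, compact $K\subset\mathcal X$, $\varepsilon>0$ and sequence $\{v_k\}$ in $K$ with $|v_k|\ge\varepsilon$ for all $k$: $g(t_k,v_k)\to0$ implies $\hat g(t_k,v_k)\to0$. **Reduced limiting control systems.** $U=\{\mu\in\mathbb R_{\ge0}^N:\sum_i\mu_i=1\}$; $\mathcal U$ is the set of Lebesgue measurable $u:\mathbb R\to U$. With the decomposition $f_i=\hat f_i+\Delta f_i$ fixed, $\Lambda=\bigcap_{i\in\mathcal I}[\Lambda(\hat f_i)\cap\Lambda(h_i)]$.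 For $\gamma\in\Lambda$, $\hat F_\gamma=[\hat f_{1,\gamma}\cdots\hat f_{N,\gamma}]$ and $\hat H_\gamma=[|h_{1,\gamma}|\cdots|h_{N,\gamma}|]$. A complete trajectory of $\Sigma_\gamma$ is a pair $(x,u)$ with $x:\mathbb R\to\mathcal X$ locally absolutely continuous, $u\in\mathcal U$ and, for almost all $t\in\mathbb R$, $\dot x(t)=\hat F_\gamma(t,x(t))u(t)$ and $\hat H_\gamma(t,x(t))u(t)=0$; it is bounded if $x(\mathbb R)$ is contained in a compact subset of $\mathcal X$. $\Sigma_\gamma$ is WZSD if $\inf_{t\in\mathbb R}|x(t)|=0$ for every bounded complete trajectory $(x,u)$ of $\Sigma_\gamma$. *)

(* Defs.v *)
From HB Require Import structures.
From mathcomp Require Import all_boot all_order all_algebra.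
From mathcomp Require Import all_classical all_reals all_analysis.

Set Implicit Arguments.
Unset Strict Implicit.
Unset Printing Implicit Defensive.

Import Order.TTheory GRing.Theory Num.Theory.
Import numFieldNormedType.Exports.

Local Open Scope classical_set_scope.
Local Open Scope ring_scope.

(* Functions with domain R>=0 x X (resp. R x X, [t0, tf[, ...) are represented
   by total functions; every definition below only constrains, and only looks
   at, the values on the actual domain. *)

(* The library norm on 'rV[R]_n is the sup norm; |.| is the Euclidean one. *)
Definition enorm (R : realType) (n : nat) (v : 'rV[R]_n) : R :=
  Num.sqrt (\sum_(j < n) v 0 j ^+ 2).

(* A scalar-valued function seen as a function with values in R^1. *)
Definition to_R1 (R : realType) (n : nat) (g : R -> 'rV[R]_n -> R) :
    R -> 'rV[R]_n -> 'rV[R]_1 :=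
  fun t xi => (g t xi)%:M.

Definition Rge0 (R : realType) : set R := [set t | 0 <= t].

(* * Comparison functions *)

Definition classK (R : realType) (alpha : R -> R) : Prop :=
  [/\ {within @Rge0 R, continuous alpha},
      (forall r s : R, 0 <= r -> r < s -> alpha r < alpha s)
    & alpha 0 = 0].

Definition classKinf (R : realType) (alpha : R -> R) : Prop :=
  classK alpha /\ forall M : R, exists2 r, 0 <= r & M < alpha r.

Definition classKL (R : realType) (beta : R -> R -> R) : Prop :=
  (forall t : R, 0 <= t -> classKinf (beta ^~ t)) /\
  (forall r : R, 0 <= r ->
     (forall s t : R, 0 <= s -> s <= t -> beta r t <= beta r s) /\
     (beta r t @[t --> +oo] --> (0 : R))).

(* * Lebesgue measurability *)

(* The real line with the sigma-algebra of Lebesgue (not only Borel) measurable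
   sets, i.e. the domain of completed_lebesgue_measure. Null sets are the sets
   that are lebesgue_measure.-negligible. *)
Definition lebesgueType (R : realType) :=
  caratheodory_type (mu_ext (@wlength R idfun)).

Definition lebesgue_measurable_fun (R : realType) (J : set R) (g : R -> R) :
    Prop :=
  @measurable_fun _ _ (lebesgueType R) R J g.

Definition lebesgue_integrable (R : realType) (J : set R) (g : R -> R) : Prop :=
  (@completed_lebesgue_measure R).-integrable J (EFin \o g).

(* * Regularity notions for g : J x X -> R^m *)

Section Regularity.
Context {R : realType} {n m : nat}.
Implicit Types (J : set R) (X : set 'rV[R]_n) (g : R -> 'rV[R]_n -> 'rV[R]_m).

Definition uniformly_bounded J X g : Prop :=
  exists J' : set R,
    [/\ J' `<=` J, (@lebesgue_measure R).-negligible (J `\` J')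
      & forall K : set 'rV[R]_n, compact K -> K `<=` X ->
          exists M : R, forall t xi, J' t -> K xi -> enorm (g t xi) <= M].

Definition measurable_in_t J X g : Prop :=
  forall xi, X xi -> forall j, lebesgue_measurable_fun J (fun t => g t xi 0 j).

Definition continuous_in_xi J X g : Prop :=
  (@lebesgue_measure R).-negligible
    [set t | J t /\ ~ {within X, continuous (g t)}].

Definition continuous_in_xi_uniformly J X g : Prop :=
  exists J' : set R,
    [/\ J' `<=` J, (@lebesgue_measure R).-negligible (J `\` J')
      & forall K : set 'rV[R]_n, compact K -> K `<=` X ->
          exists2 omega : R -> R, classK omega &
            forall t xi zeta, J' t -> K xi -> K zeta ->
              enorm (g t xi - g t zeta) <= omega (enorm (xi - zeta))].

(* Domain R>=0 x X. *)
Definition caratheodory X g : Prop :=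
  [/\ measurable_in_t (@Rge0 R) X g,
      continuous_in_xi (@Rge0 R) X g
    & forall C : set (R * 'rV[R]_n), compact C ->
        C `<=` [set p | 0 <= p.1 /\ X p.2] ->
        exists2 b : R -> R, lebesgue_integrable (@Rge0 R) b &
          forall t xi, C (t, xi) -> enorm (g t xi) <= b t].

Definition times_to_infinity (gamma : nat -> R) : Prop :=
  (forall k, 0 <= gamma k) /\ (gamma k @[k --> \oo] --> +oo).

(* For s < 0 the values g (gamma k + s) are meaningful for k large only, which
   is harmless in the limit. The limiting function is determined by g and gamma
   up to a null set of times s. *)
Definition limiting_function X g (gamma : nat -> R)
    (g_gamma : R -> 'rV[R]_n -> 'rV[R]_m) : Prop :=
  exists2 E : set R, (@lebesgue_measure R).-negligible E &
    forall s xi, ~ E s -> X xi ->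
      g (gamma k + s) xi @[k --> \oo] --> g_gamma s xi.

Definition admissible X g (gamma : nat -> R) : Prop :=
  times_to_infinity gamma /\ exists g_gamma, limiting_function X g gamma g_gamma.

Definition precompact_fun X g : Prop :=
  forall gamma, times_to_infinity gamma ->
    exists2 phi : nat -> nat, {homo phi : k l / (k < l)%N} &
      admissible X g (gamma \o phi).

End Regularity.

Definition zeroing_pair (R : realType) (n m m' : nat) (X : set 'rV[R]_n)
    (g : R -> 'rV[R]_n -> 'rV[R]_m) (ghat : R -> 'rV[R]_n -> 'rV[R]_m') : Prop :=
  forall (gamma : nat -> R) (K : set 'rV[R]_n) (eps : R) (v : nat -> 'rV[R]_n),
    times_to_infinity gamma -> compact K -> K `<=` X -> 0 < eps ->
    (forall k, K (v k)) -> (forall k, eps <= enorm (v k)) ->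
    (g (gamma k) (v k) @[k --> \oo] --> (0 : 'rV[R]_m)) ->
    (ghat (gamma k) (v k) @[k --> \oo] --> (0 : 'rV[R]_m')).

(* * Absolute continuity *)

Definition abs_continuous_on (R : realType) (n : nat) (a b : R)
    (x : R -> 'rV[R]_n) : Prop :=
  forall eps : R, 0 < eps -> exists2 delta : R, 0 < delta &
    forall (p : nat) (al be : 'I_p -> R),
      (forall k, [/\ a <= al k, al k <= be k & be k <= b]) ->
      trivIset setT (fun k => `]al k, be k[%classic) ->
      \sum_(k < p) (be k - al k) < delta ->
      \sum_(k < p) enorm (x (be k) - x (al k)) < eps.

(* * Switched systems *)

(* The second clause says that the jumps, i.e. the times around which sigma is
   not constant, are finitely many in each compact interval. *)
Definition switching_signal (R : realType) (N : nat) (sigma : R -> 'I_N) :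
    Prop :=
  (forall t, \forall s \near t^'+, sigma s = sigma t) /\
  (forall a b : R, finite_set
     [set t | a <= t <= b /\ ~ (\forall s \near t, sigma s = sigma t)]).

(* A pair (x, sigma), together with the domain [t0, tf[ of x. *)
Record switched_path (R : realType) (n N : nat) := SwitchedPath {
  t0 : R;
  tf : \bar R;
  state : R -> 'rV[R]_n;
  signal : R -> 'I_N }.

Section Trajectories.
Context {R : realType} {n N : nat}.
Variables (X : set 'rV[R]_n) (f : 'I_N -> R -> 'rV[R]_n -> 'rV[R]_n).

Definition solution (p : switched_path R n N) : Prop :=
  [/\ 0 <= t0 p, ((t0 p)%:E < tf p)%E,
      (forall t, t0 p <= t -> (t%:E < tf p)%E -> X (state p t)),
      (forall a b, t0 p <= a -> a <= b -> (b%:E < tf p)%E ->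
         abs_continuous_on a b (state p))
    & {ae (@lebesgue_measure R), forall t : R,
         t0 p <= t -> (t%:E < tf p)%E ->
         is_derive t (1 : R) (state p) (f (signal p t) t (state p t))}].

Definition maximal_solution (p : switched_path R n N) : Prop :=
  solution p /\
  forall q, solution q -> t0 q = t0 p -> signal q = signal p ->
    (forall t, t0 p <= t -> (t%:E < tf p)%E -> state q t = state p t) ->
    ~ (tf p < tf q)%E.

Definition trajectories : set (switched_path R n N) :=
  [set p | switching_signal (signal p) /\ maximal_solution p].

End Trajectories.

(* * Stability *)

Section Stability.
Context {R : realType} {n N : nat}.
Implicit Types (T : set (switched_path R n N)) (p : switched_path R n N).

Definition KL_estimate (beta : R -> R -> R) p (s : R) : Prop :=
  forall t, s <= t -> (t%:E < tf p)%E ->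
    enorm (state p t) <= beta (enorm (state p s)) (t - s).

Definition UAS T : Prop :=
  exists (beta : R -> R -> R) (delta0 : R),
    [/\ classKL beta, 0 < delta0
      & forall p s, T p -> t0 p <= s -> (s%:E < tf p)%E ->
          enorm (state p s) < delta0 -> KL_estimate beta p s].

Definition GUAS (X : set 'rV[R]_n) T : Prop :=
  X = setT /\
  exists2 beta : R -> R -> R, classKL beta &
    forall p s, T p -> t0 p <= s -> (s%:E < tf p)%E -> KL_estimate beta p s.

End Stability.

(* * Continuously differentiable functions on R>=0 x X *)

(* Vt and Vx are the partial derivatives of V with respect to t and xi. At
   t = 0 the derivative with respect to t is one-sided. *)
Definition C1_with (R : realType) (n : nat) (X : set 'rV[R]_n)
    (V Vt : R -> 'rV[R]_n -> R) (Vx : R -> 'rV[R]_n -> 'rV[R]_n) : Prop :=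
  let D := [set p : R * 'rV[R]_n | 0 <= p.1 /\ X p.2] in
  [/\ (forall (t : R) xi, 0 <= t -> X xi ->
         (V (t + s) xi - V t xi) / s
           @[s --> within [set s | 0 <= t + s] (dnbhs (0 : R))] --> Vt t xi),
      (forall (t : R) xi j, 0 <= t -> X xi ->
         is_derive xi (delta_mx 0 j : 'rV[R]_n) (V t) (Vx t xi 0 j)),
      {within D, continuous (fun p => Vt p.1 p.2)}
    & {within D, continuous (fun p => Vx p.1 p.2)}].

(* * Reduced limiting control systems *)

Definition simplex (R : realType) (N : nat) : set 'rV[R]_N :=
  [set mu | (forall i, 0 <= mu 0 i) /\ \sum_(i < N) mu 0 i = 1].

Definition control (R : realType) (N : nat) (u : R -> 'rV[R]_N) : Prop :=
  (forall t, simplex (u t)) /\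
  (forall i, lebesgue_measurable_fun setT (fun t => u t 0 i)).

Section LimitingSystems.
Context {R : realType} {n m N : nat}.
Variables (X : set 'rV[R]_n).

Definition Lambda (fhat : 'I_N -> R -> 'rV[R]_n -> 'rV[R]_n)
    (h : 'I_N -> R -> 'rV[R]_n -> 'rV[R]_m) : set (nat -> R) :=
  [set gamma | forall i, admissible X (fhat i) gamma /\ admissible X (h i) gamma].

Variables (fg : 'I_N -> R -> 'rV[R]_n -> 'rV[R]_n)
          (hg : 'I_N -> R -> 'rV[R]_n -> 'rV[R]_m).

(* F(t, xi) u for the matrix F(t, xi) with columns fg i t xi. *)
Definition limit_dynamics (t : R) (xi : 'rV[R]_n) (u : 'rV[R]_N) : 'rV[R]_n :=
  \sum_(i < N) u 0 i *: fg i t xi.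

(* H(t, xi) u for the row H(t, xi) with entries |hg i t xi|. *)
Definition limit_output (t : R) (xi : 'rV[R]_n) (u : 'rV[R]_N) : R :=
  \sum_(i < N) enorm (hg i t xi) * u 0 i.

Definition complete_trajectory (x : R -> 'rV[R]_n) (u : R -> 'rV[R]_N) : Prop :=
  [/\ (forall t, X (x t)), (forall a b, a <= b -> abs_continuous_on a b x),
      control u
    & {ae (@lebesgue_measure R), forall t : R,
         is_derive t (1 : R) x (limit_dynamics t (x t) (u t)) /\
         limit_output t (x t) (u t) = 0}].

Definition bounded_trajectory (x : R -> 'rV[R]_n) : Prop :=
  exists K : set 'rV[R]_n, [/\ compact K, K `<=` X & range x `<=` K].

Definition WZSD : Prop :=
  forall x u, complete_trajectory x u -> bounded_trajectory x ->
    inf (range (fun t => enorm (x t))) = 0.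

End LimitingSystems.

(* Main.v *)
(* Only the trajectories inside their interval of existence matter, so neither
   maximality nor continuation of solutions enters.  V is nonincreasing along
   every solution, which gives stability; attractivity reduces to showing that no
   solution stays in a compact annulus of X over arbitrarily long times.  If one
   did, the drop of V would tend to 0 on longer and longer windows centred at
   times tau_k -> +oo.  The recentred states y_k are equi-Lipschitz and, like the
   occupation times U_ki(s) of the modes, converge along a subsequence.
   The limit x solves the reduced limiting system with control u_i = U_i'.
   No weak compactness is needed: at a Lebesgue point of the limiting functions
   g_i(s, x(s)) the increments of x are compared with sum_i g_i(s, x(s)) dU_i, and
   all error terms are absorbed either by integrals that tend to 0 by dominated
   convergence or by a multiple of the drop of V, because the zeroing pair property
   yields |Df_i| <= e + C eta_i for large times.  The control so obtained contradicts
   WZSD, since |x| stays away from 0. *)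

Require Import Defs.
From HB Require Import structures.
From mathcomp Require Import all_boot all_order all_algebra.
From mathcomp Require Import all_classical all_reals all_analysis.
From mathcomp Require Import measurable_realfun.
From mathcomp Require Import ring lra.

Set Implicit Arguments.
Unset Strict Implicit.
Unset Printing Implicit Defensive.

Import Order.TTheory GRing.Theory Num.Theory.
Import numFieldNormedType.Exports.

Local Open Scope classical_set_scope.
Local Open Scope ring_scope.

(** Two obstacles shape the argument. The data are controlled at almost every time only, and states
    are merely absolutely continuous. Hence every differential inequality is integrated through one
    monotonicity lemma, and every Lebesgue measurable integrand is replaced by a Borel
    representative. Switching signals may oscillate faster and faster, so they have no pointwise
    limit. Their occupation times are 1-Lipschitz, which leaves an Arzela-Ascoli argument; the
    limiting control is then a relaxed one, with values inside the simplex and not only at its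
    vertices. Windows with a small drop come from the pigeonhole principle: [V] lies between 0 and
    [phi2 B] on the annulus, so among many consecutive windows one must waste little of it. An
    annulus is needed rather than a ball because the zeroing pair property is silent near the
    origin. The final KL function needs continuity in the initial norm, which suprema over
    trajectories do not provide; it is restored by interpolating between integer radii. *)

(* Cousin's lemma: the supremum of the points reachable from [a] is [b]. *)
Lemma interval_creep (R : realType) (P : R -> R -> Prop) (a b : R) : a <= b ->
  (forall u v w, u <= v -> v <= w -> P u v -> P v w -> P u w) ->
  (forall t, a <= t <= b -> exists2 r : R, 0 < r &
     forall u v, a <= u -> u <= t -> t <= v -> v <= b ->
       t - r < u -> v < t + r -> P u v) ->
  P a b.
Proof.
move=> ab Ptr Ploc.
pose S := [set t | a <= t <= b /\ P a t].
have Sa : S a.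
  split; first by rewrite lexx ab.
  have [|r r0 H] := Ploc a; first by rewrite lexx ab.
  by apply: H => //; lra.
have supS : has_sup S by split; [exists a | exists b => t [/andP[]]].
pose c := sup S.
have ac : a <= c by apply: ub_le_sup => //; case: supS.
have cb : c <= b by apply: ge_sup; [exists a | move=> t [/andP[]]].
have [|r r0 H] := Ploc c; first by rewrite ac cb.
have [t [/andP[at_ tb] Pat] tc] := sup_adherent r0 supS.
have tlec : t <= c by apply: ub_le_sup => //; [case: supS | split=> //; rewrite at_ tb].
(* Half of [r] keeps [v] strictly inside the neighbourhood of [c]. The minimum serves both cases: it
   passes beyond [c] if [c < b] and reaches [b] if [c = b]. *)
pose v := Num.min b (c + r / 2).
have cv : c <= v by rewrite /v le_min cb /=; lra.
have vb : v <= b by rewrite /v ge_min lexx.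
have vr : v < c + r by rewrite /v gt_min; apply/orP; right; lra.
have Pav : P a v.
  apply: (Ptr a t v) => //; first exact: le_trans cv.
  by apply: H.
have vc : v <= c.
  apply: ub_le_sup; first by case: supS.
  by split=> //; rewrite vb andbT (le_trans ac cv).
have vcE : v = c by apply/eqP; rewrite eq_le vc cv.
suff vbE : v = b by rewrite -vbE.
move: vcE; rewrite /v /Num.min; case: ifP => // _ hc.
by exfalso; move: hc; lra.
Qed.

(** * Monotonicity from the sign of an almost everywhere derivative *)

Section AlmostEverywhere.
Context {R : realType}.
Local Notation mu := (@lebesgue_measure R).
Implicit Types P Q : R -> Prop.

Lemma ae_mono P Q : (forall t, P t -> Q t) ->
  {ae mu, forall t, P t} -> {ae mu, forall t, Q t}.
Proof. by move=> PQ; apply: negligibleS => t /= nQ Pt; exact/nQ/PQ. Qed.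

Lemma ae_and P Q : {ae mu, forall t, P t} -> {ae mu, forall t, Q t} ->
  {ae mu, forall t, P t /\ Q t}.
Proof.
move=> HP HQ; apply: negligibleS (negligibleU HP HQ) => t /= nPQ.
by apply: contrapT => /not_orP[/contrapT Pt /contrapT Qt]; exact: nPQ.
Qed.

Lemma ae_all (P : R -> Prop) : (forall t, P t) -> {ae mu, forall t, P t}.
Proof.
move=> HP; apply: (negligibleS (A := set0)); last exact: negligible_set0.
by move=> t /= nP; exact/nP/HP.
Qed.

Lemma ae_nat (P : nat -> R -> Prop) : (forall k, {ae mu, forall t, P k t}) ->
  {ae mu, forall t, forall k, P k t}.
Proof.
move=> HP; apply: negligibleS (negligible_bigcup HP) => t /= /existsNP[k nP].
by exists k.
Qed.

Lemma ae_count (I : countType) (P : I -> R -> Prop) :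
  (forall i, {ae mu, forall t, P i t}) -> {ae mu, forall t, forall i, P i t}.
Proof.
move=> HP; have : {ae mu, forall t, forall k : nat,
    if unpickle k is Some i then P i t else True}.
  by apply: ae_nat => k; case: unpickle => [i|]; [exact: HP|exact: ae_all].
by apply: ae_mono => t H i; have := H (pickle i); rewrite pickleK.
Qed.

End AlmostEverywhere.

Section AbsolutelyContinuousMonotone.
Context {R : realType}.
Local Notation mu := (@lebesgue_measure R).

Lemma negligible_open_cover (E : set R) (e : R) : 0 < e -> mu.-negligible E ->
  exists O : set R, [/\ open O, E `<=` O & (mu O < e%:E)%E].
Proof.
move=> e0 [B [mB B0 EB]].
have [|O [oO BO Oe]] := @lebesgue_regularity_outer R B e mB _ e0.
  by move: (B0) => /= h; rewrite [X in (X < _)%E]h.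
exists O; split=> //; first exact: subset_trans BO.
have -> : O = B `|` (O `\` B) by rewrite setDUK.
have mO : measurable O by exact: open_measurable.
rewrite measureU //; [by move: (B0) => /= h; rewrite [X in (X + _)%E]h add0e | exact: measurableD |].
by rewrite setDE setICA setICr setI0.
Qed.

(* Disjoint intervals, listed from left to right, inside [O] and between [u] and [v]. *)
Fixpoint ordered_intervals (O : set R) (u : R) (s : seq (R * R)) (v : R) : Prop :=
  if s is p :: s' then
    [/\ u <= p.1, p.1 <= p.2, `]p.1, p.2[%classic `<=` O &
      ordered_intervals O p.2 s' v]
  else u <= v.

Lemma ordered_intervals_le O u s v : ordered_intervals O u s v -> u <= v.
Proof.
elim: s u => [|p s IH] u //= [up p12 _ /IH pv].
exact: le_trans (le_trans up p12) pv.
Qed.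

Lemma ordered_intervals_cat O u v w s1 s2 :
  ordered_intervals O u s1 v -> ordered_intervals O v s2 w ->
  ordered_intervals O u (s1 ++ s2) w.
Proof.
elim: s1 u => [|p s IH] u /=.
  move=> uv; case: s2 => [|q s2] /=; first exact: le_trans.
  by case=> vq *; split=> //; exact: le_trans vq.
by move=> [up p12 sO H] H2; split=> //; apply: IH.
Qed.

Lemma ordered_intervals_nth O u s v (k : nat) : ordered_intervals O u s v ->
  (k < size s)%N ->
  [/\ u <= (nth (0, 0) s k).1, (nth (0, 0) s k).1 <= (nth (0, 0) s k).2,
      (nth (0, 0) s k).2 <= v & `](nth (0, 0) s k).1, (nth (0, 0) s k).2[%classic `<=` O].
Proof.
elim: s u k => [|p s IH] u [|k] //= [up p12 sO H] ks.
  by split=> //; exact: ordered_intervals_le H.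
have [h1 h2 h3 h4] := IH _ _ H ks; split=> //.
exact: le_trans (le_trans up p12) h1.
Qed.

Lemma ordered_intervals_lt O u s v (k l : nat) : ordered_intervals O u s v ->
  (k < l)%N -> (l < size s)%N -> (nth (0, 0) s k).2 <= (nth (0, 0) s l).1.
Proof.
elim: s u k l => [|p s IH] u [|k] [|l] //= [up p12 sO H] kl ls.
  by have [] := ordered_intervals_nth H ls.
exact: IH H _ _.
Qed.

Lemma ordered_intervals_trivIset O u s v : ordered_intervals O u s v ->
  trivIset setT (fun k : 'I_(size s) =>
    `](nth (0, 0) s k).1, (nth (0, 0) s k).2[%classic).
Proof.
move=> H; apply/trivIsetP => i j _ _ ij.
wlog lij : i j ij / (i < j)%N.
  move=> W; case: (ltngtP i j) => [|ji|/ord_inj] ; first exact: W.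
    by rewrite setIC; apply: W => //; rewrite eq_sym.
  by move/eqP; rewrite (negPf ij).
rewrite -subset0 => t [] /=; rewrite !in_itv /= => /andP[_ t1] /andP[t2 _].
have := ordered_intervals_lt H lij (ltn_ord j).
by move=> h; have := lt_trans t1 (le_lt_trans h t2); rewrite ltxx.
Qed.


(** Disjointness turns the sum of lengths into the measure of a union contained in [O]; degenerate
    intervals count 0 on both sides. *)
Lemma ordered_intervals_length (O : set R) u s v (e : R) : open O -> (mu O < e%:E)%E ->
  ordered_intervals O u s v ->
  \sum_(k < size s) ((nth (0, 0) s k).2 - (nth (0, 0) s k).1) < e.
Proof.
move=> oO Oe H; rewrite -lte_fin; apply: le_lt_trans Oe.
pose F (k : 'I_(size s)) := `](nth (0, 0) s k).1, (nth (0, 0) s k).2[%classic : set R.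
have mF k : measurable (F k) by exact: measurable_itv.
have -> : (\sum_(k < size s) ((nth (0, 0) s k).2 - (nth (0, 0) s k).1))%:E =
   (\sum_(k < size s) mu (F k))%E.
  rewrite -sumEFin; apply: eq_bigr => k _.
  rewrite /F lebesgue_measure_itv /= lte_fin -EFinB.
  have [_ h _ _] := ordered_intervals_nth H (ltn_ord k).
  case: ltP => // h2; congr (_%:E); apply/eqP; rewrite subr_eq0.
  by rewrite eq_le h h2.
rewrite -(measure_bigsetU_ord mu xpredT mF (ordered_intervals_trivIset H)).
apply: le_measure; rewrite ?inE.
- by apply: bigsetU_measurable => k _; exact: mF.
- exact: open_measurable.
- apply: (big_ind (fun A => A `<=` O)) => [//|A B AO BO|k _].
    by rewrite subUset.
  by have [_ _ _] := ordered_intervals_nth H (ltn_ord k).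
Qed.

Definition ac_on (a b : R) (F : R -> R) : Prop :=
  forall eps : R, 0 < eps -> exists2 delta : R, 0 < delta &
    forall (p : nat) (al be : 'I_p -> R),
      (forall k, [/\ a <= al k, al k <= be k & be k <= b]) ->
      trivIset setT (fun k => `]al k, be k[%classic) ->
      \sum_(k < p) (be k - al k) < delta ->
      \sum_(k < p) `|F (be k) - F (al k)| < eps.

(** No sign is imposed on [L], and the condition is vacuous when [b < a], so windows [[- a, a]] make
    sense for every real [a]. *)
Definition lip_on (a b L : R) (F : R -> R) : Prop :=
  forall u v, a <= u -> u <= v -> v <= b -> `|F v - F u| <= L * (v - u).

Lemma lip_on_ac a b L F : lip_on a b L F -> ac_on a b F.
Proof.
move=> FL e e0; pose M := `|L| + 1.
have M0 : 0 < M by rewrite /M; have := normr_ge0 L; lra.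
exists (e / M); first exact: divr_gt0.
move=> p al be H _ S.
apply: (@le_lt_trans _ _ (\sum_(k < p) M * (be k - al k))).
  apply: ler_sum => k _; have [h1 h2 h3] := H k.
  apply: (le_trans (FL _ _ h1 h2 h3)); apply: ler_wpM2r; first lra.
  by rewrite /M; have := ler_norm L; lra.
by rewrite -mulr_sumr mulrC -ltr_pdivlMr.
Qed.

(** Multiplying out the difference quotient makes [h = 0] harmless, so later estimates need no case
    distinction at the base point. *)
Lemma is_derive_dirP (W : normedModType R) (G : W -> R) (p v : W) (d : R) :
  is_derive p v G d <->
  forall e, 0 < e -> exists2 r, 0 < r &
    forall h, `|h| < r -> `|G (p + h *: v) - G p - d * h| <= e * `|h|.
Proof.
pose D (h : R) : R := h^-1 *: ((G \o shift p) (h *: v) - G p).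
have DE h : D h = h^-1 * (G (p + h *: v) - G p) by rewrite /D /= [h *: v + p]addrC.
have cvgE : (D h @[h --> 0^'] --> d) <-> forall e, 0 < e -> exists2 r, 0 < r &
    forall h, `|h| < r -> `|G (p + h *: v) - G p - d * h| <= e * `|h|.
  split.
    move=> /cvgrPdist_le H e e0.
    have /H := e0; rewrite /dnbhs near_withinE => /nbhs_ballP[r /= r0 Hr].
    exists r => // h hr; have [->|nh] := eqVneq h 0.
      by rewrite scale0r addr0 subrr mulr0 subr0 normr0 mulr0.
    have /= := Hr h; rewrite /ball /= sub0r normrN => /(_ hr nh).
    rewrite DE => H1.
    have -> : G (p + h *: v) - G p - d * h =
      - (d - h^-1 * (G (p + h *: v) - G p)) * h by field.
    by rewrite normrM normrN; apply: ler_wpM2r.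
  move=> H; apply/cvgrPdist_le => e e0; have [r r0 Hr] := H e e0.
  rewrite /dnbhs near_withinE; apply/nbhs_ballP; exists r => //= h.
  rewrite /ball /= sub0r normrN => hr nh.
  have hh := Hr h hr.
  rewrite DE; have -> : d - h^-1 * (G (p + h *: v) - G p) =
    - (G (p + h *: v) - G p - d * h) * h^-1 by field.
  by rewrite normrM normrN normfV ler_pdivrMr ?normr_gt0.
split.
  by move=> [dF dE]; apply/cvgE; rewrite -dE; exact: dF.
move/cvgE => H; split; first by apply/cvg_ex; exists d; exact: H.
exact/cvg_lim.
Qed.

Lemma is_derive_epsP (F : R -> R) (t d : R) :
  is_derive t 1 F d <->
  forall e, 0 < e -> exists2 r, 0 < r &
    forall s, `|s - t| < r -> `|F s - F t - d * (s - t)| <= e * `|s - t|.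
Proof.
rewrite is_derive_dirP; split=> H e /H[r r0 Hr]; exists r => //.
  move=> s /Hr; rewrite /GRing.scale /= mulr1.
  by have -> : t + (s - t) = s by ring.
move=> h hr; have := Hr (t + h); rewrite /GRing.scale /= mulr1.
have -> : t + h - t = h by ring.
by move=> /(_ hr).
Qed.

(* Away from an open set of small measure that contains the exceptional points,
   small increments are at most [k * length]; inside it absolute continuity applies. *)
Lemma ac_derivative_le0 a b F : a <= b -> ac_on a b F ->
  {ae mu, forall t, a < t < b -> exists2 d, is_derive t 1 F d & d <= 0} ->
  F b <= F a.
Proof.
move=> ab Fac Fd; apply/ler_addgt0Pr => e e0.
have e20 : 0 < e / 2 by lra.
have [dl dl0 Hdl] := Fac _ e20.
have [Z [mZ Z0 ZF]] := Fd.
(* The endpoints join the exceptional set because nothing is assumed about the derivative there. *)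
have [W [oO EO Odl]] : exists W : set R,
    [/\ open W, Z `|` [set a; b] `<=` W & (mu W < dl%:E)%E].
  apply: negligible_open_cover => //.
  apply: negligibleU; first exact/negligibleP.
  by apply: negligibleU; apply/negligibleP => //; exact: lebesgue_measure_set1.
(* A slope with [k * (b - a) <= e / 2]; the added 1 keeps the denominator positive when [a = b]. *)
pose k := e / (2 * (b - a + 1)).
have k0 : 0 < k by rewrite divr_gt0 //; lra.
(* Increments are charged either to the length, with slope [k], or to the variation of [F] on
   intervals inside [W]. Both charges add under concatenation, as [interval_creep] demands. *)
pose P u v := exists2 s, ordered_intervals W u s v &
  F v - F u <= k * (v - u) + \sum_(p <- s) `|F p.2 - F p.1|.
have [|||s sab Fs] := @interval_creep R P a b => //.
- move=> u v w uv vw [s1 H1 F1] [s2 H2 F2]; exists (s1 ++ s2).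
    exact: ordered_intervals_cat H2.
  by rewrite big_cat /=; lra.
- move=> t tab.
  have [/EO Ot|nE] := pselect ((Z `|` [set a; b]) t).
    have /nbhs_ballP[r /= r0 Hr] : nbhs t W by exact: open_nbhs_nbhs.
    exists r => // u v au ut tv vb tu tr.
    exists [:: (u, v)] => /=; last by rewrite big_seq1 /= ler_wpDl //; [
      rewrite mulr_ge0 ?(ltW k0) // subr_ge0; lra | exact: ler_norm].
    split=> //; first lra.
    move=> x /=; rewrite in_itv /= => /andP[ux xv]; apply: Hr.
    by rewrite /ball /= ltr_norml; apply/andP; split; lra.
  have [d dF d0] : exists2 d, is_derive t 1 F d & d <= 0.
    apply: contrapT => nd; apply: (nE); left; apply: ZF => /= h; apply: nd; apply: h.
    have : t != a /\ t != b.
      by split; apply/eqP => tE; apply: (nE); right; [left|right].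
    by move=> [ta tb]; rewrite !lt_neqAle eq_sym ta tb.
  move/is_derive_epsP: dF => /(_ k k0)[r r0 Hr].
  exists r => // u v au ut tv vb tu tr; exists [::] => /=; first lra.
  rewrite big_nil addr0.
  have /ler_normlP[hu _] : `|F u - F t - d * (u - t)| <= k * `|u - t|.
    by apply: Hr; rewrite ltr_norml; apply/andP; split; lra.
  have /ler_normlP[_ hv] : `|F v - F t - d * (v - t)| <= k * `|v - t|.
    by apply: Hr; rewrite ltr_norml; apply/andP; split; lra.
  move: hu hv; rewrite ler0_norm ?subr_le0 // ger0_norm ?subr_ge0 // => hu hv.
  have : d * (v - t) <= 0 by rewrite mulr_le0_ge0 // subr_ge0.
  have : d * (t - u) <= 0 by rewrite mulr_le0_ge0 // subr_ge0.
  move: hu hv; lra.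
have Sle : \sum_(p <- s) `|F p.2 - F p.1| < e / 2.
  rewrite (big_nth (0, 0)) big_mkord.
  apply: Hdl; [|exact: ordered_intervals_trivIset sab|exact: ordered_intervals_length Odl sab].
  by move=> i; have [] := ordered_intervals_nth sab (ltn_ord i).
have kb : k * (b - a) <= e / 2.
  have -> : e / 2 = k * (b - a + 1) by rewrite /k; field; lra.
  by apply: ler_wpM2l; lra.
lra.
Qed.

End AbsolutelyContinuousMonotone.

(** * Lipschitz and absolutely continuous functions of one variable *)

Section Lipschitz.
Context {R : realType}.
Local Notation mu := (@lebesgue_measure R).
Implicit Types (a b L : R) (F G : R -> R).

Lemma lip_derivative_le0 a b L F : a <= b -> lip_on a b L F ->
  {ae mu, forall t, a < t < b -> exists2 d, is_derive t 1 F d & d <= 0} ->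
  F b <= F a.
Proof. by move=> ab /lip_on_ac; exact: ac_derivative_le0. Qed.

Lemma lip_onD a b L L' F G : lip_on a b L F -> lip_on a b L' G ->
  lip_on a b (L + L') (fun t => F t + G t).
Proof.
move=> HF HG u v au uv vb.
have -> : F v + G v - (F u + G u) = (F v - F u) + (G v - G u) by ring.
rewrite mulrDl; apply: (le_trans (ler_normD _ _)).
by apply: lerD; [exact: HF|exact: HG].
Qed.

Lemma lip_onZ a b L F c : lip_on a b L F ->
  lip_on a b (`|c| * L) (fun t => c * F t).
Proof.
move=> HF u v au uv vb; rewrite -mulrBr normrM -mulrA.
by apply: ler_wpM2l => //; exact: HF.
Qed.

Lemma lip_on_sum (I : finType) a b (L : I -> R) (F : I -> R -> R) :
  (forall i, lip_on a b (L i) (F i)) ->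
  lip_on a b (\sum_i L i) (fun t => \sum_i F i t).
Proof.
move=> HF u v au uv vb; rewrite -sumrB mulr_suml.
by apply: (le_trans (ler_norm_sum _ _ _)); apply: ler_sum => i _; exact: HF.
Qed.

Lemma lip_on_id a b : lip_on a b 1 id.
Proof. by move=> u v au uv vb; rewrite mul1r ger0_norm // subr_ge0. Qed.

Lemma lip_on_sub a b a' b' L F : a <= a' -> b' <= b -> lip_on a b L F ->
  lip_on a' b' L F.
Proof. by move=> aa bb H u v ? ? ?; apply: H => //; lra. Qed.

(** The local constants are merged by [Num.max]; an increment that straddles a junction is split
    there. *)
Lemma loclip_lip a b F : a <= b ->
  (forall t, a <= t <= b -> exists r L, 0 < r /\
     forall u v, a <= u -> u <= v -> v <= b -> t - r < u -> v < t + r ->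
       `|F v - F u| <= L * (v - u)) ->
  exists L, lip_on a b L F.
Proof.
move=> ab H.
apply: (@interval_creep R (fun u v => exists L, lip_on u v L F) a b) => //.
- move=> u v w uv vw [L1 H1] [L2 H2]; exists (Num.max L1 L2) => s t us st tw.
  have m1 : L1 <= Num.max L1 L2 by rewrite le_max lexx.
  have m2 : L2 <= Num.max L1 L2 by rewrite le_max lexx orbT.
  have [tv|vt] := leP t v.
    by apply: (le_trans (H1 s t us st tv)); apply: ler_wpM2r => //; lra.
  have [vs|sv] := leP v s.
    by apply: (le_trans (H2 s t vs st tw)); apply: ler_wpM2r => //; lra.
  have -> : F t - F s = (F t - F v) + (F v - F s) by ring.
  have -> : t - s = (t - v) + (v - s) by ring.
  rewrite mulrDr; apply: (le_trans (ler_normD _ _)); apply: lerD.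
    apply: (le_trans (H2 v t (lexx _) (ltW vt) tw)).
    by apply: ler_wpM2r => //; lra.
  apply: (le_trans (H1 s v us (ltW sv) (lexx _))).
  by apply: ler_wpM2r => //; lra.
- move=> t /H[r [L [r0 HL]]]; exists r => // u v au ut tv vb tu tr.
  by exists L => s w us sw wv; apply: HL => //; lra.
Qed.

Lemma ac_onD a b F G : ac_on a b F -> ac_on a b G ->
  ac_on a b (fun t => F t + G t).
Proof.
move=> HF HG e e0; have e20 : 0 < e / 2 by lra.
have [d1 d10 H1] := HF _ e20; have [d2 d20 H2] := HG _ e20.
exists (Num.min d1 d2); first by rewrite lt_min d10 d20.
move=> p al be h1 h2; rewrite lt_min => /andP[s1 s2].
apply: (@le_lt_trans _ _ (\sum_(k < p) `|F (be k) - F (al k)| +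
                          \sum_(k < p) `|G (be k) - G (al k)|)).
  rewrite -big_split /=; apply: ler_sum => k _.
  have -> : F (be k) + G (be k) - (F (al k) + G (al k)) =
    (F (be k) - F (al k)) + (G (be k) - G (al k)) by ring.
  exact: ler_normD.
have := H1 p al be h1 h2 s1; have := H2 p al be h1 h2 s2; lra.
Qed.

Lemma ac_onN a b F : ac_on a b F -> ac_on a b (fun t => - F t).
Proof.
move=> HF e e0; have [d d0 H] := HF _ e0; exists d => // p al be h1 h2 s.
rewrite (eq_bigr (fun k => `|F (be k) - F (al k)|)); first exact: H.
by move=> k _; rewrite -opprD normrN.
Qed.

Lemma ac_on_sub a b a' b' F : a <= a' -> b' <= b -> ac_on a b F -> ac_on a' b' F.
Proof.
move=> aa bb HF e e0; have [d d0 H] := HF _ e0; exists d => // p al be h1.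
by apply: H => k; have [? ? ?] := h1 k; split; lra.
Qed.

(** Monotonicity applied to [F t - M * t] and, after a change of sign, to [- F t - M * t]. *)
Lemma ac_bounded_derivative_lip a b M F : ac_on a b F ->
  {ae mu, forall t, a < t < b -> exists2 d, is_derive t 1 F d & `|d| <= M} ->
  lip_on a b M F.
Proof.
have key u v G : u <= v -> ac_on u v G ->
    {ae mu, forall t, u < t < v -> exists2 d, is_derive t 1 G d & d <= M} ->
    G v - G u <= M * (v - u).
  move=> uv Gac HG.
  suff : G v + (- M) * v <= G u + (- M) * u by lra.
  apply: (@ac_derivative_le0 R u v (fun t => G t + (- M) * t)) => //.
    apply: ac_onD => //; apply: (@lip_on_ac _ _ _ (`|- M| * 1)).
    exact: (lip_onZ _ (@lip_on_id u v)).
  apply: ae_mono HG => t H /H[d dG dM]; exists (d + (- M) * 1); last by lra.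
  exact: is_deriveD.
move=> Fac HF u v au uv vb; rewrite ler_norml; apply/andP; split.
  have := @key u v (fun t => - F t) uv _ _.
  move=> h; suff : - F v - - F u <= M * (v - u) by lra.
  apply: h; first by apply/ac_onN/(ac_on_sub _ _ Fac).
  apply: ae_mono HF => t H tuv; have [|d dF dM] := H; first by lra.
  by exists (- d); [exact: is_deriveN | rewrite (le_trans _ dM) // -normrN ler_norm].
apply: key => //; first exact: ac_on_sub Fac.
apply: ae_mono HF => t H tuv; have [|d dF dM] := H; first by lra.
by exists d => //; rewrite (le_trans _ dM) // ler_norm.
Qed.

End Lipschitz.

(** * The Lyapunov function along solutions *)

Section EuclideanNorm.
Context {R : realType}.

Lemma enorm_ge0 n (v : 'rV[R]_n) : 0 <= enorm v.
Proof. exact: sqrtr_ge0. Qed.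

Lemma coord_le_enorm n (v : 'rV[R]_n) j : `|v 0 j| <= enorm v.
Proof.
rewrite -sqrtr_sqr /enorm; apply: ler_wsqrtr.
rewrite (bigD1 j) //= lerDl; apply: sumr_ge0 => k _; exact: sqr_ge0.
Qed.

Lemma enorm_le_sum n (v : 'rV[R]_n) : enorm v <= \sum_j `|v 0 j|.
Proof.
have S0 : 0 <= \sum_j `|v 0 j| by apply: sumr_ge0.
rewrite -(ger0_norm S0) -sqrtr_sqr; apply: ler_wsqrtr.
rewrite expr2 mulr_suml; apply: ler_sum => j _.
rewrite -(real_normK (num_real _)) expr2; apply: ler_wpM2l => //.
rewrite (bigD1 j) //= lerDl; exact: sumr_ge0.
Qed.

Lemma enorm_scalar (c : R) : enorm (c%:M : 'rV[R]_1) = `|c|.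
Proof. by rewrite /enorm big_ord_recl big_ord0 addr0 mxE mulr1n sqrtr_sqr. Qed.

Lemma continuous_enorm n : continuous (@enorm R n).
Proof.
move=> v; apply: continuous_comp; last exact: sqrt_continuous.
move: v; apply: continuous_big => [|j _ v]; first exact: add_continuous.
apply: (@continuous_comp _ _ _ (fun v : 'rV[R]_n => v 0 j) (fun x => x ^+ 2)).
  exact: coord_continuous.
exact: exprn_continuous.
Qed.

Lemma is_derive_coord n (x : R -> 'rV[R]_n) (t : R) (d : 'rV[R]_n) j :
  is_derive t (1 : R) x d -> is_derive t (1 : R) (fun s => x s 0 j) (d 0 j).
Proof.
move=> [dx dE]; split; first by have /derivable_mxP/(_ 0 j) := dx.
by rewrite -dE derive_mx // mxE.
Qed.

Lemma is_derive_rV n (x : R -> 'rV[R]_n) (t : R) (d : 'rV[R]_n) :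
  (forall j, is_derive t (1 : R) (fun s => x s 0 j) (d 0 j)) -> is_derive t (1 : R) x d.
Proof.
move=> H; have dx : derivable x t 1.
  by apply/derivable_mxP => i j; rewrite ord1; have [] := H j.
split=> //; rewrite derive_mx //; apply/rowP => j; rewrite mxE.
by have [_ ->] := H j.
Qed.

Lemma ball_rVP n (x y : 'rV[R]_n) e : 0 < e ->
  ball x e y <-> forall j, `|x 0 j - y 0 j| < e.
Proof.
by move=> e0; split=> [[_ H] j|H]; [exact: H|split=> // i j; rewrite ord1; exact: H].
Qed.

End EuclideanNorm.

(** * Strict differentiability of the Lyapunov function *)

Section StrictDifferentiability.
Context {R : realType}.

(** Differentiability is asked relative to [[a, b]] only, which admits the one-sided time derivative
    of [V] at 0. A slack slope [k] absorbs the first-order errors while creeping and is then sent to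
    0. *)
Lemma mean_value_ineq (F D : R -> R) (a b d0 e : R) : a <= b ->
  (forall s, a <= s <= b -> forall k, 0 < k -> exists2 r, 0 < r &
     forall w, a <= w <= b -> `|w - s| < r ->
       `|F w - F s - D s * (w - s)| <= k * `|w - s|) ->
  (forall s, a <= s <= b -> `|D s - d0| <= e) ->
  `|F b - F a - d0 * (b - a)| <= e * (b - a).
Proof.
move=> ab HF HD; apply/ler_addgt0Pr => k0 k00.
pose k := k0 / (b - a + 1).
have kp : 0 < k by rewrite divr_gt0 //; lra.
apply: (@le_trans _ _ ((e + k) * (b - a))); last first.
  rewrite mulrDl lerD2l; have -> : k0 = k * (b - a + 1) by rewrite /k; field; lra.
  by apply: ler_wpM2l; lra.
apply: (@interval_creep R (fun u v =>
  `|F v - F u - d0 * (v - u)| <= (e + k) * (v - u)) a b) => //.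
  move=> u v w uv vw H1 H2.
  have -> : F w - F u - d0 * (w - u) =
    (F w - F v - d0 * (w - v)) + (F v - F u - d0 * (v - u)) by ring.
  by apply: (le_trans (ler_normD _ _)); lra.
move=> s sab; have [r r0 Hr] := HF s sab k kp.
exists r => // u v au us sv vb su vr.
have h1 : `|F u - F s - D s * (u - s)| <= k * `|u - s|.
  by apply: Hr; [apply/andP; split; lra | rewrite ltr_norml; apply/andP; split; lra].
have h2 : `|F v - F s - D s * (v - s)| <= k * `|v - s|.
  by apply: Hr; [apply/andP; split; lra | rewrite ltr_norml; apply/andP; split; lra].
have h3 : `|(D s - d0) * (v - u)| <= e * (v - u).
  rewrite normrM [X in _ * X]ger0_norm ?subr_ge0 ?(le_trans us) //.
  by apply: ler_wpM2r; [rewrite subr_ge0 (le_trans us) | exact: HD].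
have -> : F v - F u - d0 * (v - u) = (F v - F s - D s * (v - s)) -
  (F u - F s - D s * (u - s)) + (D s - d0) * (v - u) by ring.
rewrite [X in _ <= _ * X]ler0_norm ?subr_le0 // in h1.
rewrite [X in _ <= _ * X]ger0_norm ?subr_ge0 // in h2.
apply: (le_trans (ler_normD _ _)).
apply: (le_trans (lerD (ler_normB _ _) (lexx _))); lra.
Qed.

Context {n : nat}.
Variables (X : set 'rV[R]_n) (V Vt : R -> 'rV[R]_n -> R) (Vx : R -> 'rV[R]_n -> 'rV[R]_n).
Implicit Types (t e r : R) (xi : 'rV[R]_n).
Hypotheses (Xopen : open X) (VC1 : C1_with X V Vt Vx).

Lemma C1_within_ball t0 xi0 e : 0 <= t0 -> X xi0 -> 0 < e ->
  exists2 r, 0 < r & forall t xi, 0 <= t -> `|t - t0| < r -> ball xi0 r xi ->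
    [/\ X xi, `|Vt t xi - Vt t0 xi0| <= e
      & forall j, `|Vx t xi 0 j - Vx t0 xi0 0 j| <= e].
Proof.
move=> t00 Xxi0 e0; have [_ _ ct cx] := VC1.
have D0 : [set p : R * 'rV[R]_n | 0 <= p.1 /\ X p.2] (t0, xi0) by [].
have /nbhs_ballP[r1 /= r10 H1] : nbhs xi0 X by exact: open_nbhs_nbhs.
have := (subspace_continuousP _ _).1 ct _ D0.
move=> /cvgrPdist_le/(_ e e0); rewrite near_withinE => -[[A B] /= [A0 B0] H2].
have := (subspace_continuousP _ _).1 cx _ D0.
move=> /cvgrPdist_lt/(_ e e0); rewrite near_withinE => -[[A' B'] /= [A0' B0'] H3].
have /nbhs_ballP[r2 /= r20 HA] : nbhs t0 (A `&` A') by exact: filterI.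
have /nbhs_ballP[r3 /= r30 HB] : nbhs xi0 (B `&` B') by exact: filterI.
exists (Num.min r1 (Num.min r2 r3)); first by rewrite !lt_min r10 r20 r30.
move=> t xi tge; rewrite !lt_min => /and3P[tr1 tr2 tr3] bxi.
have Xxi : X xi by apply: H1; apply: le_ball bxi; rewrite ge_min lexx.
have [At At'] : (A `&` A') t by apply: HA; rewrite /ball /= distrC.
have [Bx Bx'] : (B `&` B') xi.
  by apply: HB; apply: le_ball bxi; rewrite !ge_min lexx !orbT.
split=> //.
  have /= := H2 (t, xi) (conj At Bx) (conj tge Xxi).
  by rewrite distrC.
move=> j; have /= := H3 (t, xi) (conj At' Bx') (conj tge Xxi) => H.
have : ball (Vx t0 xi0) e (Vx t xi) by rewrite mx_norm_ball.
move=> /(ball_rVP _ _ e0)/(_ j) h; rewrite distrC; exact: ltW.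
Qed.

Lemma V_time_incr t0 xi0 e r : (forall t xi, 0 <= t -> `|t - t0| < r -> ball xi0 r xi ->
    [/\ X xi, `|Vt t xi - Vt t0 xi0| <= e
      & forall j, `|Vx t xi 0 j - Vx t0 xi0 0 j| <= e]) ->
  forall t t' xi, 0 <= t -> t <= t' -> `|t - t0| < r -> `|t' - t0| < r -> ball xi0 r xi ->
    `|V t' xi - V t xi - Vt t0 xi0 * (t' - t)| <= e * (t' - t).
Proof.
move=> Hr t t' xi tge tt' tr tr' bxi; have [Vd _ _ _] := VC1.
have inr s : t <= s <= t' -> 0 <= s /\ `|s - t0| < r.
  move=> /andP[h1 h2]; split; first exact: le_trans h1.
  by move: tr tr'; rewrite !ltr_norml => /andP[? ?] /andP[? ?]; apply/andP; split; lra.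
apply: (@mean_value_ineq (fun s => V s xi) (fun s => Vt s xi)) => //; last first.
  by move=> s /inr[s0 sr]; have [] := Hr s xi s0 sr bxi.
move=> s /inr[s0 sr] k k0; have [Xxi _ _] := Hr s xi s0 sr bxi.
move: (Vd s xi s0 Xxi) => /cvgrPdist_le/(_ k k0).
rewrite near_withinE /dnbhs near_withinE => /nbhs_ballP[q /= q0 Hq].
exists q => // w wtt' ws; have [w0 _] := inr w wtt'.
have [->|nws] := eqVneq w s; first by rewrite !subrr mulr0 subr0 normr0 mulr0.
have nz : w - s != 0 by rewrite subr_eq0.
have := Hq (w - s); rewrite /ball /= sub0r normrN => /(_ ws nz).
rewrite [s + _]addrC subrK => /(_ w0) h.
have -> : V w xi - V s xi - Vt s xi * (w - s) =
  - (Vt s xi - (V w xi - V s xi) / (w - s)) * (w - s) by field.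
by rewrite normrM normrN; apply: ler_wpM2r.
Qed.

(** Along [y] a single coordinate moves. Balls of the sup norm are boxes, so the path stays in the
    ball as soon as its ends do. *)
Lemma V_coord_incr t0 xi0 e r t (z : 'rV[R]_n) k (c : R) : 0 < r ->
  (forall t xi, 0 <= t -> `|t - t0| < r -> ball xi0 r xi ->
    [/\ X xi, `|Vt t xi - Vt t0 xi0| <= e
      & forall j, `|Vx t xi 0 j - Vx t0 xi0 0 j| <= e]) ->
  0 <= t -> `|t - t0| < r -> ball xi0 r z -> `|xi0 0 k - c| < r ->
  `|V t (z + (c - z 0 k) *: delta_mx 0 k) - V t z - Vx t0 xi0 0 k * (c - z 0 k)|
     <= e * `|c - z 0 k|.
Proof.
move=> r0 Hr tge tr bz cr; have [_ Vd _ _] := VC1.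
pose y s := z + (s - z 0 k) *: delta_mx 0 k : 'rV[R]_n.
have ys w s : y w = y s + (w - s) *: delta_mx 0 k.
  by rewrite /y -addrA -scalerDl; congr (_ + _ *: _); ring.
have yE j s : y s 0 j = if j == k then s else z 0 j.
  rewrite !mxE eqxx /= eq_sym; case: eqVneq => [->|_]; last by rewrite mulr0 addr0.
  by rewrite mulr1 addrC subrK.
have yz : y (z 0 k) = z by rewrite /y subrr scale0r addr0.
have by_ s : `|xi0 0 k - s| < r -> ball xi0 r (y s).
  move=> sr; apply/ball_rVP => // j; rewrite yE; case: eqVneq => [->//|_].
  by have := (ball_rVP _ _ r0).1 bz j.
have zr := (ball_rVP _ _ r0).1 bz k.
have gen a b : a <= b -> `|xi0 0 k - a| < r -> `|xi0 0 k - b| < r ->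
    `|V t (y b) - V t (y a) - Vx t0 xi0 0 k * (b - a)| <= e * (b - a).
  move=> ab ar br.
  have inr s : a <= s <= b -> `|xi0 0 k - s| < r.
    move=> /andP[h1 h2].
    by move: ar br; rewrite !ltr_norml => /andP[? ?] /andP[? ?]; apply/andP; split; lra.
  apply: (@mean_value_ineq (fun s => V t (y s)) (fun s => Vx t (y s) 0 k)) => //; last first.
    by move=> s /inr/by_ /(Hr t _ tge tr)[].
  move=> s /inr/by_ /(Hr t _ tge tr)[Xy _ _] q q0.
  have /is_derive_dirP/(_ q q0)[p p0 Hp] := Vd t (y s) k tge Xy.
  by exists p => // w _ wp; rewrite (ys w s); exact: Hp.
have -> : V t z = V t (y (z 0 k)) by rewrite yz.
rewrite -/(y c); have [zc|cz] := leP (z 0 k) c.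
  by rewrite [in leRHS]ger0_norm ?subr_ge0 //; exact: gen.
rewrite [in leRHS]ltr0_norm ?subr_lt0 // opprB -normrN.
have -> : - (V t (y c) - V t (y (z 0 k)) - Vx t0 xi0 0 k * (c - z 0 k)) =
  V t (y (z 0 k)) - V t (y c) - Vx t0 xi0 0 k * (z 0 k - c) by ring.
by apply: gen => //; exact: ltW.
Qed.

(** Neither point is the base point [(t0, xi0)]: this strict form yields the chain rule and a local
    Lipschitz bound alike. Time and coordinates are changed one at a time, and the partial
    derivatives vary by at most [e] on the way. *)
Lemma C1_strict t0 xi0 e : 0 <= t0 -> X xi0 -> 0 < e -> exists2 r, 0 < r &
  forall t t' xi xi', 0 <= t -> 0 <= t' -> `|t - t0| < r -> `|t' - t0| < r ->
    ball xi0 r xi -> ball xi0 r xi' ->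
    `|V t' xi' - V t xi - (Vt t0 xi0 * (t' - t) +
       \sum_j Vx t0 xi0 0 j * (xi' 0 j - xi 0 j))|
    <= e * (`|t' - t| + \sum_j `|xi' 0 j - xi 0 j|).
Proof.
move=> t00 Xxi0 e0; have [r r0 Hr] := C1_within_ball t00 Xxi0 e0.
exists r => // t t' xi xi' tge tge' tr tr' bxi bxi'.
have h1 : `|V t' xi' - V t xi' - Vt t0 xi0 * (t' - t)| <= e * `|t' - t|.
  have [tt'|t't] := leP t t'.
    by rewrite [in leRHS]ger0_norm ?subr_ge0 //; exact: V_time_incr Hr _ _ _ _ _ _ _ _.
  rewrite [in leRHS]ltr0_norm ?subr_lt0 // opprB -normrN.
  have -> : - (V t' xi' - V t xi' - Vt t0 xi0 * (t' - t)) =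
    V t xi' - V t' xi' - Vt t0 xi0 * (t - t') by ring.
  by apply: V_time_incr Hr _ _ _ _ _ _ _ _ => //; exact: ltW.
(* [z k] takes its first [k] coordinates from [xi'] and the others from [xi]; consecutive points
   differ in one coordinate and stay in the same box. *)
pose z (k : nat) : 'rV[R]_n := \row_j (if (j < k)%N then xi' 0 j else xi 0 j).
have z0 : z 0%N = xi by apply/rowP => j; rewrite mxE.
have zn : z n = xi' by apply/rowP => j; rewrite mxE ltn_ord.
have bx := (ball_rVP _ _ r0).1 bxi; have bx' := (ball_rVP _ _ r0).1 bxi'.
have bz k : ball xi0 r (z k).
  by apply/ball_rVP => // j; rewrite mxE; case: ifP.
have zk (k : 'I_n) : z k 0 k = xi 0 k by rewrite mxE ltnn.
have zS (k : 'I_n) : z k.+1 = z k + (xi' 0 k - z k 0 k) *: delta_mx 0 k.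
  rewrite zk; apply/rowP => j; rewrite !mxE eqxx /= ltnS leq_eqVlt -val_eqE /=.
  case: eqVneq => [/val_inj ->|_] /=; last by rewrite mulr0 addr0.
  by rewrite ltnn mulr1 addrC subrK.
have h2 : `|V t xi' - V t xi - \sum_j Vx t0 xi0 0 j * (xi' 0 j - xi 0 j)| <=
    e * \sum_j `|xi' 0 j - xi 0 j|.
  have -> : V t xi' - V t xi = \sum_(k < n) (V t (z k.+1) - V t (z k)).
    by rewrite -(big_mkord xpredT (fun k => V t (z k.+1) - V t (z k)))
      telescope_sumr // zn z0.
  rewrite -sumrB mulr_sumr; apply: (le_trans (ler_norm_sum _ _ _)).
  apply: ler_sum => k _; rewrite zS -(zk k).
  exact: V_coord_incr Hr _ _ _ _.
have -> : V t' xi' - V t xi - (Vt t0 xi0 * (t' - t) +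
       \sum_j Vx t0 xi0 0 j * (xi' 0 j - xi 0 j)) =
  (V t' xi' - V t xi' - Vt t0 xi0 * (t' - t)) +
  (V t xi' - V t xi - \sum_j Vx t0 xi0 0 j * (xi' 0 j - xi 0 j)) by ring.
by apply: (le_trans (ler_normD _ _)); rewrite [leRHS]mulrDr; exact: lerD.
Qed.

End StrictDifferentiability.

(** * Chain rule along a curve of states *)

Section ChainRule.
Context {R : realType}.
Local Notation mu := (@lebesgue_measure R).

Lemma fin_radius (I : finType) (t : R) (P : I -> R -> Prop) :
  (forall i, exists2 r : R, 0 < r & forall s, `|s - t| < r -> P i s) ->
  exists2 r : R, 0 < r & forall s, `|s - t| < r -> forall i, P i s.
Proof.
move=> H; have /nbhs_ballP[r /= r0 Hr] : \forall s \near t, forall i, P i s.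
  apply: (@filter_forall _ _ P (nbhs t) _) => i; have [r r0 Hr] := H i.
  by apply/nbhs_ballP; exists r => //= s; rewrite /ball /= distrC => /Hr.
by exists r => // s st; apply: Hr; rewrite /ball /= distrC.
Qed.

Lemma abs_continuous_coord n a b (x : R -> 'rV[R]_n) j :
  abs_continuous_on a b x -> ac_on a b (fun s => x s 0 j).
Proof.
move=> H e e0; have [d d0 Hd] := H e e0; exists d => // p al be h1 h2 h3.
apply: le_lt_trans (Hd p al be h1 h2 h3); apply: ler_sum => k _.
by have := coord_le_enorm (x (be k) - x (al k)) j; rewrite !mxE.
Qed.

Lemma ac_on_continuous a b (F : R -> R) t e : ac_on a b F -> a <= t <= b -> 0 < e ->
  exists2 r, 0 < r & forall s, `|s - t| < r -> a <= s <= b -> `|F s - F t| < e.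
Proof.
move=> H tab e0; have [d d0 Hd] := H e e0; exists d => //.
have key u v : a <= u -> u <= v -> v <= b -> v - u < d -> `|F v - F u| < e.
  move=> au uv vb uvd.
  have := Hd 1%N (fun=> u) (fun=> v); rewrite !big_ord_recl !big_ord0 !addr0.
  move=> h; apply: h => //.
  by apply/trivIsetP => i j; rewrite !ord1 eqxx.
move=> s std /andP[as_ sb]; case/andP: tab => at_ tb.
have [ts|st] := leP t s.
  by apply: key => //; apply: le_lt_trans std; exact: ler_norm.
rewrite distrC; apply: key => //; first exact: ltW.
by apply: le_lt_trans std; rewrite distrC; exact: ler_norm.
Qed.

Context {n : nat}.
Variables (X : set 'rV[R]_n) (V Vt : R -> 'rV[R]_n -> R) (Vx : R -> 'rV[R]_n -> 'rV[R]_n).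
Hypotheses (Xopen : open X) (VC1 : C1_with X V Vt Vx).

Lemma C1_chain_rule (x : R -> 'rV[R]_n) (t : R) (d : 'rV[R]_n) : 0 < t -> X (x t) ->
  is_derive t (1 : R) x d ->
  is_derive t (1 : R) (fun s => V s (x s))
    (Vt t (x t) + \sum_j Vx t (x t) 0 j * d 0 j).
Proof.
move=> t0 Xx dx; apply/is_derive_epsP => e e0.
pose C := \sum_j `|Vx t (x t) 0 j|.
pose S := \sum_j (`|d 0 j| + 1).
have C0 : 0 <= C by apply: sumr_ge0.
have S0 : 0 <= S by apply: sumr_ge0 => j _; rewrite addr_ge0.
(* Tolerance for the coordinates of [x]: [k * C <= e / 2] pays for the factor [Vx], and [k <= 1]
   gives the increments the constants [|d_j| + 1] collected in [S]. *)
pose k := Num.min 1 (e / 2 / (C + 1)).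
have k0 : 0 < k by rewrite lt_min ltr01 /=; rewrite !divr_gt0 //; lra.
have kC : k * C <= e / 2.
  apply: (@le_trans _ _ (e / 2 / (C + 1) * C)).
    by apply: ler_wpM2r => //; rewrite ge_min lexx orbT.
  by rewrite -mulrA ler_piMr // ?ler_pdivrMl; lra.
have k1 : k <= 1 by rewrite ge_min lexx.
pose e' := e / 2 / (S + 1).
have e'0 : 0 < e' by rewrite !divr_gt0 //; lra.
have e'S : e' * (1 + S) <= e / 2 by rewrite addrC mulfVK //; lra.
have [r r0 Hr] := C1_strict Xopen VC1 (ltW t0) Xx e'0.
have [q q0 Hq] : exists2 q : R, 0 < q & forall s, `|s - t| < q -> forall j,
    `|x s 0 j - x t 0 j - d 0 j * (s - t)| <= k * `|s - t|.
  by apply: fin_radius => j; exact: (is_derive_epsP _ _ _).1 (is_derive_coord j dx) _ k0.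
have xs s : `|s - t| < q -> forall j, `|x s 0 j - x t 0 j| <= (`|d 0 j| + 1) * `|s - t|.
  move=> /Hq H j.
  have -> : x s 0 j - x t 0 j = (x s 0 j - x t 0 j - d 0 j * (s - t)) + d 0 j * (s - t) by ring.
  apply: (le_trans (ler_normD _ _)); rewrite mulrDl mul1r addrC normrM lerD2l.
  by apply: (le_trans (H j)); rewrite -[leRHS]mul1r; apply: ler_wpM2r.
(* The bound [t] keeps [s] nonnegative, and [r / (S + 1)] keeps [x s] in the ball where [V] is
   controlled. *)
pose p := Num.min (Num.min q t) (Num.min r (r / (S + 1))).
have p0 : 0 < p by rewrite !lt_min q0 t0 r0 divr_gt0 //; lra.
exists p => // s; rewrite !lt_min => /andP[/andP[sq st] /andP[sr srS]].
have s0 : 0 <= s by move: st; rewrite ltr_norml => /andP[? ?]; lra.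
have bs : ball (x t) r (x s).
  apply/ball_rVP => // j; rewrite distrC; apply: (le_lt_trans (xs s sq j)).
  apply: (@le_lt_trans _ _ ((S + 1) * `|s - t|)).
    apply: ler_wpM2r => //; rewrite /S (bigD1 j) //= -addrA lerDl.
    by rewrite addr_ge0 // sumr_ge0 // => i _; rewrite addr_ge0.
  by rewrite mulrC -ltr_pdivlMr //; lra.
have tt : `|t - t| < r by rewrite subrr normr0.
have := Hr t s (x t) (x s) (ltW t0) s0 tt sr (ballxx _ r0) bs.
set B := \sum_j Vx _ _ _ _ * _ => HB.
have Bd : `|B - (\sum_j Vx t (x t) 0 j * d 0 j) * (s - t)| <= e / 2 * `|s - t|.
  rewrite mulr_suml -sumrB; apply: (le_trans (ler_norm_sum _ _ _)).
  apply: (@le_trans _ _ (k * C * `|s - t|)); last exact: ler_wpM2r.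
  rewrite mulrAC mulr_sumr; apply: ler_sum => j _.
  have -> : Vx t (x t) 0 j * (x s 0 j - x t 0 j) - Vx t (x t) 0 j * d 0 j * (s - t) =
    Vx t (x t) 0 j * (x s 0 j - x t 0 j - d 0 j * (s - t)) by ring.
  by rewrite normrM mulrC; apply: ler_wpM2r => //; exact: Hq.
have HB' : `|V s (x s) - V t (x t) - (Vt t (x t) * (s - t) + B)| <= e / 2 * `|s - t|.
  apply: (le_trans HB); apply: (@le_trans _ _ (e' * (1 + S) * `|s - t|)); last exact: ler_wpM2r.
  rewrite -mulrA; apply: ler_wpM2l; first exact: ltW.
  rewrite mulrDl mul1r lerD2l mulr_suml; apply: ler_sum => j _; exact: xs.
have -> : V s (x s) - V t (x t) -
   (Vt t (x t) + \sum_j Vx t (x t) 0 j * d 0 j) * (s - t) =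
  (V s (x s) - V t (x t) - (Vt t (x t) * (s - t) + B)) +
  (B - (\sum_j Vx t (x t) 0 j * d 0 j) * (s - t)) by ring.
by apply: (le_trans (ler_normD _ _)); lra.
Qed.

End ChainRule.

(** * Lipschitz bounds and dissipation along solutions *)

Section Solutions.
Context {R : realType} {n N : nat}.
Local Notation mu := (@lebesgue_measure R).
Implicit Types (X : set 'rV[R]_n) (p : switched_path R n N).

Lemma uniformly_bounded_fin m X (g : 'I_N -> R -> 'rV[R]_n -> 'rV[R]_m) K :
  (forall i, uniformly_bounded (@Rge0 R) X (g i)) -> compact K -> K `<=` X ->
  exists2 M : R, 0 <= M &
   {ae mu, forall t, 0 <= t -> forall i xi, K xi -> enorm (g i t xi) <= M}.
Proof.
move=> H cK KX.
have /choice[Mf HM] : forall i, exists M : R,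
    {ae mu, forall t, 0 <= t -> forall xi, K xi -> enorm (g i t xi) <= M}.
  move=> i; have [J [JJ nJ HJ]] := H i; have [M HM] := HJ K cK KX; exists M.
  apply: negligibleS nJ => t /= /not_implyP[t0 nt]; split=> // Jt; apply: nt => xi.
  exact: HM.
exists (\sum_i `|Mf i|); first exact: sumr_ge0.
apply: ae_mono (ae_count HM) => t Ht t0 i xi Kxi.
apply: (le_trans (Ht i t0 xi Kxi)); apply: (le_trans (ler_norm _)).
by rewrite (bigD1 i) //= lerDl sumr_ge0.
Qed.

Variables (X : set 'rV[R]_n) (f : 'I_N -> R -> 'rV[R]_n -> 'rV[R]_n).
Hypothesis fbnd : forall i, uniformly_bounded (@Rge0 R) X (f i).

(** [M] is chosen before the solution: it serves all of them at once and is the source of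
    equicontinuity. *)
Lemma solution_lip K : compact K -> K `<=` X -> exists2 M : R, 0 <= M &
  forall p a b, solution X f p -> t0 p <= a -> (b%:E < tf p)%E ->
    (forall t, a <= t <= b -> K (state p t)) ->
    forall j, lip_on a b M (fun t => state p t 0 j).
Proof.
move=> cK KX; have [M M0 HM] := uniformly_bounded_fin fbnd cK KX.
exists M => // p a b [p0 _ _ pac pd] pa bp pK j.
have [ab|ba] := leP a b; last by move=> u v *; exfalso; lra.
apply: ac_bounded_derivative_lip; first by apply: abs_continuous_coord; exact: pac.
apply: ae_mono (ae_and HM pd) => t [Ht dt] /andP[at_ tb].
exists (f (signal p t) t (state p t) 0 j).
  apply: is_derive_coord; apply: dt; first by lra.
  by apply: lt_trans bp; rewrite lte_fin.
apply: (le_trans (coord_le_enorm _ _)); apply: Ht; first lra.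
by apply: pK; lra.
Qed.

Variables (V Vt : R -> 'rV[R]_n -> R) (Vx : R -> 'rV[R]_n -> 'rV[R]_n).
Hypotheses (Xopen : open X) (VC1 : C1_with X V Vt Vx).

(** Needed to integrate the almost everywhere inequality for [V]. Near each time the state stays in
    a small box, where it is Lipschitz, and [C1_strict] passes this on to [V]. *)
Lemma solution_V_lip p a b : solution X f p -> t0 p <= a -> a <= b -> (b%:E < tf p)%E ->
  exists L, lip_on a b L (fun t => V t (state p t)).
Proof.
move=> sp pa ab bp; have [p0 _ pX pac pd] := sp.
apply: loclip_lip => // t /andP[at_ tb].
have Xt : X (state p t).
  by apply: pX; [lra | apply: le_lt_trans bp; rewrite lee_fin].
have t0_ : 0 <= t by lra.
have [r r0 Hr] := C1_strict Xopen VC1 t0_ Xt ltr01.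
have /nbhs_ballP[r1 /= r10 H1] : nbhs (state p t) X by exact: open_nbhs_nbhs.
pose q := Num.min r r1 / 2.
have q0 : 0 < q by rewrite divr_gt0 // lt_min r0.
have [qr qr1] : q < r /\ q < r1.
  have h1 : Num.min r r1 <= r by rewrite ge_min lexx.
  have h2 : Num.min r r1 <= r1 by rewrite ge_min lexx orbT.
  by move: q0; rewrite /q; split; lra.
(* A closed box of half-width [q], inside [X] and inside the ball given by [C1_strict]; continuity
   keeps the state in it near [t]. *)
pose K := [set v : 'rV[R]_n | forall j, `[state p t 0 j - q, state p t 0 j + q]%classic (v 0 j)].
have cK : compact K by apply: (rV_compact (A := fun j => `[state p t 0 j - q, state p t 0 j + q]%classic)) => j; exact: segment_compact.
have KE v : K v -> forall j, `|state p t 0 j - v 0 j| <= q.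
  move=> Kv j; have := Kv j; rewrite /= in_itv /= => /andP[? ?].
  by rewrite ler_norml; apply/andP; split; lra.
have KX : K `<=` X.
  move=> v /KE Kv; apply: H1; apply/ball_rVP => // j; exact: le_lt_trans (Kv j) _.
have [M M0 HM] := solution_lip cK KX.
have [s s0 Hs] : exists2 s : R, 0 < s & forall w, `|w - t| < s -> forall j,
    a <= w <= b -> `|state p w 0 j - state p t 0 j| < q.
  apply: fin_radius => j; apply: (ac_on_continuous (a := a) (b := b)) => //; last by rewrite at_.
  exact: abs_continuous_coord (pac _ _ pa ab bp).
(* The terms bound the time derivative, the space derivative and the first-order error, the last one
   with tolerance 1. *)
pose C := `|Vt t (state p t)| + \sum_j `|Vx t (state p t) 0 j| * M + 1 * (1 + \sum_(j < n) M).
exists (Num.min s r), C; split; first by rewrite lt_min s0.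
move=> u v au uv vb tu vt.
have [sm rm] : Num.min s r <= s /\ Num.min s r <= r by rewrite !ge_min !lexx orbT.
have near w : u <= w <= v -> `|w - t| < s /\ `|w - t| < r.
  by move=> /andP[? ?]; split; rewrite ltr_norml; apply/andP; split; lra.
have inK w : u <= w <= v -> K (state p w).
  move=> uwv; have [ws _] := near w uwv; move=> j.
  have := Hs w ws j; rewrite ltr_norml /= in_itv /= => /(_ _)/andP[].
    by case/andP: uwv => *; apply/andP; split; lra.
  by move=> *; apply/andP; split; lra.
have xL := HM p u v sp (le_trans pa au) (le_lt_trans _ bp) inK.
have {}xL j : `|state p v 0 j - state p u 0 j| <= M * (v - u).
  by apply: xL => //; rewrite lee_fin.
have ub : u <= u <= v by rewrite lexx.
have vb' : u <= v <= v by rewrite uv lexx.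
have inb w : u <= w <= v -> ball (state p t) r (state p w).
  move=> /inK/KE h; apply/ball_rVP => // j; exact: le_lt_trans (h j) _.
have [_ ur] := near u ub; have [_ vr] := near v vb'.
have u0 : 0 <= u by lra.
have v0 : 0 <= v by lra.
have := Hr u v _ _ u0 v0 ur vr (inb u ub) (inb v vb').
set A := _ - V u _; set B := _ + \sum_j _ => HAB.
have -> : A = (A - B) + B by ring.
apply: (le_trans (ler_normD _ _)); rewrite addrC mulrDl; apply: lerD.
  apply: (le_trans (ler_normD _ _)); rewrite mulrDl; apply: lerD.
    by rewrite normrM; apply: ler_wpM2l => //; rewrite ger0_norm // subr_ge0.
  rewrite mulr_suml; apply: (le_trans (ler_norm_sum _ _ _)); apply: ler_sum => j _.
  by rewrite normrM -mulrA; apply: ler_wpM2l.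
apply: (le_trans HAB); rewrite !mul1r mulrDl mul1r mulr_suml; apply: lerD.
  by rewrite ger0_norm // subr_ge0.
by apply: ler_sum => j _.
Qed.

Lemma solution_V_derive p : solution X f p ->
  {ae mu, forall t, t0 p < t -> (t%:E < tf p)%E ->
     is_derive t (1 : R) (fun s => V s (state p s))
      (Vt t (state p t) + \sum_j Vx t (state p t) 0 j * f (signal p t) t (state p t) 0 j)}.
Proof.
move=> [p0 _ pX pac pd]; apply: ae_mono pd => t dt pt tp.
apply: (C1_chain_rule Xopen VC1); first exact: le_lt_trans p0 pt.
  exact: pX (ltW pt) tp.
exact: dt (ltW pt) tp.
Qed.

Variable eta : 'I_N -> R -> 'rV[R]_n -> R.
Hypotheses (eta0 : forall i t xi, 0 <= t -> X xi -> 0 <= eta i t xi)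
  (Vdot : forall i (t : R) (xi : 'rV[R]_n), 0 <= t -> X xi ->
     Vt t xi + \sum_(j < n) Vx t xi 0 j * f i t xi 0 j <= - eta i t xi).

Lemma solution_V_dissipation p : solution X f p ->
  {ae mu, forall t, t0 p < t -> (t%:E < tf p)%E ->
     exists2 d, is_derive t (1 : R) (fun s => V s (state p s)) d &
       d <= - eta (signal p t) t (state p t)}.
Proof.
move=> sp; apply: ae_mono (solution_V_derive sp) => t dt pt tp.
have [p0 _ pX _ _] := sp.
eexists; first exact: dt.
by apply: Vdot; [exact: ltW (le_lt_trans p0 pt) | exact: pX (ltW pt) tp].
Qed.

Lemma solution_V_nonincreasing p a b : solution X f p -> t0 p <= a -> a <= b ->
  (b%:E < tf p)%E -> V b (state p b) <= V a (state p a).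
Proof.
move=> sp pa ab bp; have [L HL] := solution_V_lip sp pa ab bp.
apply: (lip_derivative_le0 ab HL).
apply: ae_mono (solution_V_dissipation sp) => t H /andP[at_ tb].
have pt : t0 p < t by exact: le_lt_trans at_.
have tp : (t%:E < tf p)%E by apply: lt_trans bp; rewrite lte_fin.
have [d dV dle] := H pt tp; exists d => //; apply: (le_trans dle); rewrite oppr_le0.
have [p0 _ pX _ _] := sp.
by apply: eta0; [lra | exact: pX (ltW pt) tp].
Qed.

End Solutions.

(** * Lebesgue measurable functions up to null sets, and their primitives *)

Section AeBorel.
Context {R : realType}.
Local Notation mu := (@lebesgue_measure R).
Implicit Types g h : R -> R.

(** Lebesgue measurability encoded by a Borel representative, because integrals over
    [lebesgue_measure] refer to the Borel sigma-algebra. *)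
Definition ae_borel g : Prop := exists2 h : R -> R,
  measurable_fun [set: R] h & {ae mu, forall t, g t = h t}.

Lemma ae_borelE g : ae_borel g -> exists h : R -> R,
  measurable_fun [set: R] h /\ {ae mu, forall t, g t = h t}.
Proof. by move=> [h mh gh]; exists h. Qed.

Lemma measurable_ae_borel g : measurable_fun [set: R] g -> ae_borel g.
Proof. by move=> mg; exists g => //; exact: ae_all. Qed.

Lemma ae_borel_eq g h : {ae mu, forall t, g t = h t} -> ae_borel h -> ae_borel g.
Proof.
move=> gh [k mk hk]; exists k => //.
by apply: ae_mono (ae_and gh hk) => t [-> ->].
Qed.

Lemma ae_conull (P : R -> Prop) : {ae mu, forall t, P t} ->
  exists Z : set R, [/\ measurable Z, mu Z = 0 & forall t, ~ Z t -> P t].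
Proof.
move=> [Z [mZ Z0 PZ]]; exists Z; split=> // t nZ.
by apply: contrapT => nP; apply: nZ; exact: PZ.
Qed.

Lemma conull_ae (Z : set R) (P : R -> Prop) : measurable Z -> mu Z = 0 ->
  (forall t, ~ Z t -> P t) -> {ae mu, forall t, P t}.
Proof.
move=> mZ Z0 PZ; exists Z; split=> // t nP.
by apply: contrapT => nZ; apply: nP; exact: PZ.
Qed.

Lemma measurable_patch0 (Z : set R) g : measurable Z -> measurable_fun [set: R] g ->
  measurable_fun [set: R] (g \_ (~` Z)).
Proof.
move=> mZ mg; apply/(measurable_restrictT _ _).1; first exact: measurableC.
exact: measurable_funS mg.
Qed.

Lemma patchC_notin (Z : set R) g t : ~ Z t -> (g \_ (~` Z)) t = g t.
Proof. by move=> nZ; rewrite patchE mem_set. Qed.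

Lemma patchC_in (Z : set R) g t : Z t -> (g \_ (~` Z)) t = 0.
Proof. by move=> nZ; rewrite patchE memNset //; apply. Qed.

(** The exceptional sets of the representatives and of the convergence are merged into one null set;
    setting everything to 0 there makes the convergence hold everywhere. *)
Lemma ae_borel_cvg (g_ : nat -> R -> R) g : (forall k, ae_borel (g_ k)) ->
  {ae mu, forall t, g_ k t @[k --> \oo] --> g t} -> ae_borel g.
Proof.
move=> bg gc; have /choice[h_ Hh] k := ae_borelE (bg k).
have mh k : measurable_fun [set: R] (h_ k) by have [] := Hh k.
have /ae_conull[Z [mZ Z0 HZ]] : {ae mu, forall t,
    g_ k t @[k --> \oo] --> g t /\ forall k, g_ k t = h_ k t}.
  by apply: ae_and => //; apply: ae_nat => k; have [] := Hh k.
exists (g \_ (~` Z)); last first.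
  by apply: (conull_ae mZ Z0) => t nZ; rewrite patchC_notin.
apply: (@measurable_fun_cvg _ _ R setT (fun k => h_ k \_ (~` Z))).
  by move=> k; exact: measurable_patch0.
move=> t _; have [Zt|nZ] := pselect (Z t).
  rewrite patchC_in //; under eq_cvg do rewrite patchC_in //.
  exact: cvg_cst.
have [gt ht] := HZ t nZ; rewrite patchC_notin //.
by under eq_cvg do rewrite patchC_notin // -ht.
Qed.

Lemma ae_borel_pieces (I : countType) (p : R -> I) (g_ : I -> R -> R) :
  (forall i, measurable [set t | p t = i]) -> (forall i, ae_borel (g_ i)) ->
  ae_borel (fun t => g_ (p t) t).
Proof.
move=> mp bg; have /choice[h_ Hh] i := ae_borelE (bg i).
have mh i : measurable_fun [set: R] (h_ i) by have [] := Hh i.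
exists (fun t => h_ (p t) t).
  move=> _ B mB; rewrite setTI.
  have -> : (fun t => h_ (p t) t) @^-1` B =
      \bigcup_(i in [set: I]) ([set t | p t = i] `&` (h_ i @^-1` B)).
    apply/seteqP; split=> [t Bt|t [i _ [/= <-]]] //=.
    by exists (p t).
  apply: countable_bigcupT_measurable; first exact: countableP.
  by move=> i; apply: measurableI => //; rewrite -[X in measurable X]setTI; exact: mh.
have : {ae mu, forall t i, g_ i t = h_ i t} by apply: ae_count => i; have [] := Hh i.
by apply: ae_mono => t.
Qed.

Lemma lebesgue_measurable_borelU (A : set R) : measurable (A : set (lebesgueType R)) ->
  exists B Z : set R, [/\ measurable B, measurable Z, mu Z = 0 &
    forall t, ~ Z t -> (A t <-> B t)].
Proof.
move=> mA; have : (completed_algebra_gen mu) A.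
  by rewrite -g_sigma_completed_algebra_genE completed_caratheodory_measurable.
move=> [B mB [Z0 [Z [mZ mZ0 Z0Z]] <-]]; exists B, Z; split=> // t nZ.
by split=> [[//|/Z0Z]|Bt]; [|left].
Qed.

(** The sublevel sets at rational levels agree with Borel sets off one common null set, and they
    determine the function. *)
Lemma lebesgue_measurable_ae_borel g : lebesgue_measurable_fun setT g -> ae_borel g.
Proof.
move=> mg.
have mA (q : rat) : measurable ([set t | g t < ratr q] : set (lebesgueType R)).
  have := mg measurableT [set x | x < ratr q]; rewrite setTI; apply.
  by rewrite -set_itvNyo; exact: measurable_itv.
have /choice[B HB] : forall q : rat, exists B : set R, exists Z : set R,
    [/\ measurable B, measurable Z, mu Z = 0 &
    forall t, ~ Z t -> (g t < ratr q <-> B t)].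
  by move=> q; exact: lebesgue_measurable_borelU (mA q).
have /choice[Zq HZ] := HB.
have /ae_conull[Z [mZ Z0 ZH]] : {ae mu, forall t (q : rat), g t < ratr q <-> B q t}.
  apply: ae_count => q; have [_ m0 z0 h] := HZ q; exact: (conull_ae m0 z0).
exists (g \_ (~` Z)); last first.
  by apply: (conull_ae mZ Z0) => t nZ; rewrite patchC_notin.
apply: (measurability (@RGenInftyO.G R)); first exact: RGenInftyO.measurableE.
move=> _ [_ [x ->] <-]; rewrite setTI.
(* On [Z] the modified function is 0, so [Z] belongs to the sublevel set exactly when some rational
   [q <= x] is positive. *)
have -> : (g \_ (~` Z)) @^-1` `]-oo, x[%classic =
    \bigcup_(q in [set: rat]) (if ratr q <= x then
       (B q `\` Z) `|` (if 0 < ratr q :> R then Z else set0) else set0).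
  apply/seteqP; split=> t /=.
    rewrite in_itv /= => /rat_in_itvoo[q]; rewrite in_itv /= => /andP[gq qx].
    exists q => //; rewrite (ltW qx).
    have [Zt|nZ] := pselect (Z t).
      by right; rewrite patchC_in // in gq; rewrite gq.
    by left; split=> //; rewrite patchC_notin // in gq; exact/ZH.
  move=> [q _]; case: ifP => // qx [[Bq nZ]|].
    by rewrite in_itv /= patchC_notin //; apply: lt_le_trans qx; exact/ZH.
  by case: ifP => // q0 Zt; rewrite in_itv /= patchC_in //; exact: lt_le_trans qx.
apply: bigcupT_measurable_rat => q; case: ifP => // _; apply: measurableU; last by case: ifP.
by apply: measurableD => //; have [] := HZ q.
Qed.

Lemma measurable_shift (c : R) :
  measurable_fun [set: R] ((fun t => c + t) : R -> measurableTypeR R).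
Proof. by apply: measurable_funD; [exact: measurable_cst|exact: measurable_id]. Qed.

(** The pushforward gives every []a, b]] its length, and this characterises Lebesgue measure. *)
Lemma lebesgue_measure_shift (c : R) (A : set R) : measurable A ->
  mu ((fun t => c + t) @^-1` A) = mu A.
Proof.
move=> mA; apply/esym.
have -> := @lebesgue_measure_unique R
  (measure_function_pushforward__canonical__measure_function_Measure mu (measurable_shift c)) _ A mA.
  by [].
move=> _ [[a b] _ <-] /=; rewrite /pushforward.
have -> : (fun t => c + t) @^-1` `]a, b] = `]a - c, b - c]%classic.
  apply/seteqP; split=> t /=; rewrite !in_itv /= => /andP[? ?]; apply/andP; split; lra.
rewrite !lebesgue_measure_itv /= !lte_fin ltrD2r; case: ifP => // _.
by rewrite -!EFinB; congr (_%:E); ring.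
Qed.

Lemma ae_shift (c : R) (P : R -> Prop) :
  {ae mu, forall t, P t} -> {ae mu, forall t, P (c + t)}.
Proof.
move=> /ae_conull[Z [mZ Z0 HZ]].
apply: (conull_ae (Z := (fun t => c + t) @^-1` Z)).
- by rewrite -[X in measurable X]setTI; exact: measurable_shift.
- by rewrite lebesgue_measure_shift.
- by move=> t /HZ.
Qed.

Lemma ae_borel_shift (c : R) g : ae_borel g -> ae_borel (fun t => g (c + t)).
Proof.
move=> [h mh gh]; exists (fun t => h (c + t)); last exact: (ae_shift c gh).
by apply: (measurableT_comp mh); exact: measurable_shift.
Qed.

Lemma lebesgue_measurable_patch_Rge0 g : lebesgue_measurable_fun (@Rge0 R) g ->
  ae_borel (fun t => if 0 <= t then g t else 0).
Proof.
move=> mg; apply: lebesgue_measurable_ae_borel.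
have m0 : measurable (@Rge0 R : set (lebesgueType R)).
  apply: sub_caratheodory.
  have -> : @Rge0 R = `[0, +oo[%classic.
    by apply/seteqP; split=> t /=; rewrite in_itv /= andbT.
  exact: measurable_itv.
have -> : (fun t => if 0 <= t then g t else 0) = g \_ (@Rge0 R).
  apply/funext => t; rewrite patchE; case: ifPn => t0; first by rewrite mem_set.
  by rewrite memNset // => /=; exact/negP.
exact: (measurable_restrictT _ m0).1.
Qed.

Lemma classK_ge0 (w : R -> R) r : classK w -> 0 <= r -> 0 <= w r.
Proof.
move=> [_ inc w0]; rewrite le_eqVlt => /orP[/eqP <-|r0]; first by rewrite w0.
by rewrite -w0; apply/ltW/inc.
Qed.

Lemma classK_near0 (w : R -> R) e : classK w -> 0 < e ->
  exists2 d, 0 < d & forall r, 0 <= r -> r < d -> w r < e.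
Proof.
move=> [cw inc w0] e0.
have H0 : @Rge0 R 0 by rewrite /Rge0 /=.
have /cvgrPdist_lt/(_ e e0) := (subspace_continuousP _ _).1 cw 0 H0.
rewrite near_withinE => /nbhs_ballP[d /= d0 Hd]; exists d => // r r0 rd.
have rd' : `|0 - r| < d by rewrite sub0r normrN ger0_norm.
have : `|w 0 - w r| < e := Hd r rd' r0.
by rewrite w0 sub0r normrN; apply: le_lt_trans; exact: ler_norm.
Qed.

Lemma floor_pieces_measurable (c : R) (z : int) : 0 < c ->
  measurable [set t : R | Num.floor (t * c) = z].
Proof.
move=> c0.
have -> : [set t : R | Num.floor (t * c) = z] = `[z%:~R / c, (z + 1)%:~R / c[%classic.
  apply/seteqP; split=> t /=; rewrite in_itv /= ler_pdivrMr // ltr_pdivlMr //.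
    by move=> <-; exact: floor_itv.
  by move=> h; exact: floor_def.
exact: measurable_itv.
Qed.

End AeBorel.

Section Superposition.
Context {R : realType} {n : nat}.
Local Notation mu := (@lebesgue_measure R).

(* The argument [y t] is replaced by its value at [floor (t m) / m], which takes
   countably many values. *)
Lemma superposition_ae_borel (X K : set 'rV[R]_n) (g : R -> 'rV[R]_n -> R)
    (y : R -> 'rV[R]_n) (L : R) (w : R -> R) (J : set R) :
  K `<=` X -> (forall t, K (y t)) ->
  (forall u v, enorm (y u - y v) <= L * `|u - v|) ->
  (forall xi, X xi -> lebesgue_measurable_fun (@Rge0 R) (g ^~ xi)) ->
  mu.-negligible (@Rge0 R `\` J) -> classK w ->
  (forall t xi zeta, J t -> K xi -> K zeta ->
     `|g t xi - g t zeta| <= w (enorm (xi - zeta))) ->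
  ae_borel (fun t => if 0 <= t then g t (y t) else 0).
Proof.
move=> KX Ky yL mg nJ Kw gw.
pose s (m : nat) (t : R) : R := (Num.floor (t * m.+1%:R))%:~R / m.+1%:R.
have m0 (m : nat) : 0 < m.+1%:R :> R by rewrite ltr0Sn.
have sE m t : `|s m t - t| <= m.+1%:R^-1.
  have /andP[h1 h2] := floor_itv (t * m.+1%:R).
  have {}h1 : s m t <= t by rewrite /s ler_pdivrMr.
  have {}h2 : t < s m t + m.+1%:R^-1.
    by rewrite /s -[X in _ + X]mul1r -mulrDl ltr_pdivlMr // -[X in _ + X]/(1%:~R) -intrD.
  have d0 : 0 < m.+1%:R^-1 :> R by rewrite invr_gt0.
  rewrite ler_norml; move: (m.+1%:R^-1) d0 h1 h2 => d d0 h1 h2.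
  by apply/andP; split; lra.
apply: (@ae_borel_cvg R (fun m t => if 0 <= t then g t (y (s m t)) else 0)).
  move=> m.
  pose G (z : int) t := if 0 <= t then g t (y (z%:~R / m.+1%:R)) else 0.
  apply: (@ae_borel_pieces R int (fun t => Num.floor (t * m.+1%:R)) G).
    by move=> z; exact: floor_pieces_measurable.
  by move=> z; apply: lebesgue_measurable_patch_Rge0; apply: mg; exact: KX.
apply: negligibleS nJ => t /= H.
have [t0 nc] : 0 <= t /\ ~ (g t (y (s m t)) @[m --> \oo] --> g t (y t)).
  have [t0|t0] := leP 0 t; last first.
    by exfalso; apply: H; rewrite leNgt t0 /=; exact: cvg_cst.
  by split=> // h; apply: H; rewrite t0.
split=> // Jt; apply: nc; apply/cvgrPdist_lt => e e0.
have [d d0 Hd] := classK_near0 Kw e0.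
have L0 : 0 < `|L| + 1 by have := normr_ge0 L; lra.
have := near_infty_natSinv_lt (PosNum (divr_gt0 d0 L0)); apply: filterS => m /= hm.
rewrite distrC; apply: le_lt_trans (gw t _ _ Jt (Ky _) (Ky _)) _.
apply: Hd; first exact: enorm_ge0.
apply: (le_lt_trans (yL _ _)).
apply: (@le_lt_trans _ _ ((`|L| + 1) * m.+1%:R^-1)).
  apply: (@le_trans _ _ ((`|L| + 1) * `|s m t - t|)).
    by apply: ler_wpM2r => //; have := ler_norm L; lra.
  by apply: ler_wpM2l; [exact: ltW | exact: sE].
by rewrite mulrC -ltr_pdivlMr.
Qed.

End Superposition.

(** * Primitives of bounded Borel functions and Lebesgue points *)

Section Primitive.
Context {R : realType}.
Local Notation mu := (@lebesgue_measure R).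

Lemma bounded_integrable_itv (i : interval R) (f : R -> R) (C : R) (a b : R) :
  [set` i] `<=` `[a, b] ->
  measurable_fun [set: R] f -> (forall t, `|f t| <= C) ->
  mu.-integrable [set` i] (EFin \o f).
Proof.
move=> iab mf fC; apply: measurable_bounded_integrable => //.
- apply: (@le_lt_trans _ _ (mu `[a, b]%classic)).
    by apply: le_measure; rewrite ?inE.
  by rewrite lebesgue_measure_itv /=; case: ifP => _; rewrite ?ltry // -EFinB ltry.
- exact: measurable_funS mf.
- exists C; split; first exact: num_real.
  by move=> M CM t _; apply: (le_trans (fC t)); exact: ltW.
Qed.

Lemma bounded_locally_integrable (f : R -> R) (C : R) :
  measurable_fun [set: R] f -> (forall t, `|f t| <= C) ->
  locally_integrable [set: R] f.
Proof.
move=> mf fC; split=> //; first exact: openT.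
move=> K _ cK.
have mK : measurable K by exact: compact_measurable.
apply: (@le_lt_trans _ _ (\int[mu]_(x in K) C%:E)%E).
  apply: ge0_le_integral => //.
  - by apply/measurable_EFinP; apply: measurableT_comp => //; exact: measurable_funS mf.
  - by move=> t _; rewrite lee_fin (le_trans _ (fC t)).
have C0 : 0 <= C by exact: le_trans (fC 0).
have h := compact_finite_measure cK.
by rewrite integral_cst; [apply: lte_mul_pinfty | exact: mK].
Qed.

(** For [x < a] the interval is empty and the value is 0, so this is a primitive only to the right
    of [a]. *)
Definition primitive (a : R) (f : R -> R) (x : R) : R :=
  \int[mu]_(t in [set` Interval (BLeft a) (BRight x)]) f t.

Lemma primitive_lip (f : R -> R) (C a b : R) :
  measurable_fun [set: R] f -> (forall t, `|f t| <= C) ->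
  lip_on a b C (primitive a f).
Proof.
move=> mf fC u v au uv vb.
rewrite /primitive Rintegral_itvB //; last first.
  by apply: (@bounded_integrable_itv _ _ C a v).
have intf : mu.-integrable `]u, v] (EFin \o f).
  by apply: (@bounded_integrable_itv _ _ C u v) => // t /=; rewrite !in_itv /= => /andP[/ltW -> ->].
apply: (le_trans (le_normr_Rintegral _ intf)) => //.
apply: (@le_trans _ _ (\int[mu]_(t in `]u, v]) C)%R).
  apply: le_Rintegral => //.
  - apply: (@bounded_integrable_itv _ (fun t => `|f t|) C u v).
    + by move=> t /=; rewrite !in_itv /= => /andP[/ltW -> ->].
    + exact: measurableT_comp.
    + by move=> t; rewrite normr_id.
  - apply: (@bounded_integrable_itv _ (fun t => C) `|C| u v) => //.
    by move=> t /=; rewrite !in_itv /= => /andP[/ltW -> ->].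
rewrite Rintegral_cst // [X in _ * X <= _](_ : _ = v - u) //.
apply: (@etrans _ _ (fine (mu `]u, v]%classic))) => //.
rewrite lebesgue_measure_itv /= lte_fin.
by case: ltP => [_|vu] //=; rewrite (le_anti (introT andP (conj uv vu))) subrr.
Qed.

Lemma primitive_derive (f : R -> R) (C a : R) :
  measurable_fun [set: R] f -> (forall t, `|f t| <= C) ->
  {ae mu, forall t, a < t -> is_derive t (1 : R) (primitive a f) (f t)}.
Proof.
move=> mf fC.
have int y : mu.-integrable [set` Interval (BLeft a) (BRight y)] (EFin \o f).
  by apply: (@bounded_integrable_itv _ _ C a y).
apply: ae_mono (FTC1 int (bounded_locally_integrable mf fC)) => t H at_.
have [d1 d2] : derivable (primitive a f) t 1 /\ (primitive a f)^`()%classic t = f t.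
  exact: H.
by split=> //; rewrite -d2 derive1E.
Qed.

(** The integrand changes with [t], so differentiating almost everywhere for each fixed integrand
    would not do. A Lebesgue point [t] of [f] is one of [|f - f t|] as well, since the averages
    coincide, and that function vanishes at [t]. *)
Lemma primitive_derive_lebesgue_pt (f : R -> R) (C a : R) :
  measurable_fun [set: R] f -> (forall t, `|f t| <= C) ->
  {ae mu, forall t, a < t ->
     is_derive t (1 : R) (primitive a (fun s => `|f s - f t|)) 0}.
Proof.
move=> mf fC.
have := lebesgue_differentiation (bounded_locally_integrable mf fC).
apply: ae_mono => t ft at_.
pose h s := `|f s - f t|.
have mh : measurable_fun [set: R] h.
  by apply: measurableT_comp => //; apply: measurable_funB.
have hC s : `|h s| <= C + C.
  by rewrite normr_id; apply: (le_trans (ler_normB _ _)); exact: lerD.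
have h0 : h t = 0 by rewrite /h subrr normr0.
have ht : lebesgue_pt h t.
  move: ft; rewrite /lebesgue_pt; suff -> : davg h t = davg f t by [].
  apply/funext => r; rewrite /davg /iavg; congr (_ * _)%E.
  by apply: eq_integral => s _ /=; rewrite h0 subr0 normr_id.
have t1 : t < t + 1 by rewrite ltrDl.
have [] := @FTC1_lebesgue_pt R h (BLeft a) t (t + 1) t1 _ _ ht.
- by apply: (@bounded_integrable_itv _ _ (C + C) a (t + 1)).
- by [].
by move=> d1 d2; split=> //; rewrite -[RHS]h0 -d2 derive1E.
Qed.

End Primitive.

(** * Convergence of primitives and densities of Lipschitz functions *)

Section Density.
Context {R : realType}.
Local Notation mu := (@lebesgue_measure R).

Lemma primitive_dist_cvg (g_ : nat -> R -> R) (g : R -> R) (C a b : R) :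
  (forall k, measurable_fun [set: R] (g_ k)) -> measurable_fun [set: R] g ->
  (forall k t, `|g_ k t| <= C) ->
  {ae mu, forall t, g_ k t @[k --> \oo] --> g t} ->
  primitive a (fun t => `|g_ k t - g t|) b @[k --> \oo] --> (0 : R).
Proof.
move=> mg_ mg gC gc.
have := @dominated_convergence _ _ R mu `[a, b]%classic (measurable_itv _)
  (fun k => EFin \o g_ k) (EFin \o g) (cst C%:E).
case.
- by move=> k; apply/measurable_EFinP; exact: measurable_funS (mg_ k).
- by apply/measurable_EFinP; exact: measurable_funS mg.
- by apply: ae_mono gc => t gt _; apply: cvg_EFin => //; exact: nearW.
- apply: (@bounded_integrable_itv R `[a, b] (cst C) `|C| a b) => //.
- by apply: ae_all => t k _ /=; rewrite lee_fin.
move=> _ + _ => /fine_cvg /=; rewrite /fine /=.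
apply: cvg_trans; apply: near_eq_cvg; apply: nearW => k /=.
by [].
Qed.

Lemma lip_continuous (U : R -> R) :
  (forall u v, u <= v -> `|U v - U u| <= v - u) -> continuous U.
Proof.
move=> UL x; apply/cvgrPdist_lt => e e0; apply/nbhs_ballP; exists e => //= y.
rewrite /ball /=; apply: le_lt_trans.
have [xy|/ltW yx] := leP x y.
  by rewrite distrC [leRHS]distrC [leRHS]ger0_norm ?subr_ge0 //; exact: UL.
by rewrite [leRHS]ger0_norm ?subr_ge0 //; exact: UL.
Qed.

(** Compared cover by cover: a half-open interval has at most as much [U]-mass as length, hence the
    infima over covers are ordered. *)
Lemma lebesgue_stieltjes_le (U : cumulative R R) (A : set R) :
  (forall u v, u <= v -> U v - U u <= v - u) ->
  (lebesgue_stieltjes_measure U A <= mu A)%E.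
Proof.
move=> UL; rewrite /lebesgue_measure /lebesgue_stieltjes_measure /measure_extension /mu_ext.
apply: le_ereal_inf_tmp => _ [F [mF AF] <-].
apply: (@le_trans _ _ (\sum_(k <oo) wlength U (F k))%E).
  by apply: ereal_inf_lbound; exists F.
apply: lee_nneseries => [k _ _|k _]; first exact: wlength_ge0.
have [[x y] _ <-] := mF k.
have [xy|yx] := leP x y; last first.
  by rewrite set_itv_ge ?bnd_simp -?leNgt ?(ltW yx) // !wlength0.
rewrite wlength_itv_bnd // [leRHS](_ : _ = (y - x)%:E).
  by rewrite lee_fin; exact: UL.
exact: (wlength_itv_bnd idfun false false xy).
Qed.

(* The Lebesgue-Stieltjes measure of [U] is dominated by the Lebesgue measure, and
   its Radon-Nikodym density is the derivative. *)
Lemma nondecreasing_lip_density_window (U : R -> R) (m : R) : 0 < m ->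
  {homo U : x y / x <= y} -> (forall u v, u <= v -> `|U v - U u| <= v - u) ->
  exists2 h : R -> R, measurable_fun [set: R] h &
    {ae mu, forall t, - m < t < m -> is_derive t (1 : R) U (h t)}.
Proof.
move=> m0 nd UL.
have UL' u v : u <= v -> U v - U u <= v - u.
  by move=> uv; apply: (le_trans (ler_norm _)); exact: UL.
pose Uc : cumulative R R := HB.pack U (isCumulative.Build R _ R U nd
  (right_continuousW (lip_continuous UL))).
pose D : set (measurableTypeR R) := `]- m, m]%classic.
have mD : measurable D by exact: measurable_itv.
pose nu := lebesgue_stieltjes_measure Uc.
have nuI (a b : R) : a <= b -> nu `]a, b]%classic = (U b - U a)%:E.
  move=> ab; rewrite /nu /lebesgue_stieltjes_measure /measure_extension.
  rewrite measurable_mu_extE; last by exists (a, b).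
  exact: (wlength_itv_bnd U false false ab).
(* Restricting to the window makes the measure finite, the form in which it enters the Radon-Nikodym
   theorem. *)
have nuD : (nu D < +oo)%E by rewrite nuI ?ltry //; lra.
pose nuf : {finite_measure set (measurableTypeR R) -> \bar R} := mfrestr mD nuD.
have dom : nuf `<< mu.
  move=> Z Z0 A mA AZ; have muA : mu A = 0%E by exact: Z0.
  apply/eqP; rewrite eq_le measure_ge0 andbT.
  apply: (@le_trans _ _ (nu A)).
    by rewrite /nuf /mfrestr /mrestr; apply: le_measure; rewrite ?inE //; exact: measurableI.
  have h : (nu A <= mu A)%E := @lebesgue_stieltjes_le Uc A UL'.
  by apply: (le_trans h); rewrite [X in (X <= _)%E](muA : mu A = 0%E).
have [F [F0 Ffin intF HF]] := radon_nikodym_sigma_finite dom.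
pose h t := fine (F t).
have FE : EFin \o h = F by apply/funext => t /=; rewrite fineK.
have mh : measurable_fun [set: R] h.
  by apply/measurable_EFinP; rewrite FE; have /integrableP[] := intF.
exists h => //.
have inth : mu.-integrable setT (EFin \o h) by rewrite FE.
have inty y : mu.-integrable [set` Interval (BRight (- m)) (BRight y)] (EFin \o h).
  by apply: integrableS inth.
have loc : locally_integrable [set: R] h by apply: open_integrable_locally => //; exact: openT.
apply: ae_mono (FTC1 inty loc) => t H /andP[mt tm].
have [d1 d2] := H mt.
have {}H : is_derive t (1 : R) (fun x => \int[mu]_(s in `]- m, x]) h s)%R (h t).
  by split=> //; rewrite -d2 derive1E.
apply/is_derive_epsP => e e0; have /is_derive_epsP/(_ e e0)[r r0 Hr] := H.
(* On the window the integral of the density is [U] up to a constant, so both have the same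
   derivative. *)
have UE y : - m <= y -> y <= m -> (\int[mu]_(s in `]- m, y]) h s)%R = U y - U (- m).
  move=> my ym; pose A : set (measurableTypeR R) := `]- m, y]%classic.
  have mA : measurable A by exact: measurable_itv.
  apply: EFin_inj; rewrite /Rintegral fineK; last first.
    exact: (integrable_fin_num mA (inty y)).
  have -> : (\int[mu]_(s in A) (h s)%:E = nuf A)%E.
    by rewrite HF //; apply: eq_integral => s _; rewrite /h fineK.
  have -> : nuf A = nu (A `&` D) by [].
  rewrite setIidl; first exact: nuI.
  by move=> s; rewrite /A /D /= !in_itv /= => /andP[-> sy]; exact: le_trans ym.
exists (Num.min r (Num.min (t + m) (m - t))); first by rewrite !lt_min r0 /=; apply/andP; split; lra.
move=> s; rewrite !lt_min => /and3P[sr]; rewrite !ltr_norml => /andP[? ?] /andP[? ?].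
have := Hr s sr; rewrite !UE; try lra.
by have -> : U s - U (- m) - (U t - U (- m)) = U s - U t by ring.
Qed.

Lemma nondecreasing_lip_density (U : R -> R) :
  {homo U : x y / x <= y} -> (forall u v, u <= v -> `|U v - U u| <= v - u) ->
  exists2 h : R -> R, measurable_fun [set: R] h &
    {ae mu, forall t, is_derive t (1 : R) U (h t)}.
Proof.
move=> nd UL.
(* For [t] with floor [z] one has [|t| < |z| + 2], so the window of radius [|z| + 2] decides the
   density there. *)
have /choice[H HH] : forall z : int, exists h : R -> R, measurable_fun [set: R] h /\
    {ae mu, forall t : R, - (`|z%:~R| + 2) < t < `|z%:~R| + 2 -> is_derive t (1 : R) U (h t)}.
  move=> z; have m0 : 0 < `|z%:~R| + 2 :> R by have := normr_ge0 (z%:~R : R); lra.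
  by have [h mh hd] := nondecreasing_lip_density_window m0 nd UL; exists h.
have [h mh hh] : ae_borel (fun t => H (Num.floor (t * 1)) t).
  apply: (@ae_borel_pieces R int (fun t => Num.floor (t * 1)) H).
    by move=> z; exact: floor_pieces_measurable.
  by move=> z; apply: measurable_ae_borel; have [] := HH z.
exists h => //.
have : {ae mu, forall (t : R) (z : int), - (`|z%:~R| + 2) < t < `|z%:~R| + 2 ->
    is_derive t (1 : R) U (H z t)} by apply: ae_count => z; have [] := HH z.
move=> /(ae_and hh); apply: ae_mono => t [<-]; apply.
rewrite mulr1; have /andP[h1] := floor_itv t; rewrite intrD mulr1z => h2.
have n1 := ler_norm ((Num.floor t)%:~R : R); have := ler_norm (- (Num.floor t)%:~R : R).
rewrite normrN => n2; move: h1 h2 n1 n2; move: ((Num.floor t)%:~R : R) => z h1 h2 n1 n2.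
by apply/andP; split; lra.
Qed.

End Density.

(** * Limits of recentred trajectories *)

Section Subsequences.
Context {R : realType}.

Lemma fmap_ultra (T W : Type) (f : T -> W) (G : set_system T) :
  UltraFilter G -> UltraFilter (f x @[x --> G]).
Proof.
move=> GU; split=> [|H HP GH]; first exact: fmap_proper_filter.
apply/seteqP; split=> A; last exact: GH.
move=> HA; have [//|nA] := in_ultra_setVsetC (f @^-1` A) GU.
have {nA} : H (~` A) by apply: GH.
by move=> /(filterI HA); rewrite setICr => /filter_not_empty.
Qed.

Lemma ultrafilter_limit (G : set_system nat) (a : nat -> R) (B : R) :
  UltraFilter G -> (\forall k \near G, `|a k| <= B) ->
  exists l : R, a k @[k --> G] --> l.
Proof.
move=> GU aB; have := @segment_compact R (- B) B; rewrite compact_ultra.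
move=> /(_ _ (fmap_ultra a GU))[].
  by rewrite /fmap /=; apply: filterS aB => k; rewrite /= in_itv /= ler_norml.
by move=> l [_ al]; exists l.
Qed.

(* Along an ultrafilter the limits exist at all [s] simultaneously; the subsequence
   has to follow them at rational points only. *)
Lemma equilip_subsequence (I : finType) (L : R) (F : nat -> I -> R -> R) :
  (forall (a : R) i, \forall k \near \oo, lip_on (- a) a L (F k i)) ->
  (forall i (s : R), exists B : R, \forall k \near \oo, `|F k i s| <= B) ->
  exists2 phi : nat -> nat, {homo phi : k l / (k < l)%N} &
    exists l : I -> R -> R, forall i s, F (phi k) i s @[k --> \oo] --> l i s.
Proof.
move=> FL FB; have [G [GU ooG]] := @ultraFilterLemma _ (\oo : set_system nat) _.
have /choice[l Hl] : forall is_ : I * R, exists l : R, F k is_.1 is_.2 @[k --> G] --> l.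
  by move=> [i s]; have [B HB] := FB i s; apply: (@ultrafilter_limit G _ B); exact: ooG.
have Gl i s : F k i s @[k --> G] --> l (i, s) := Hl (i, s).
(* [|L| + 1] is a positive Lipschitz constant whatever the sign of [L]. *)
have L0 : 0 < `|L| + 1 by have := normr_ge0 L; lra.
have lipG i s t : \forall k \near \oo, `|F k i s - F k i t| <= (`|L| + 1) * `|s - t|.
  have sa : `|s| <= Num.max `|s| `|t| by rewrite le_max lexx.
  have ta : `|t| <= Num.max `|s| `|t| by rewrite le_max lexx orbT.
  have LL : L <= `|L| + 1 by have := ler_norm L; lra.
  move: sa ta; rewrite !ler_norml => /andP[? ?] /andP[? ?].
  apply: filterS (FL (Num.max `|s| `|t|) i) => k Fk.
  have [st|/ltW ts] := leP s t.
    rewrite distrC [X in _ * X]distrC [X in _ * X]ger0_norm ?subr_ge0 //.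
    by apply: (le_trans (Fk s t _ _ _)) => //; apply: ler_wpM2r => //; rewrite subr_ge0.
  rewrite [X in _ * X]ger0_norm ?subr_ge0 //.
  by apply: (le_trans (Fk t s _ _ _)) => //; apply: ler_wpM2r => //; rewrite subr_ge0.
have lL i s t : `|l (i, s) - l (i, t)| <= (`|L| + 1) * `|s - t|.
  have h : `|F k i s - F k i t| @[k --> G] --> `|l (i, s) - l (i, t)|.
    by apply: cvg_norm; apply: cvgB.
  by apply: (ler_cvg_to h (cvg_cst _)); apply: ooG; exact: lipG.
(* At rank [m] only the finitely many pairs with code at most [m] are constrained, so a member of
   the ultrafilter consists of good indices. *)
pose good (m k : nat) := forall q i, (pickle (q, i) <= m)%N ->
  `|F k i (ratr q) - l (i, ratr q)| < m.+1%:R^-1.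
have ex m N : exists2 k, (N < k)%N & good m k.
  have Gg : \forall k \near G, good m k.
    have : \forall k \near G, forall (j : 'I_m.+1) q i, pickle (q, i) = j ->
        `|F k i (ratr q) - l (i, ratr q)| < m.+1%:R^-1.
      apply: filter_forall => j.
      have [[[q i] qij]|nj] := pselect (exists x : rat * I, pickle x = j).
        have e0 : 0 < m.+1%:R^-1 :> R by rewrite invr_gt0.
        have /cvgrPdist_lt/(_ _ e0) := Gl i (ratr q).
        apply: filterS => k; rewrite distrC => h q' i'; rewrite -qij.
        by move=> /(pcan_inj pickleK)[-> ->].
      by apply: nearW => k q i qij; case: nj; exists (q, i).
    apply: filterS => k H q i; rewrite -ltnS => qim.
    exact: (H (Ordinal qim)).
  have GN : \forall k \near G, (N < k)%N by apply: ooG; exact: nbhs_infty_gt.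
  by have [k [gk Nk]] := @filter_ex _ G _ _ (filterI Gg GN); exists k.
have /choice[c Hc] : forall mN : nat * nat, exists k, (mN.2 < k)%N /\ good mN.1 k.
  by move=> [m N]; have [k] := ex m N; exists k.
pose phi := fix phi (m : nat) : nat := if m is m'.+1 then c (m, phi m') else c (0%N, 0%N).
have phiS m : (phi m < phi m.+1)%N by have [] := Hc (m.+1, phi m).
have phi_good m : good m (phi m) by case: m => [|m]; [have [] := Hc (0%N, 0%N) | have [] := Hc (m.+1, phi m)].
have phi_homo : {homo phi : k m / (k < m)%N}.
  apply: (@homo_ltn _ phi (fun a b : nat => (a < b)%N)) => //.
  by move=> ? ? ?; exact: ltn_trans.
have phi_oo : phi k @[k --> \oo] --> \oo.
  move=> A [N _ NA]; exists N => // k /= Nk; apply: NA => /=.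
  apply: (leq_trans Nk); elim: {Nk} k => [//|k IH].
  exact: leq_ltn_trans (phiS k).
exists phi => //; exists (fun i s => l (i, s)) => i s.
apply/cvgrPdist_lt => e e0.
(* Three errors of at most [e / 4]: two from moving between [s] and a rational point, one from the
   convergence at that point. *)
pose d := e / 4 / (`|L| + 1).
have d0 : 0 < d by rewrite !divr_gt0 //; lra.
have /rat_in_itvoo[q] : s - d < s + d by lra.
rewrite in_itv /= => /andP[q1 q2].
have sq : `|s - ratr q| <= d by rewrite ler_norml; apply/andP; split; lra.
have Lsq : (`|L| + 1) * `|s - ratr q| <= e / 4.
  by rewrite mulrC -ler_pdivlMr.
have near1 : \forall k \near \oo, `|F (phi k) i s - F (phi k) i (ratr q)| <= (`|L| + 1) * `|s - ratr q|.
  by have := lipG i s (ratr q) => /phi_oo.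
have e40 : 0 < e / 4 by lra.
have near2 : \forall k \near \oo, k.+1%:R^-1 < e / 4 := near_infty_natSinv_lt (PosNum e40).
have near3 : \forall k \near \oo, (pickle (q, i) <= k)%N.
  by exists (pickle (q, i)).
near=> k.
have h1 : `|F (phi k) i s - F (phi k) i (ratr q)| <= (`|L| + 1) * `|s - ratr q| by near: k.
have h2 : k.+1%:R^-1 < e / 4 by near: k.
have h3 : (pickle (q, i) <= k)%N by near: k.
have h4 := phi_good k q i h3.
have h5 := lL i s (ratr q).
have -> : l (i, s) - F (phi k) i s = (l (i, s) - l (i, ratr q)) +
  (- (F (phi k) i (ratr q) - l (i, ratr q)) - (F (phi k) i s - F (phi k) i (ratr q))) by ring.
apply: (le_lt_trans (ler_normD _ _)).
apply: (le_lt_trans (lerD (lexx _) (ler_normB _ _))); rewrite normrN.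
by move: h2 h4; move: (k.+1%:R^-1) => z; lra.
Unshelve. all: by end_near. Qed.

(** Convergence at one point controls a neighbourhood whose size depends on [L] and [e] only;
    creeping combines the neighbourhoods by taking the maximum of the ranks. *)
Lemma equilip_uniform (a L e : R) (F : nat -> R -> R) (l : R -> R) : 0 <= a -> 0 < e ->
  (\forall k \near \oo, lip_on (- a) a L (F k)) -> lip_on (- a) a L l ->
  (forall s, F k s @[k --> \oo] --> l s) ->
  \forall k \near \oo, forall s, - a <= s <= a -> `|F k s - l s| <= e.
Proof.
move=> a0 e0 FL lL Fl.
have key : exists k0 : nat, forall k, (k0 <= k)%N -> forall s, - a <= s <= a ->
   `|F k s - l s| <= e.
  apply: (@interval_creep R (fun u v => exists k0 : nat, forall k, (k0 <= k)%N ->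
    forall s, u <= s <= v -> `|F k s - l s| <= e) (- a) a); first by lra.
    move=> u v w uv vw [k1 H1] [k2 H2]; exists (maxn k1 k2) => k.
    rewrite geq_max => /andP[kk1 kk2] s /andP[us sw].
    have [sv|/ltW vs] := leP s v; first by apply: H1 => //; rewrite us.
    by apply: H2 => //; rewrite vs.
  move=> t /andP[at_ ta].
  have L0 : 0 < `|L| + 1 by have := normr_ge0 L; lra.
  have LL : L <= `|L| + 1 by have := ler_norm L; lra.
  exists (e / 4 / (`|L| + 1)); first by rewrite !divr_gt0 //; lra.
  move=> u v au ut tv va tu vt.
  have e20 : 0 < e / 2 by lra.
  have /cvgrPdist_lt/(_ _ e20) := Fl t.
  move=> /(filterI FL)[k0 _ Hk0]; exists k0 => k /Hk0[/= FkL Fkt] s /andP[us sv].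
  have gen (H : R -> R) : lip_on (- a) a L H -> `|H s - H t| <= e / 4.
    move=> HL; apply: (@le_trans _ _ ((`|L| + 1) * `|s - t|)).
      have [st|/ltW ts] := leP s t.
        rewrite distrC [X in _ * X]distrC [X in _ * X]ger0_norm ?subr_ge0 //.
        by apply: (le_trans (HL s t _ _ _)); [lra|by []|lra|apply: ler_wpM2r => //; rewrite subr_ge0].
      rewrite [X in _ * X]ger0_norm ?subr_ge0 //.
      by apply: (le_trans (HL t s _ _ _)); [lra|by []|lra|apply: ler_wpM2r => //; rewrite subr_ge0].
    rewrite mulrC -ler_pdivlMr //.
    by rewrite ler_norml; move: tu vt; move: (e / 4 / _) => z *; apply/andP; split; lra.
  have h1 := gen _ FkL; have h2 := gen _ lL.
  have -> : F k s - l s = (F k s - F k t) + (- (l t - F k t) - (l s - l t)) by ring.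
  apply: (le_trans (ler_normD _ _)).
  by apply: (le_trans (lerD (lexx _) (ler_normB _ _))); rewrite normrN; lra.
by have [k0 H] := key; exists k0.
Qed.

End Subsequences.

(** * Differentiating a limit of curves driven by switched rates *)

Section LimitDerivative.
Context {R : realType}.
Local Notation mu := (@lebesgue_measure R).

Lemma is_derive_bigsum (N : nat) (F : 'I_N -> R -> R) (d : 'I_N -> R) (t : R) :
  (forall i, is_derive t (1 : R) (F i) (d i)) ->
  is_derive t (1 : R) (fun s => \sum_i F i s) (\sum_i d i).
Proof.
move=> H; have -> : (fun s => \sum_i F i s) = \sum_i F i.
  by apply/funext => s; rewrite fct_sumE.
exact: is_derive_sum.
Qed.

Lemma is_derive_scale (F : R -> R) (c d t : R) :
  is_derive t (1 : R) F d -> is_derive t (1 : R) (fun s => c * F s) (c * d).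
Proof. by move=> H; exact: is_deriveZ. Qed.

Lemma is_derive_add (F G : R -> R) (d e t : R) :
  is_derive t (1 : R) F d -> is_derive t (1 : R) G e ->
  is_derive t (1 : R) (fun s => F s + G s) (d + e).
Proof. by move=> dF dG; exact: is_deriveD. Qed.

Lemma is_derive_dominated (P G : R -> R) (t : R) (r : R) : 0 < r ->
  (forall s, `|s - t| < r -> `|P s - P t| <= `|G s - G t|) ->
  is_derive t (1 : R) G 0 -> is_derive t (1 : R) P 0.
Proof.
move=> r0 PG /is_derive_epsP dG; apply/is_derive_epsP => e e0.
have [q q0 Hq] := dG e e0; exists (Num.min r q); first by rewrite lt_min r0.
move=> s; rewrite lt_min => /andP[sr sq].
by have := Hq s sq; rewrite !mul0r !subr0; exact: le_trans (PG s sr).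
Qed.

(* The function eps (Q - sum b_i U_i) - sum D_i - sum G_i - e t + C' W is nonincreasing. *)
Lemma increment_ineq (N : nat) (u v e eps C' : R) (c : R -> 'I_N) (b : 'I_N -> R)
    (Q W : R -> R) (U D G gk g : 'I_N -> R -> R) :
  u <= v -> `|eps| = 1 ->
  (exists L, lip_on u v L Q) -> (exists L, lip_on u v L W) ->
  (forall i, exists L, lip_on u v L (U i)) -> (forall i, exists L, lip_on u v L (D i)) ->
  (forall i, exists L, lip_on u v L (G i)) ->
  {ae mu, forall s, u < s < v -> forall i, is_derive s (1 : R) (U i) (c s == i)%:R} ->
  {ae mu, forall s, u < s < v -> forall i, is_derive s (1 : R) (D i) `|gk i s - g i s|} ->
  {ae mu, forall s, u < s < v -> forall i, is_derive s (1 : R) (G i) `|g i s - b i|} ->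
  {ae mu, forall s, u < s < v -> exists dq dw,
       [/\ is_derive s (1 : R) Q dq, is_derive s (1 : R) W dw &
           `|dq - gk (c s) s| <= e - C' * dw]} ->
  eps * (Q v - Q u - \sum_i b i * (U i v - U i u)) <=
    \sum_i (D i v - D i u) + \sum_i (G i v - G i u) + e * (v - u) + C' * (W u - W v).
Proof.
move=> uv eps1 [LQ HQ] [LW HW] /choice[LU HU] /choice[LD HD] /choice[LG HG] dU dD dG dQ.
pose F (t : R) := eps * Q t + (\sum_i (- (eps * b i)) * U i t +
  (\sum_i (-1) * D i t + (\sum_i (-1) * G i t + ((- e) * t + C' * W t)))).
have [L HL] : exists L, lip_on u v L F.
  eexists; apply: lip_onD; first exact: (lip_onZ _ HQ).
  apply: lip_onD; first by apply: lip_on_sum => i; exact: (lip_onZ _ (HU i)).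
  apply: lip_onD; first by apply: lip_on_sum => i; exact: (lip_onZ _ (HD i)).
  apply: lip_onD; first by apply: lip_on_sum => i; exact: (lip_onZ _ (HG i)).
  apply: lip_onD; first exact: (lip_onZ _ (@lip_on_id R _ _)).
  exact: (lip_onZ _ HW).
have Fuv : F v <= F u.
  apply: (lip_derivative_le0 uv HL).
  apply: ae_mono (ae_and (ae_and dD dG) (ae_and dU dQ)) => t [[{}dD {}dG] [{}dU {}dQ]] tuv.
  have [dq [dw [dQk dWk dle]]] := dQ tuv.
  pose d := eps * dq + (\sum_i (- (eps * b i)) * (c t == i)%:R +
    (\sum_i (-1) * `|gk i t - g i t| + (\sum_i (-1) * `|g i t - b i| +
      ((- e) * 1 + C' * dw)))).
  exists d.
    exact: (is_derive_add (is_derive_scale eps dQk)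
      (is_derive_add (is_derive_bigsum (fun i => is_derive_scale (- (eps * b i)) (dU tuv i)))
      (is_derive_add (is_derive_bigsum (fun i => is_derive_scale (-1) (dD tuv i)))
      (is_derive_add (is_derive_bigsum (fun i => is_derive_scale (-1) (dG tuv i)))
      (is_derive_add (is_derive_scale (- e) (is_derive_id t 1)) (is_derive_scale C' dWk)))))).
  (* With [j] the active mode, the derivatives of the [U i] select [b j]; in the two sums of norms
     only the term of [j] is kept. *)
  rewrite /d; set j := c t.
  have S1 : \sum_i (- (eps * b i)) * (j == i)%:R = - (eps * b j).
    rewrite (bigD1 j) //= eqxx mulr1 big1 ?addr0 // => i ij.
    by rewrite eq_sym (negPf ij) mulr0.
  have S2 : \sum_i (-1) * `|gk i t - g i t| <= - `|gk j t - g j t|.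
    rewrite (bigD1 j) //= mulN1r -[leRHS]addr0 lerD2l.
    by apply: sumr_le0 => i _; rewrite mulN1r oppr_le0.
  have S3 : \sum_i (-1) * `|g i t - b i| <= - `|g j t - b j|.
    rewrite (bigD1 j) //= mulN1r -[leRHS]addr0 lerD2l.
    by apply: sumr_le0 => i _; rewrite mulN1r oppr_le0.
  have S4 : eps * dq - eps * b j <= `|dq - gk j t| + `|gk j t - g j t| + `|g j t - b j|.
    rewrite -mulrBr; apply: (le_trans (ler_norm _)); rewrite normrM eps1 mul1r.
    have -> : dq - b j = (dq - gk j t) + (gk j t - g j t) + (g j t - b j) by ring.
    apply: (le_trans (ler_normD _ _)); rewrite lerD2r; exact: ler_normD.
  by rewrite S1; move: dle S2 S3 S4; rewrite -/j; lra.
rewrite !sumrB /=.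
have sB (x y z : 'I_N -> R) :
   \sum_i z i * (x i - y i) = \sum_i z i * x i - \sum_i z i * y i.
  by rewrite -sumrB; apply: eq_bigr => i _; rewrite mulrBr.
rewrite sB; move: Fuv; rewrite /F.
have sN (x : 'I_N -> R) : \sum_i (-1) * x i = - \sum_i x i.
  by rewrite -sumrN; apply: eq_bigr => i _; rewrite mulN1r.
have sE (x : 'I_N -> R) : \sum_i (- (eps * b i)) * x i = - (eps * \sum_i b i * x i).
  by rewrite mulr_sumr -sumrN; apply: eq_bigr => i _; rewrite mulrA mulNr.
rewrite !sN !sE; lra.
Qed.

Variables (N : nat) (a C : R) (c : nat -> R -> 'I_N).
Variables (U_ : nat -> 'I_N -> R -> R) (U ud : 'I_N -> R -> R).
Variables (g_ : nat -> 'I_N -> R -> R) (g : 'I_N -> R -> R).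
Variables (Q_ W_ : nat -> R -> R) (Q : R -> R).
Hypotheses (a0 : 0 < a)
  (U_lip : \forall k \near \oo, forall i, lip_on (- a) a 1 (U_ k i))
  (U_der : \forall k \near \oo, {ae mu, forall s, - a < s < a ->
     forall i, is_derive s (1 : R) (U_ k i) (c k s == i)%:R})
  (U_cvg : forall i s, - a <= s <= a -> U_ k i s @[k --> \oo] --> U i s)
  (Ud : {ae mu, forall s, - a < s < a -> forall i, is_derive s (1 : R) (U i) (ud i s)})
  (mg_ : forall k i, measurable_fun [set: R] (g_ k i))
  (mg : forall i, measurable_fun [set: R] (g i))
  (gC_ : forall k i t, `|g_ k i t| <= C) (gC : forall i t, `|g i t| <= C)
  (g_cvg : forall i, {ae mu, forall s, g_ k i s @[k --> \oo] --> g i s})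
  (Q_lip : \forall k \near \oo, exists L, lip_on (- a) a L (Q_ k))
  (W_lip : \forall k \near \oo, exists L, lip_on (- a) a L (W_ k))
  (Q_cvg : forall s, - a <= s <= a -> Q_ k s @[k --> \oo] --> Q s)
  (W_mono : \forall k \near \oo, forall u v, - a <= u -> u <= v -> v <= a -> W_ k v <= W_ k u)
  (W_drop : W_ k (- a) - W_ k a @[k --> \oo] --> (0 : R))
  (QW : forall e : R, 0 < e -> exists2 C' : R, 0 <= C' &
     \forall k \near \oo, {ae mu, forall s, - a < s < a -> exists dq dw,
       [/\ is_derive s (1 : R) (Q_ k) dq, is_derive s (1 : R) (W_ k) dw &
           `|dq - g_ k (c k s) s| <= e - C' * dw]}).

(** [D k i] accumulates the distance from the mode function to its limit and vanishes as [k] grows.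
    [G b i] accumulates the distance from the limit to a constant, and is flat at a Lebesgue point
    where [b i] is the value of [g i]. *)
Let D k i := primitive (- a) (fun s => `|g_ k i s - g i s|).
Let G b i := primitive (- a) (fun s => `|g i s - b i|).

Let mD k i : measurable_fun [set: R] (fun s => `|g_ k i s - g i s|).
Proof. by apply: measurableT_comp => //; exact: measurable_funB. Qed.

Let DC k i t : `| `|g_ k i t - g i t| | <= C + C.
Proof. by rewrite normr_id; apply: (le_trans (ler_normB _ _)); exact: lerD. Qed.

Let mG b i : measurable_fun [set: R] (fun s => `|g i s - b i|).
Proof. by apply: measurableT_comp => //; exact: measurable_funB. Qed.

Let GC (b : 'I_N -> R) i t : `| `|g i t - b i| | <= C + `|b i|.
Proof. by rewrite normr_id; apply: (le_trans (ler_normB _ _)); exact: lerD. Qed.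

(** [C'] is fixed by [e] before [k] is chosen. However large it is, it multiplies the drop of [W_ k]
    over the whole window, which tends to 0. *)
Lemma limit_increment_approx (b : 'I_N -> R) (e eps u v : R) : 0 < e -> `|eps| = 1 ->
  - a <= u -> u <= v -> v <= a -> exists2 C' : R, 0 <= C' & \forall k \near \oo,
  eps * (Q_ k v - Q_ k u - \sum_i b i * (U_ k i v - U_ k i u)) <=
    \sum_i (D k i v - D k i u) + \sum_i (G b i v - G b i u) + e * (v - u)
    + C' * (W_ k (- a) - W_ k a).
Proof.
move=> e0 eps1 au uv va; have [C' C'0 HC'] := QW e0; exists C' => //.
near=> k.
have Ul : forall i, lip_on (- a) a 1 (U_ k i) by near: k.
have Uk : {ae mu, forall s, - a < s < a ->
     forall i, is_derive s (1 : R) (U_ k i) (c k s == i)%:R} by near: k.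
have [L1 HQ] : exists L, lip_on (- a) a L (Q_ k) by near: k.
have [L2 HW] : exists L, lip_on (- a) a L (W_ k) by near: k.
have Wm : forall u v, - a <= u -> u <= v -> v <= a -> W_ k v <= W_ k u by near: k.
have HH : {ae mu, forall s, - a < s < a -> exists dq dw,
       [/\ is_derive s (1 : R) (Q_ k) dq, is_derive s (1 : R) (W_ k) dw &
           `|dq - g_ k (c k s) s| <= e - C' * dw]} by near: k.
have sub (L : R) H : lip_on (- a) a L H -> lip_on u v L H by exact: lip_on_sub.
have suv s : u < s < v -> - a < s < a by move=> /andP[? ?]; apply/andP; split; lra.
have uva s : u < s < v -> - a < s by move=> /suv/andP[].
have Wd : C' * (W_ k u - W_ k v) <= C' * (W_ k (- a) - W_ k a).
  apply: ler_wpM2l => //.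
  have h1 : W_ k u <= W_ k (- a) by apply: Wm => //; lra.
  have h2 : W_ k a <= W_ k v by apply: Wm => //; lra.
  lra.
apply: le_trans (lerD (lexx _) Wd).
apply: (@increment_ineq N u v e eps C' (c k) b (Q_ k) (W_ k) (U_ k) (D k) (G b) (g_ k) g) => //.
- by exists L1; exact: sub.
- by exists L2; exact: sub.
- by move=> i; exists 1; exact/sub/Ul.
- by move=> i; exists (C + C); apply/sub; exact: (primitive_lip (mD k i) (DC k i)).
- by move=> i; exists (C + `|b i|); apply/sub; exact: (primitive_lip (mG b i) (GC b i)).
- by apply: ae_mono Uk => s H /suv; exact: H.
- have : {ae mu, forall s i, - a < s -> is_derive s (1 : R) (D k i) `|g_ k i s - g i s|}.
    by apply: ae_count => i; exact: (primitive_derive (- a) (mD k i) (DC k i)).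
  by apply: ae_mono => s H /uva h i; exact: H.
- have : {ae mu, forall s i, - a < s -> is_derive s (1 : R) (G b i) `|g i s - b i|}.
    by apply: ae_count => i; exact: (primitive_derive (- a) (mG b i) (GC b i)).
  by apply: ae_mono => s H /uva h i; exact: H.
- by apply: ae_mono HH => s H /suv; exact: H.
Unshelve. all: by end_near. Qed.

(** Letting [k] grow removes [D] and the drop; afterwards [e] tends to 0. *)
Lemma limit_increment (b : 'I_N -> R) (eps u v : R) : `|eps| = 1 ->
  - a <= u -> u <= v -> v <= a ->
  eps * (Q v - Q u - \sum_i b i * (U i v - U i u)) <= \sum_i (G b i v - G b i u).
Proof.
move=> eps1 au uv va; apply/ler_addgt0Pr => e e0.
(* Dividing by the window length [a + a] leaves an error [e' * (v - u)] of at most [e]. *)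
pose e' := e / (a + a).
have e'0 : 0 < e' by rewrite divr_gt0 // addr_gt0.
have [C' C'0 H] := limit_increment_approx b e'0 eps1 au uv va.
have uin : - a <= u <= a by rewrite au (le_trans uv va).
have vin : - a <= v <= a by rewrite va andbT (le_trans au uv).
have D0 i s : D k i s @[k --> \oo] --> (0 : R).
  exact: (primitive_dist_cvg _ _ (fun k => mg_ k i) (mg i) (fun k => gC_ k i) (g_cvg i)).
have sum0 (x : nat -> 'I_N -> R) (y : 'I_N -> R) :
    (forall i, x k i @[k --> \oo] --> y i) ->
    \sum_i x k i @[k --> \oo] --> \sum_i y i.
  by move=> xy; apply: cvg_big => [|i _]; [exact: add_continuous | exact: xy].
apply: (@le_trans _ _ (\sum_(i < N) (0 - 0) + \sum_i (G b i v - G b i u) + e' * (v - u) + C' * 0)).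
  apply: (ler_cvg_to _ _ H).
    apply: cvgMr; apply: cvgB; first by apply: cvgB; exact: Q_cvg.
    by apply: sum0 => i; apply: cvgMr; apply: cvgB; exact: U_cvg.
  apply: cvgD; last by apply: cvgMr.
  apply: cvgD; last exact: cvg_cst.
  apply: cvgD; last exact: cvg_cst.
  by apply: sum0 => i; apply: cvgB; exact: D0.
rewrite subrr big1 // add0r mulr0 addr0 lerD2l.
apply: (@le_trans _ _ (e' * (a + a))).
  apply: ler_wpM2l; first exact: ltW.
  by have : v - u <= a - - a; [exact: lerB | rewrite opprK].
by rewrite /e' divfK // gt_eqF // addr_gt0.
Qed.

Lemma limit_derivative : {ae mu, forall s, - a < s < a ->
  is_derive s (1 : R) Q (\sum_i ud i s * g i s)}.
Proof.
have GL : {ae mu, forall t i, - a < t ->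
    is_derive t (1 : R) (primitive (- a) (fun s => `|g i s - g i t|)) 0}.
  by apply: ae_count => i; exact: (primitive_derive_lebesgue_pt _ (mg i) (gC i)).
apply: ae_mono (ae_and GL Ud) => t [dG dU] ta; have /andP[at_ ta'] := ta.
(* The rates are frozen at [t]. What this linear model misses is [P], whose increments are bounded
   by those of the [G b i], flat at [t]. *)
pose b i := g i t.
pose P s := Q s - \sum_i b i * U i s.
have -> : Q = (fun s => P s + \sum_i b i * U i s) by apply/funext => s; rewrite /P subrK.
have -> : \sum_i ud i t * g i t = 0 + \sum_i b i * ud i t.
  by rewrite add0r; apply: eq_bigr => i _; rewrite mulrC.
suff dP : is_derive t (1 : R) P 0.
  exact: (is_derive_add dP (is_derive_bigsum (fun i => is_derive_scale (b i) (dU ta i)))).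
have r0 : 0 < Num.min (t + a) (a - t) by rewrite lt_min; apply/andP; split; lra.
apply: (is_derive_dominated (G := fun s => \sum_i G b i s) r0); last first.
  have := @is_derive_bigsum N (G b) (fun=> 0) t (fun i => dG i at_).
  rewrite big1 //.
have gen u v : - a <= u -> u <= v -> v <= a ->
    `|P v - P u| <= \sum_i G b i v - \sum_i G b i u.
  move=> au uv va; rewrite -sumrB.
  have PE : P v - P u = Q v - Q u - \sum_i b i * (U i v - U i u).
    have -> : \sum_i b i * (U i v - U i u) = \sum_i b i * U i v - \sum_i b i * U i u.
      by rewrite -sumrB; apply: eq_bigr => i _; rewrite mulrBr.
    by rewrite /P; ring.
  (* The signs -1 and 1 of [eps] give the two halves of the absolute value. *)
  rewrite ler_norml PE; apply/andP; split.
    have := @limit_increment b (-1) u v; rewrite normrN1 => /(_ erefl au uv va).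
    by rewrite mulN1r; lra.
  by have := @limit_increment b 1 u v; rewrite normr1 mul1r => /(_ erefl au uv va).
move=> s; rewrite lt_min => /andP[h1 h2].
move: h1 h2; rewrite !ltr_norml => /andP[? ?] /andP[? ?].
have [st|/ltW ts] := leP s t.
  rewrite distrC [leRHS]distrC; apply: le_trans (ler_norm _); apply: gen => //; lra.
by apply: le_trans (ler_norm _); apply: gen => //; lra.
Qed.

End LimitDerivative.

Section Convergence.
Context {R : realType}.
Local Notation mu := (@lebesgue_measure R).

Lemma cvg_rVP (n : nat) (T : Type) (G : set_system T) (FG : Filter G) (v : T -> 'rV[R]_n) (l : 'rV[R]_n) :
  v k @[k --> G] --> l <-> forall j, v k 0 j @[k --> G] --> l 0 j.
Proof.
split=> [H j|H].
  apply: (@cvg_comp _ _ _ v (fun w : 'rV[R]_n => w 0 j) _ _ _ H).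
  exact: coord_continuous.
apply/cvg_ballP => e e0; rewrite near_simpl /=.
have : \forall k \near G, forall j, `|l 0 j - v k 0 j| < e.
  apply: filter_forall => j; move/cvgrPdist_lt: (H j); exact.
by apply: filterS => k Hk; apply/ball_rVP.
Qed.

Lemma homo_cvg_infty (phi : nat -> nat) : {homo phi : k l / (k < l)%N} ->
  phi k @[k --> \oo] --> \oo.
Proof.
move=> Hphi A [N _ NA]; exists N => // k /= Nk; apply: NA => /=.
apply: (leq_trans Nk); elim: {Nk} k => [//|k IH].
exact: leq_ltn_trans IH (Hphi _ _ (ltnSn k)).
Qed.

Lemma times_to_infinity_near (g : nat -> R) (a : R) : times_to_infinity g ->
  \forall k \near \oo, a <= g k.
Proof. by move=> [_ /cvgryPge]; exact. Qed.

Lemma times_to_infinity_sub (g : nat -> R) (phi : nat -> nat) :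
  {homo phi : k l / (k < l)%N} -> times_to_infinity g -> times_to_infinity (g \o phi).
Proof.
move=> Hphi [g0 goo]; split; first by move=> k; exact: g0.
exact: (cvg_comp _ _ (homo_cvg_infty Hphi) goo).
Qed.

Lemma is_derive_shift (F : R -> R) (c s d : R) : is_derive (c + s) (1 : R) F d ->
  is_derive s (1 : R) (fun t => F (c + t)) d.
Proof.
move=> /is_derive_epsP H; apply/is_derive_epsP => e /H[r r0 Hr]; exists r => // t.
have := Hr (c + t); have -> : c + t - (c + s) = t - s by ring.
exact.
Qed.

Lemma is_derive_unique (F : R -> R) (t d1 d2 : R) :
  is_derive t (1 : R) F d1 -> is_derive t (1 : R) F d2 -> d1 = d2.
Proof. by move=> [_ <-] [_ <-]. Qed.

Lemma is_derive_nondecreasing_ge0 (F : R -> R) (t d : R) :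
  {homo F : x y / x <= y} -> is_derive t (1 : R) F d -> 0 <= d.
Proof.
move=> nd /is_derive_epsP H; rewrite leNgt; apply/negP => d0.
have nd0 : 0 < - d / 2 by lra.
have [r r0 Hr] := H _ nd0.
have := Hr (t + r / 2); have -> : t + r / 2 - t = r / 2 by ring.
rewrite ger0_norm ?ltr_pdivrMr //; last lra.
move=> /(_ _)/ler_normlP[|_]; first lra.
have : F t <= F (t + r / 2) by apply: nd; lra.
have : d * (r / 2) < 0 by rewrite nmulr_rlt0 // divr_gt0.
move=> h1 h2; have -> : - d / 2 * (r / 2) = - (d * (r / 2)) / 2 by ring.
lra.
Qed.

(** The lemmas on primitives demand a bound at every time; setting the representative to 0 on a null
    set provides it. *)
Lemma ae_borel_bounded (F : R -> R) (C : R) : 0 <= C -> ae_borel F ->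
  {ae mu, forall t, `|F t| <= C} ->
  exists h : R -> R, [/\ measurable_fun [set: R] h, forall t, `|h t| <= C &
    {ae mu, forall t, F t = h t}].
Proof.
move=> C0 [h mh Fh] FC; have [Z [mZ Z0 HZ]] := ae_conull (ae_and Fh FC).
exists (h \_ (~` Z)); split; first exact: measurable_patch0.
  move=> t; have [Zt|nZ] := pselect (Z t); first by rewrite patchC_in ?normr0.
  by rewrite patchC_notin //; have [<-] := HZ t nZ.
by apply: (conull_ae mZ Z0) => t nZ; rewrite patchC_notin //; have [->] := HZ t nZ.
Qed.

(** The set where the signal is [i] differs from its interior, an open set, only at jump times, and
    these are countably many. *)
Lemma switching_signal_ae_borel (N : nat) (sg : R -> 'I_N) i : switching_signal sg ->
  ae_borel (fun t => (sg t == i)%:R).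
Proof.
move=> [_ fin].
pose A := [set t | sg t = i].
exists (\1_(interior A)).
  by apply: measurable_indic; apply: open_measurable; exact: open_interior.
pose Dm (m : nat) := [set t : R | - m%:R <= t <= m%:R /\ ~ (\forall s \near t, sg s = sg t)].
have nDm : mu.-negligible (\bigcup_m Dm m).
  apply: negligible_bigcup => m.
  have cm : countable (Dm m) by apply: finite_set_countable; exact: fin.
  have mm : measurable (Dm m) by apply: countable_measurable => // t; exact: measurable_set1.
  apply/negligibleP; first exact: mm.
  exact: countable_lebesgue_measure0.
apply: negligibleS nDm => t /= nt; exists (Num.bound `|t|) => //=.
split; first by rewrite -ler_norml; apply/ltW/archi_boundP.
move=> nearE; apply: nt; rewrite indicE; congr (_%:R); congr nat_of_bool.
have [ti|nti] := eqVneq (sg t) i.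
  rewrite mem_set //; rewrite /A /interior -ti; exact: nearE.
by rewrite memNset // => /interior_subset /= ti; rewrite ti eqxx in nti.
Qed.

Lemma compact_rV_closed n (K : set 'rV[R]_n) : compact K -> closed K.
Proof. exact: compact_closed. Qed.

Lemma bounded_coord n (K : set 'rV[R]_n) : compact K -> exists B : R, forall v, K v ->
  forall j, `|v 0 j| <= B.
Proof.
move=> cK; have [B [_ HB]] := compact_bounded cK.
exists (B + 1) => v Kv j; apply: (@le_trans _ _ `|v|); last by apply: HB => //; rewrite ltrDl.
by rewrite [leRHS]/Num.Def.normr /= mx_normrE; apply: (le_trans _ (le_bigmax _ _ (0, j))).
Qed.

End Convergence.

(** * Quantitative form of the zeroing pair property *)

Section ZeroingPair.
Context {R : realType} {n N : nat}.
Local Notation mu := (@lebesgue_measure R).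
Variables (X : set 'rV[R]_n) (eta : 'I_N -> R -> 'rV[R]_n -> R)
  (Df f fhat : 'I_N -> R -> 'rV[R]_n -> 'rV[R]_n).
Hypotheses (eta0 : forall i t xi, 0 <= t -> X xi -> 0 <= eta i t xi)
  (fdec : forall i (t : R) (xi : 'rV[R]_n), 0 <= t -> X xi ->
     f i t xi = fhat i t xi + Df i t xi)
  (fbnd : forall i, uniformly_bounded (@Rge0 R) X (f i))
  (fhatbnd : forall i, uniformly_bounded (@Rge0 R) X (fhat i))
  (etaDf : forall i, zeroing_pair X (to_R1 (eta i)) (Df i)).

(** If every threshold failed, there would be times at least [k] and points of [K] with [eta] below
    [1 / (k + 1)] but a coordinate of [Df] above [e]: a sequence excluded by the zeroing pair. *)
Lemma zeroing_pair_uniform K eps e i : compact K -> K `<=` X -> 0 < eps ->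
  (forall v, K v -> eps <= enorm v) -> 0 < e ->
  exists T d : R, [/\ 0 <= T, 0 < d & forall t v, T <= t -> K v -> eta i t v < d ->
    forall j, `|Df i t v 0 j| <= e].
Proof.
move=> cK KX eps0 Keps e0; apply: contrapT => H.
have /choice[tv Htv] : forall k : nat, exists tv : R * 'rV[R]_n,
    [/\ k%:R <= tv.1, K tv.2, eta i tv.1 tv.2 < k.+1%:R^-1 &
      exists j, e < `|Df i tv.1 tv.2 0 j|].
  move=> k; apply: contrapT => nk; apply: H; exists k%:R, k.+1%:R^-1.
  split; [exact: ler0n | by rewrite invr_gt0 ltr0Sn |].
  move=> t v kt Kv ev j; rewrite leNgt; apply/negP => ej; apply: nk.
  by exists (t, v); split=> //; exists j.
pose ga k := (tv k).1; pose v k := (tv k).2.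
have ga_oo : times_to_infinity ga.
  split=> [k|]; first by have [h _ _ _] := Htv k; exact: le_trans h.
  apply/cvgryPge => A; near=> k; have [h _ _ _] := Htv k; apply: le_trans h.
  by near: k; exact: nbhs_infty_ger.
have e_cvg : to_R1 (eta i) (ga k) (v k) @[k --> \oo] --> (0 : 'rV[R]_1).
  apply/cvg_rVP => j; rewrite mxE; apply/cvgrPdist_lt => q q0.
  have := near_infty_natSinv_lt (PosNum q0); apply: filterS => k /= hk.
  have [h1 h2 h3 _] := Htv k.
  rewrite mxE ord1 eqxx mulr1n sub0r normrN ger0_norm; first exact: lt_trans hk.
  by apply: eta0; [exact: le_trans h1 | exact: KX].
have Kv k : K (v k) by have [] := Htv k.
have := etaDf ga_oo cK KX eps0 Kv (fun k => Keps _ (Kv k)) e_cvg.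
move=> /cvg_ballP/(_ _ e0) [k0 _ Hk0].
have [_ _ _ [j]] := Htv k0; rewrite ltNge => /negP; apply.
have /(ball_rVP _ _ e0)/(_ j) := Hk0 k0 (leqnn k0).
by rewrite mxE sub0r normrN => /ltW.
Unshelve. all: by end_near. Qed.

(* Where [eta i] is small use the zeroing pair, elsewhere the bounds on [f] and [fhat]. *)
Lemma zeroing_pair_bound K eps e : compact K -> K `<=` X -> 0 < eps ->
  (forall v, K v -> eps <= enorm v) -> 0 < e ->
  exists T C : R, [/\ 0 <= T, 0 <= C & {ae mu, forall t, T <= t -> forall i v, K v ->
     forall j, `|Df i t v 0 j| <= e + C * eta i t v}].
Proof.
move=> cK KX eps0 Keps e0.
have [M1 M10 H1] := uniformly_bounded_fin fbnd cK KX.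
have [M2 M20 H2] := uniformly_bounded_fin fhatbnd cK KX.
have /choice[T /choice[d Hd]] : forall i, exists T d : R, [/\ 0 <= T, 0 < d &
    forall t v, T <= t -> K v -> eta i t v < d -> forall j, `|Df i t v 0 j| <= e].
  by move=> i; exact: (zeroing_pair_uniform i cK KX eps0 Keps e0).
have T0 i : 0 <= T i by have [] := Hd i.
have d0 i : 0 < d i by have [] := Hd i.
have c0 i : 0 <= (M1 + M2) / d i by rewrite divr_ge0 ?addr_ge0 // ltW.
(* Sums of nonnegative terms dominate the threshold and the constant of each mode. With
   [(M1 + M2) / d i], the condition [eta i >= d i] already pays for the crude bound [M1 + M2]. *)
exists (\sum_i T i), (\sum_i (M1 + M2) / d i).
split; [exact: sumr_ge0 | exact: sumr_ge0 |].
apply: ae_mono (ae_and H1 H2) => t [h1 h2] Tt i v Kv j.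
have Ti : T i <= t by apply: le_trans Tt; rewrite (bigD1 i) //= lerDl sumr_ge0.
have t0 : 0 <= t by exact: le_trans Ti.
have Ci : (M1 + M2) / d i <= \sum_i (M1 + M2) / d i.
  by rewrite [leRHS](bigD1 i) //= lerDl sumr_ge0.
have e00 := eta0 i t0 (KX _ Kv).
have [ed|de] := ltP (eta i t v) (d i).
  have [_ _ h] := Hd i; apply: (le_trans (h t v Ti Kv ed j)).
  by rewrite lerDl mulr_ge0 // sumr_ge0.
apply: (@le_trans _ _ (M1 + M2)).
  have -> : Df i t v 0 j = f i t v 0 j - fhat i t v 0 j.
    by rewrite fdec //; [rewrite mxE; ring | exact: KX].
  apply: (le_trans (ler_normB _ _)); apply: lerD.
    exact: (le_trans (coord_le_enorm _ _) (h1 t0 i v Kv)).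
  exact: (le_trans (coord_le_enorm _ _) (h2 t0 i v Kv)).
apply: (@le_trans _ _ ((M1 + M2) / d i * eta i t v)).
  by rewrite mulrAC ler_pdivlMr //; apply: ler_wpM2l => //; exact: addr_ge0.
by apply: (@le_trans _ _ ((\sum_i (M1 + M2) / d i) * eta i t v)); [exact: ler_wpM2r | rewrite lerDr ltW].
Qed.

End ZeroingPair.

(** * Equations satisfied by the limit of recentred solutions *)

Section LimitTrajectory.
Context {R : realType} {n N : nat}.
Local Notation mu := (@lebesgue_measure R).
Variables (X K : set 'rV[R]_n) (f : 'I_N -> R -> 'rV[R]_n -> 'rV[R]_n).
Variables (V Vt : R -> 'rV[R]_n -> R) (Vx : R -> 'rV[R]_n -> 'rV[R]_n)
  (eta : 'I_N -> R -> 'rV[R]_n -> R).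
Hypotheses (cK : compact K) (KX : K `<=` X) (Xopen : open X) (VC1 : C1_with X V Vt Vx).
Hypothesis fbnd : forall i, uniformly_bounded (@Rge0 R) X (f i).
Hypotheses (eta0 : forall i t xi, 0 <= t -> X xi -> 0 <= eta i t xi)
  (Vdot : forall i (t : R) (xi : 'rV[R]_n), 0 <= t -> X xi ->
     Vt t xi + \sum_(j < n) Vx t xi 0 j * f i t xi 0 j <= - eta i t xi).

Variables (p : nat -> switched_path R n N) (tau : nat -> R) (x : R -> 'rV[R]_n).
Let y k s := state (p k) (tau k + s).
Let W k s := V (tau k + s) (y k s).
Let c k s := signal (p k) (tau k + s).
Hypotheses (sol : forall k, solution X f (p k)) (tau_oo : times_to_infinity tau).
Hypothesis win : forall a : R, \forall k \near \oo,
  [/\ t0 (p k) <= tau k - a, ((tau k + a)%:E < tf (p k))%E &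
      forall s, - a <= s <= a -> K (y k s)].
Hypothesis drop : forall a : R, W k (- a) - W k a @[k --> \oo] --> (0 : R).
Hypothesis x_cvg : forall s j, y k s 0 j @[k --> \oo] --> x s 0 j.

Lemma window_lip : exists2 M : R, 0 <= M & forall a : R, \forall k \near \oo,
  forall j, lip_on (- a) a M (fun s => y k s 0 j).
Proof.
have [M M0 HM] := solution_lip fbnd cK KX; exists M => // a.
apply: filterS (win a) => k [w1 w2 w3] j u v au uv va.
have yK t : tau k - a <= t <= tau k + a -> K (state (p k) t).
  move=> /andP[? ?]; have := w3 (t - tau k); rewrite /y [tau k + _]addrC subrK; apply.
  by apply/andP; split; lra.
have := HM (p k) _ _ (sol k) w1 w2 yK j (tau k + u) (tau k + v).
have -> : tau k + v - (tau k + u) = v - u by ring.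
by apply; lra.
Qed.

Lemma limit_in_K s : K (x s).
Proof.
have yx : y k s @[k --> \oo] --> x s by apply/cvg_rVP => j; exact: x_cvg.
apply: (@closed_cvg _ _ _ _ (fun k => y k s) K (compact_rV_closed cK) _ _ yx).
apply: filterS (win `|s|) => k [_ _]; apply.
by rewrite -ler_norml.
Qed.

Lemma limit_lip : exists2 M : R, 0 <= M & forall a j, lip_on (- a) a M (fun s => x s 0 j).
Proof.
have [M M0 HM] := window_lip; exists M => // a j u v au uv va.
have h : `|y k v 0 j - y k u 0 j| @[k --> \oo] --> `|x v 0 j - x u 0 j|.
  by apply: cvg_norm; apply: cvgB; exact: x_cvg.
apply: (ler_cvg_to h (cvg_cst _)).
by apply: filterS (HM a) => k Hk; exact: Hk.
Qed.

Lemma limit_enorm_lip : exists2 L : R, 0 <= L & forall u v, enorm (x u - x v) <= L * `|u - v|.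
Proof.
have [M M0 HM] := limit_lip; exists (\sum_(j < n) M); first exact: sumr_ge0.
move=> u v; apply: (le_trans (enorm_le_sum _)); rewrite mulr_suml.
apply: ler_sum => j _; rewrite !mxE.
have := HM (Num.max `|u| `|v|) j.
have ua : `|u| <= Num.max `|u| `|v| by rewrite le_max lexx.
have va : `|v| <= Num.max `|u| `|v| by rewrite le_max lexx orbT.
move: (Num.max `|u| `|v|) ua va => a; rewrite (ler_norml u) (ler_norml v) => /andP[? ?] /andP[? ?] H.
have [uv|/ltW vu] := leP u v.
  by rewrite distrC [X in _ <= _ * X]distrC [X in _ * X]ger0_norm ?subr_ge0 //; exact: H.
by rewrite [X in _ <= _ * X]ger0_norm ?subr_ge0 //; exact: H.
Qed.

Lemma window_V (a : R) : \forall k \near \oo,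
  [/\ exists L, lip_on (- a) a L (W k),
      forall u v, - a <= u -> u <= v -> v <= a -> W k v <= W k u &
      {ae mu, forall s, - a < s < a ->
         exists2 d, is_derive s (1 : R) (W k) d & d <= - eta (c k s) (tau k + s) (y k s)}].
Proof.
apply: filterS (win a) => k [w1 w2 w3].
have [a0|a0] := leP 0 a; last first.
  split.
  - by exists 0 => u v *; exfalso; lra.
  - by move=> u v *; exfalso; lra.
  - by apply: ae_all => s /andP[? ?]; exfalso; lra.
split.
- have [|L HL] := solution_V_lip fbnd Xopen VC1 (sol k) w1 _ w2; first by lra.
  exists L => u v au uv va.
  have := HL (tau k + u) (tau k + v).
  have -> : tau k + v - (tau k + u) = v - u by ring.
  by apply; lra.
- move=> u v au uv va.
  apply: (solution_V_nonincreasing fbnd Xopen VC1 eta0 Vdot (sol k)); [lra|lra|].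
  by apply: le_lt_trans w2; rewrite lee_fin; lra.
- apply: ae_mono (ae_shift (tau k) (solution_V_dissipation Xopen VC1 Vdot (sol k))).
  move=> s H /andP[as_ sa].
  have h1 : t0 (p k) < tau k + s by lra.
  have h2 : ((tau k + s)%:E < tf (p k))%E by apply: lt_trans w2; rewrite lte_fin; lra.
  have [d dV dle] := H h1 h2; exists d => //.
  exact: (@is_derive_shift R (fun s => V s (state (p k) s))).
Qed.

Variables (U_ : nat -> 'I_N -> R -> R) (U ud : 'I_N -> R -> R).
Hypotheses (U_lip : forall a : R, \forall k \near \oo, forall i, lip_on (- a) a 1 (U_ k i))
  (U_der : forall a : R, \forall k \near \oo, {ae mu, forall s, - a < s < a ->
     forall i, is_derive s (1 : R) (U_ k i) (c k s == i)%:R})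
  (U_cvg : forall i s, U_ k i s @[k --> \oo] --> U i s)
  (Ud : {ae mu, forall s i, is_derive s (1 : R) (U i) (ud i s)}).

(* Common form of the state equation ([Q_] a coordinate of the state), of the output
   equation ([q] = eta, [Q_] = 0) and of the simplex constraint ([q] = 1, [Q_] = id). *)
Lemma limit_equation (q qg : 'I_N -> R -> 'rV[R]_n -> R) (C : R) (J : 'I_N -> set R)
    (w : 'I_N -> R -> R) (Q_ : nat -> R -> R) (Q : R -> R) :
  (forall i xi, X xi -> lebesgue_measurable_fun (@Rge0 R) (q i ^~ xi)) ->
  (forall i, mu.-negligible (@Rge0 R `\` J i)) -> (forall i, classK (w i)) ->
  (forall i t xi zeta, J i t -> K xi -> K zeta ->
     `|q i t xi - q i t zeta| <= w i (enorm (xi - zeta))) ->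
  0 <= C -> {ae mu, forall t, 0 <= t -> forall i xi, K xi -> `|q i t xi| <= C} ->
  (forall i, {ae mu, forall s, forall xi, X xi ->
     q i (tau k + s) xi @[k --> \oo] --> qg i s xi}) ->
  (forall a : R, \forall k \near \oo, exists L, lip_on (- a) a L (Q_ k)) ->
  (forall s, Q_ k s @[k --> \oo] --> Q s) ->
  (forall a e : R, 0 < e -> exists2 C' : R, 0 <= C' &
     \forall k \near \oo, {ae mu, forall s, - a < s < a -> forall dw,
       is_derive s (1 : R) (W k) dw -> dw <= - eta (c k s) (tau k + s) (y k s) ->
       exists2 dq, is_derive s (1 : R) (Q_ k) dq &
           `|dq - q (c k s) (tau k + s) (y k s)| <= e - C' * dw}) ->
  {ae mu, forall s, is_derive s (1 : R) Q (\sum_i ud i s * qg i s (x s))}.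
Proof.
move=> mq nJ wK qw C0 qC qlim Q_lip Q_cvg est.
have [L L0 xL] := limit_enorm_lip.
(* The mode functions are evaluated along the limit [x] and not along [y k]: for fixed [s] the
   argument is then independent of [k], and the limiting functions apply. The value 0 at negative
   times affects finitely many [k] for each [s]. *)
pose F k i s := if 0 <= tau k + s then q i (tau k + s) (x s) else 0.
have tau_ge b : \forall k \near \oo, b <= tau k := times_to_infinity_near b tau_oo.
have FB k i : ae_borel (F k i).
  (* Measurability of [q i] is known in absolute time, so [x] is moved back there for the
     superposition and the result is shifted again. *)
  pose y' t := x (t - tau k).
  have := @superposition_ae_borel R n X K (q i) y' L (w i) (J i) KX.
  move=> /(_ (fun t => limit_in_K _) _ (mq i) (nJ i) (wK i) (qw i)) h.
  have {}h : ae_borel (fun t => if 0 <= t then q i t (y' t) else 0).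
    by apply: h => u v; have := xL (u - tau k) (v - tau k); have -> : u - tau k - (v - tau k) = u - v by ring.
  have := ae_borel_shift (tau k) h; apply: ae_borel_eq; apply: ae_all => s.
  by rewrite /F /y' [tau k + s - tau k]addrC addKr.
have FC k i : {ae mu, forall s, `|F k i s| <= C}.
  apply: ae_mono (ae_shift (tau k) qC) => s H; rewrite /F; case: ifP => h; last by rewrite normr0.
  by apply: H => //; exact: limit_in_K.
have Flim i : {ae mu, forall s, F k i s @[k --> \oo] --> qg i s (x s)}.
  apply: ae_mono (qlim i) => s H; have := H (x s) (KX (limit_in_K s)).
  apply: cvg_trans; apply: near_eq_cvg; apply: filterS (tau_ge (- s)) => k hk.
  by rewrite /F ifT //; lra.
have GB i : ae_borel (fun s => qg i s (x s)) by apply: (ae_borel_cvg (FB ^~ i)).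
have GC i : {ae mu, forall s, `|qg i s (x s)| <= C}.
  have : {ae mu, forall s k, `|F k i s| <= C} by apply: ae_nat => k; exact: FC.
  move=> /(ae_and (Flim i)); apply: ae_mono => s [h1 h2].
  by apply: (ler_cvg_to (cvg_norm h1) (cvg_cst C)); exact: nearW.
have /choice[g_ Hg_] : forall ki : nat * 'I_N, exists h : R -> R,
    [/\ measurable_fun [set: R] h, forall t, `|h t| <= C & {ae mu, forall t, F ki.1 ki.2 t = h t}].
  by move=> [k i]; exact: ae_borel_bounded.
have /choice[g Hg] : forall i : 'I_N, exists h : R -> R,
    [/\ measurable_fun [set: R] h, forall t, `|h t| <= C & {ae mu, forall t, qg i t (x t) = h t}].
  by move=> i; exact: ae_borel_bounded.
have gg_ : {ae mu, forall s (ki : nat * 'I_N), F ki.1 ki.2 s = g_ ki s}.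
  by apply: ae_count => ki; have [] := Hg_ ki.
have gg : {ae mu, forall s i, qg i s (x s) = g i s}.
  by apply: ae_count => i; have [] := Hg i.
suff H : {ae mu, forall (s : R) (m : nat), - m.+1%:R < s < m.+1%:R ->
    is_derive s (1 : R) Q (\sum_i ud i s * g i s)}.
  apply: ae_mono (ae_and H gg) => s [Hs gs].
  have := Hs (Num.bound `|s|).
  have -> : \sum_i ud i s * qg i s (x s) = \sum_i ud i s * g i s.
    by apply: eq_bigr => i _; rewrite gs.
  apply; rewrite -ltr_norml; apply: (lt_trans (archi_boundP (normr_ge0 s))).
  by rewrite ltr_nat.
apply: ae_nat => m; set a : R := m.+1%:R.
have a0 : 0 < a by rewrite /a ltr0Sn.
apply: (@limit_derivative R N a C c U_ U ud (fun k i => g_ (k, i)) g Q_ W Q a0) => //.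
- by apply: ae_mono Ud => s H _.
- by move=> k i; have [] := Hg_ (k, i).
- by move=> i; have [] := Hg i.
- by move=> k i; have [] := Hg_ (k, i).
- by move=> i; have [] := Hg i.
- move=> i; apply: ae_mono (ae_and (Flim i) (ae_and gg_ gg)) => s [h1 [h2 h3]].
  by rewrite -h3; under eq_cvg do rewrite -(h2 (_, i)).
- by apply: filterS (window_V a) => k [].
- by apply: filterS (window_V a) => k [].
(* Half of [e] goes to the given estimate, the other half to replacing [y k] by [x] through the
   modulus [w i]. *)
move=> e e0; have e20 : 0 < e / 2 by lra.
have [C' C'0 est'] := est a _ e20; exists C' => //.
have /choice[d Hd] : forall i, exists d : R, 0 < d /\ forall r, 0 <= r -> r < d -> w i r < e / 2.
  by move=> i; have [d d0 H] := classK_near0 (wK i) e20; exists d.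
have [M M0 HM] := window_lip; have [M' M'0 HM'] := limit_lip.
have yx_near : \forall k \near \oo, forall i s, - a <= s <= a -> enorm (y k s - x s) < d i.
  apply: filter_forall => i; have [d0 _] := Hd i.
  (* Dividing by [n.+1] instead of [n] makes the sum over the coordinates strictly smaller than
     [d i], also in dimension 0. *)
  have dn0 : 0 < d i / n.+1%:R by rewrite divr_gt0.
  have : \forall k \near \oo, forall j s, - a <= s <= a -> `|y k s 0 j - x s 0 j| <= d i / n.+1%:R.
    apply: filter_forall => j.
    apply: (@equilip_uniform R a (M + M') _ (fun k s => y k s 0 j) (fun s => x s 0 j)
      (ltW a0) dn0 _ _ (fun s => @x_cvg s j)).
    - apply: filterS (HM a) => k Hk u v au uv va; apply: (le_trans (Hk j u v au uv va)).
      by apply: ler_wpM2r; lra.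
    - move=> u v au uv va; apply: (le_trans (HM' a j u v au uv va)).
      by apply: ler_wpM2r; lra.
  apply: filterS => k Hk s sa; apply: (le_lt_trans (enorm_le_sum _)).
  apply: (@le_lt_trans _ _ (\sum_(j < n) d i / n.+1%:R)).
    by apply: ler_sum => j _; rewrite !mxE; exact: Hk.
  rewrite sumr_const card_ord -[X in X < _]mulr_natr -mulrA gtr_pMr // mulrC ltr_pdivrMr // mul1r.
  by rewrite ltr_nat.
have nJ' : {ae mu, forall t, 0 <= t -> forall i, J i t}.
  have : {ae mu, forall t i, 0 <= t -> J i t}.
    apply: ae_count => i; apply: negligibleS (nJ i) => t /= /not_implyP[t0 nt]; split=> //.
  by apply: ae_mono => t H t0 i; exact: H.
near=> k.
have [w1 w2 w3] : [/\ t0 (p k) <= tau k - a, ((tau k + a)%:E < tf (p k))%E &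
      forall s, - a <= s <= a -> K (y k s)] by near: k; exact: win.
have [_ _ wV] : [/\ exists L, lip_on (- a) a L (W k),
      forall u v, - a <= u -> u <= v -> v <= a -> W k v <= W k u &
      {ae mu, forall s, - a < s < a ->
         exists2 d, is_derive s (1 : R) (W k) d & d <= - eta (c k s) (tau k + s) (y k s)}].
  by near: k; exact: window_V.
have yxk : forall i s, - a <= s <= a -> enorm (y k s - x s) < d i by near: k.
have estk : {ae mu, forall s, - a < s < a -> forall dw,
       is_derive s (1 : R) (W k) dw -> dw <= - eta (c k s) (tau k + s) (y k s) ->
       exists2 dq, is_derive s (1 : R) (Q_ k) dq &
           `|dq - q (c k s) (tau k + s) (y k s)| <= e / 2 - C' * dw} by near: k.
have tk : a <= tau k by near: k; exact: tau_ge.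
apply: ae_mono (ae_and (ae_and wV estk) (ae_and gg_ (ae_shift (tau k) nJ'))) => s.
move=> [[h1 h2] [h3 h4]] sa; have /andP[as_ sa'] := sa.
have ts : 0 <= tau k + s by lra.
have sa2 : - a <= s <= a by rewrite !ltW.
have [dw dWd dwle] := h1 sa; have [dq dQd dqle] := h2 sa dw dWd dwle.
exists dq, dw; split=> //.
have -> : g_ (k, c k s) s = q (c k s) (tau k + s) (x s) by rewrite -h3 /= /F ts.
have hw : `|q (c k s) (tau k + s) (y k s) - q (c k s) (tau k + s) (x s)| <= e / 2.
  apply: (le_trans (qw _ _ _ _ (h4 ts _) (w3 _ sa2) (limit_in_K s))).
  by apply/ltW; have [_ H] := Hd (c k s); apply: H; [exact: enorm_ge0 | exact: yxk].
have -> : dq - q (c k s) (tau k + s) (x s) = (dq - q (c k s) (tau k + s) (y k s)) +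
  (q (c k s) (tau k + s) (y k s) - q (c k s) (tau k + s) (x s)) by ring.
by apply: (le_trans (ler_normD _ _)); lra.
Unshelve. all: by end_near. Qed.

End LimitTrajectory.

(** * Occupation times of the modes *)

Section Occupation.
Context {R : realType} {N : nat}.
Local Notation mu := (@lebesgue_measure R).

Lemma lip_derivative_ge0 (a b L : R) (F : R -> R) : a <= b -> lip_on a b L F ->
  {ae mu, forall t, a < t < b -> exists2 d, is_derive t (1 : R) F d & 0 <= d} ->
  F a <= F b.
Proof.
move=> ab FL dF; suff : (-1) * F b <= (-1) * F a by lra.
apply: (lip_derivative_le0 ab (lip_onZ (-1) FL)).
apply: ae_mono dF => t H /H[d dFt d0]; exists ((-1) * d); last by lra.
exact: is_derive_scale.
Qed.

Lemma occupation_times (sg : nat -> R -> 'I_N) :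
  (forall k i, ae_borel (fun s => (sg k s == i)%:R : R)) ->
  exists U_ : nat -> 'I_N -> R -> R, [/\
    (forall a : R, \forall k \near \oo, forall i, lip_on (- a) a 1 (U_ k i)),
    (forall a : R, \forall k \near \oo, {ae mu, forall s, - a < s < a ->
       forall i, is_derive s (1 : R) (U_ k i) (sg k s == i)%:R}) &
    forall k i, U_ k i 0 = 0].
Proof.
move=> Bsg.
have /choice[h Hh] : forall ki : nat * 'I_N, exists h : R -> R,
    [/\ measurable_fun [set: R] h, forall t, `|h t| <= 1 &
     {ae mu, forall t, (sg ki.1 t == ki.2)%:R = h t}].
  move=> [k i]; apply: ae_borel_bounded => //; apply: ae_all => t /=.
  by case: (_ == _); rewrite ?normr1 ?normr0.
(* A primitive is useful only to the right of its base point; the base point [- k] leaves every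
   window as [k] grows. Subtracting the value at 0 then normalises independently of [k]. *)
pose P k i := primitive (- k%:R) (h (k, i)).
exists (fun k i s => P k i s - P k i 0); split=> [a|a|k i]; last by rewrite subrr.
- near=> k => i u v au uv va.
  have -> : P k i v - P k i 0 - (P k i u - P k i 0) = P k i v - P k i u by ring.
  have [mh hC _] := Hh (k, i).
  apply: (primitive_lip mh hC _ uv (lexx v)).
  have ak : a <= k%:R by near: k; exact: nbhs_infty_ger.
  lra.
- near=> k.
  have ak : a <= k%:R by near: k; exact: nbhs_infty_ger.
  have : {ae mu, forall s i, (sg k s == i)%:R = h (k, i) s /\
      (- k%:R < s -> is_derive s (1 : R) (P k i) (h (k, i) s))}.
    apply: ae_count => i; have [mh hC hE] := Hh (k, i).
    by apply: ae_and => //; exact: (primitive_derive (- k%:R) mh hC).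
  apply: ae_mono => s H /andP[as_ sa] i; have [-> Pd] := H i.
  have ks : - k%:R < s by lra.
  have := is_derive_add (Pd ks) (is_derive_cst (- P k i 0) s 1).
  by rewrite addr0.
Unshelve. all: by end_near. Qed.

End Occupation.

(** * Subsequences and admissible sequences *)

Section Admissible.
Context {R : realType} {n m N : nat}.
Variable (X : set 'rV[R]_n).

Lemma near_subseq (P : nat -> Prop) (phi : nat -> nat) : {homo phi : k l / (k < l)%N} ->
  (\forall k \near \oo, P k) -> \forall k \near \oo, P (phi k).
Proof. by move=> /homo_cvg_infty H PP; exact: (H _ PP). Qed.

Lemma limiting_function_sub (g gg : R -> 'rV[R]_n -> 'rV[R]_m) gamma phi :
  {homo phi : k l / (k < l)%N} -> limiting_function X g gamma gg ->
  limiting_function X g (gamma \o phi) gg.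
Proof.
move=> Hphi [E nE HE]; exists E => // s xi nEs Xxi.
exact: (cvg_comp _ _ (homo_cvg_infty Hphi) (HE s xi nEs Xxi)).
Qed.

Lemma admissible_sub (g : R -> 'rV[R]_n -> 'rV[R]_m) gamma phi :
  {homo phi : k l / (k < l)%N} -> admissible X g gamma -> admissible X g (gamma \o phi).
Proof.
move=> Hphi [tg [gg Hg]]; split; first exact: times_to_infinity_sub.
by exists gg; exact: limiting_function_sub.
Qed.

Lemma homo_comp (phi psi : nat -> nat) : {homo phi : k l / (k < l)%N} ->
  {homo psi : k l / (k < l)%N} -> {homo phi \o psi : k l / (k < l)%N}.
Proof. by move=> H1 H2 k l kl; apply/H1/H2. Qed.

(** The extractions are made mode by mode, and admissibility survives each later one. *)
Lemma precompact_family (g : 'I_N -> R -> 'rV[R]_n -> 'rV[R]_m) gamma :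
  (forall i, precompact_fun X (g i)) -> times_to_infinity gamma ->
  exists2 phi : nat -> nat, {homo phi : k l / (k < l)%N} &
    forall i, admissible X (g i) (gamma \o phi).
Proof.
move=> pg tg.
suff [phi Hphi H] : exists2 phi : nat -> nat, {homo phi : k l / (k < l)%N} &
    forall i, i \in enum 'I_N -> admissible X (g i) (gamma \o phi).
  by exists phi => // i; apply: H; rewrite mem_enum.
elim: (enum 'I_N) => [|i s [phi Hphi IH]]; first by exists id.
have [psi Hpsi H] := pg i _ (times_to_infinity_sub Hphi tg).
exists (phi \o psi); first exact: homo_comp.
move=> j; rewrite inE => /orP[/eqP ->|js]; first exact: H.
exact: (admissible_sub Hpsi (IH j js)).
Qed.

End Admissible.

Section CompleteTrajectory.
Context {R : realType} {n N : nat}.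
Local Notation mu := (@lebesgue_measure R).
Variables (X K : set 'rV[R]_n) (f : 'I_N -> R -> 'rV[R]_n -> 'rV[R]_n).
Variables (V Vt : R -> 'rV[R]_n -> R) (Vx : R -> 'rV[R]_n -> 'rV[R]_n)
  (eta : 'I_N -> R -> 'rV[R]_n -> R).
Hypotheses (cK : compact K) (KX : K `<=` X) (Xopen : open X) (VC1 : C1_with X V Vt Vx).
Hypothesis fbnd : forall i, uniformly_bounded (@Rge0 R) X (f i).
Hypotheses (eta0 : forall i t xi, 0 <= t -> X xi -> 0 <= eta i t xi)
  (Vdot : forall i (t : R) (xi : 'rV[R]_n), 0 <= t -> X xi ->
     Vt t xi + \sum_(j < n) Vx t xi 0 j * f i t xi 0 j <= - eta i t xi).

Variables (p : nat -> switched_path R n N) (tau : nat -> R) (x : R -> 'rV[R]_n).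
Let y k s := state (p k) (tau k + s).
Let W k s := V (tau k + s) (y k s).
Let c k s := signal (p k) (tau k + s).
Hypotheses (sol : forall k, solution X f (p k)) (tau_oo : times_to_infinity tau).
Hypothesis win : forall a : R, \forall k \near \oo,
  [/\ t0 (p k) <= tau k - a, ((tau k + a)%:E < tf (p k))%E &
      forall s, - a <= s <= a -> K (y k s)].
Hypothesis drop : forall a : R, W k (- a) - W k a @[k --> \oo] --> (0 : R).
Hypothesis x_cvg : forall s j, y k s 0 j @[k --> \oo] --> x s 0 j.
Variables (U_ : nat -> 'I_N -> R -> R) (U ud : 'I_N -> R -> R).
Hypotheses (U_lip : forall a : R, \forall k \near \oo, forall i, lip_on (- a) a 1 (U_ k i))
  (U_der : forall a : R, \forall k \near \oo, {ae mu, forall s, - a < s < a ->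
     forall i, is_derive s (1 : R) (U_ k i) (c k s == i)%:R})
  (U_cvg : forall i s, U_ k i s @[k --> \oo] --> U i s)
  (Ud : {ae mu, forall s i, is_derive s (1 : R) (U i) (ud i s)}).

Lemma limit_equation_coord m (g gg : 'I_N -> R -> 'rV[R]_n -> 'rV[R]_m) (j : 'I_m)
    (Q_ : nat -> R -> R) (Q : R -> R) :
  (forall i, [/\ uniformly_bounded (@Rge0 R) X (g i),
         measurable_in_t (@Rge0 R) X (g i),
         continuous_in_xi_uniformly (@Rge0 R) X (g i)
       & precompact_fun X (g i)]) ->
  (forall i, limiting_function X (g i) tau (gg i)) ->
  (forall a : R, \forall k \near \oo, exists L, lip_on (- a) a L (Q_ k)) ->
  (forall s, Q_ k s @[k --> \oo] --> Q s) ->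
  (forall a e : R, 0 < e -> exists2 C' : R, 0 <= C' &
     \forall k \near \oo, {ae mu, forall s, - a < s < a -> forall dw,
       is_derive s (1 : R) (W k) dw -> dw <= - eta (c k s) (tau k + s) (y k s) ->
       exists2 dq, is_derive s (1 : R) (Q_ k) dq &
           `|dq - g (c k s) (tau k + s) (y k s) 0 j| <= e - C' * dw}) ->
  {ae mu, forall s, is_derive s (1 : R) Q (\sum_i ud i s * gg i s (x s) 0 j)}.
Proof.
move=> reg lim Q_lip Q_cvg est.
have gb i : uniformly_bounded (@Rge0 R) X (g i) by have [] := reg i.
have [C C0 HC] := uniformly_bounded_fin gb cK KX.
have /choice[J /choice[w Hw]] : forall i, exists J w,
    [/\ mu.-negligible (@Rge0 R `\` J), classK w &
     forall t xi zeta, J t -> K xi -> K zeta ->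
       enorm (g i t xi - g i t zeta) <= w (enorm (xi - zeta))].
  move=> i; have [_ _ [J [_ nJ HJ]] _] := reg i; have [w wK Hw] := HJ K cK KX.
  by exists J, w.
apply: (limit_equation (q := fun i t xi => g i t xi 0 j)
  (qg := fun i t xi => gg i t xi 0 j) (C := C) (J := J) (w := w)
  cK KX Xopen VC1 fbnd eta0 Vdot sol tau_oo win drop x_cvg U_lip U_der U_cvg Ud _ _ _ _ C0 _ _ Q_lip Q_cvg est).
- by move=> i xi Xxi; have [_ mg _ _] := reg i; exact: mg.
- by move=> i; have [] := Hw i.
- by move=> i; have [] := Hw i.
- move=> i t xi zeta Jt Kxi Kz; have [_ _ H] := Hw i; apply: le_trans (H t xi zeta Jt Kxi Kz).
  by have := coord_le_enorm (g i t xi - g i t zeta) j; rewrite !mxE.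
- apply: ae_mono HC => t H t0 i xi Kxi; exact: (le_trans (coord_le_enorm _ _) (H t0 i xi Kxi)).
- move=> i; have [E nE HE] := lim i; apply: negligibleS nE => s /= ns.
  apply: contrapT => nEs; apply: ns => xi Xxi.
  by have /cvg_rVP/(_ j) := HE s xi nEs Xxi.
Qed.

(** Time itself advances at rate 1 in every mode. The identity thus has the derivative 1 as well as
    the sum of the limiting rates. *)
Lemma occupation_sum : {ae mu, forall s, \sum_i ud i s = 1}.
Proof.
have : {ae mu, forall s, is_derive s (1 : R) (id : R -> R) (\sum_i ud i s * 1)}.
  apply: (limit_equation (q := fun i t xi => 1) (qg := fun i t xi => 1) (C := 1)
    (J := fun=> @Rge0 R) (w := fun=> id) (Q_ := fun=> id)
    cK KX Xopen VC1 fbnd eta0 Vdot sol tau_oo win drop x_cvg U_lip U_der U_cvg Ud) => //.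
  - by move=> i xi _; exact: measurable_cst.
  - by move=> i; rewrite setDv; exact: negligible_set0.
  - move=> _; split=> //.
    by apply: continuous_subspaceT => t; exact: cvg_id.
  - by move=> i t xi zeta _ _ _; rewrite subrr normr0 enorm_ge0.
  - by apply: ae_all => t _ i xi _; rewrite normr1.
  - by move=> i; apply: ae_all => s xi _; exact: cvg_cst.
  - by move=> a; apply: nearW => k; exists 1; exact: lip_on_id.
  - by move=> s; exact: cvg_cst.
  - move=> a e e0; exists 0 => //; apply: nearW => k; apply: ae_all => s _ dw _ _.
    by exists 1; [exact: is_derive_id | rewrite subrr normr0 mul0r subr0 ltW].
apply: ae_mono => s H.
have <- := is_derive_unique H (is_derive_id s 1).
by apply: eq_bigr => i _; rewrite mulr1.
Qed.

End CompleteTrajectory.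

(** * The limit as a complete trajectory away from the origin *)

Section Contradiction.
Context {R : realType} {n N : nat}.
Local Notation mu := (@lebesgue_measure R).

Lemma enorm_lip_abs_continuous (x : R -> 'rV[R]_n) (L a b : R) : 0 <= L ->
  (forall u v, enorm (x u - x v) <= L * `|u - v|) -> abs_continuous_on a b x.
Proof.
move=> L0 xL e e0; exists (e / (L + 1)); first by rewrite divr_gt0 //; lra.
move=> q al be H _ S; apply: (@le_lt_trans _ _ (\sum_(k < q) (L + 1) * (be k - al k))).
  apply: ler_sum => k _; apply: (le_trans (xL _ _)).
  have [_ h _] := H k; rewrite ger0_norm ?subr_ge0 //.
  by apply: ler_wpM2r; rewrite ?subr_ge0 //; lra.
by rewrite -mulr_sumr mulrC -ltr_pdivlMr //; lra.
Qed.

(** A control lies in the simplex at all times, whereas the derivatives do so almost everywhere. On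
    the null set the vertex of mode [i0] is substituted. *)
Lemma control_of_ae (ud : 'I_N -> R -> R) : 'I_N ->
  (forall i, measurable_fun [set: R] (ud i)) ->
  {ae mu, forall s, simplex (\row_i ud i s)} ->
  exists2 u : R -> 'rV[R]_N, control u & {ae mu, forall s i, u s 0 i = ud i s}.
Proof.
move=> i0 mud /ae_conull[Z [mZ Z0 HZ]].
pose u s : 'rV[R]_N := \row_i ((ud i \_ (~` Z)) s + (i == i0)%:R * \1_Z s).
have uE s : ~ Z s -> u s = \row_i ud i s.
  move=> nZ; apply/rowP => i; rewrite !mxE patchC_notin // indicE memNset //.
  by rewrite mulr0 addr0.
exists u; last first.
  by apply: (conull_ae mZ Z0) => s nZ i; rewrite uE // mxE.
split=> [s|i].
  have [Zs|nZ] := pselect (Z s); last by rewrite uE //; exact: HZ.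
  have uE' i : u s 0 i = (i == i0)%:R.
    by rewrite !mxE patchC_in // indicE mem_set // mulr1 add0r.
  split=> [i|]; first by rewrite uE'; case: (_ == _).
  rewrite (bigD1 i0) //= uE' eqxx big1 ?addr0 // => i ii0.
  by rewrite uE' (negPf ii0).
have mu_ : measurable_fun [set: R] (fun s => u s 0 i).
  have -> : (fun s => u s 0 i) = (fun s => (ud i \_ (~` Z)) s + (i == i0)%:R * \1_Z s).
    by apply/funext => s; rewrite mxE.
  apply: measurable_funD; first exact: measurable_patch0.
  by apply: measurable_funM; [exact: measurable_cst | exact: measurable_indic].
move=> _ B mB; rewrite setTI; apply: sub_caratheodory.
by rewrite -[X in measurable X]setTI; exact: mu_.
Qed.

Variables (X K : set 'rV[R]_n) (f : 'I_N -> R -> 'rV[R]_n -> 'rV[R]_n).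
Variables (V Vt : R -> 'rV[R]_n -> R) (Vx : R -> 'rV[R]_n -> 'rV[R]_n)
  (eta : 'I_N -> R -> 'rV[R]_n -> R) (fhat Df : 'I_N -> R -> 'rV[R]_n -> 'rV[R]_n).
Hypotheses (Xopen : open X) (VC1 : C1_with X V Vt Vx).
Hypothesis fbnd : forall i, uniformly_bounded (@Rge0 R) X (f i).
Hypotheses (eta0 : forall i t xi, 0 <= t -> X xi -> 0 <= eta i t xi)
  (Vdot : forall i (t : R) (xi : 'rV[R]_n), 0 <= t -> X xi ->
     Vt t xi + \sum_(j < n) Vx t xi 0 j * f i t xi 0 j <= - eta i t xi).
Hypotheses (etareg : forall i,
     [/\ uniformly_bounded (@Rge0 R) X (to_R1 (eta i)),
         measurable_in_t (@Rge0 R) X (to_R1 (eta i)),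
         continuous_in_xi_uniformly (@Rge0 R) X (to_R1 (eta i))
       & precompact_fun X (to_R1 (eta i))])
  (fdec : forall i (t : R) (xi : 'rV[R]_n), 0 <= t -> X xi ->
     f i t xi = fhat i t xi + Df i t xi)
  (fhatreg : forall i,
     [/\ uniformly_bounded (@Rge0 R) X (fhat i),
         measurable_in_t (@Rge0 R) X (fhat i),
         continuous_in_xi_uniformly (@Rge0 R) X (fhat i)
       & precompact_fun X (fhat i)])
  (etaDf : forall i, zeroing_pair X (to_R1 (eta i)) (Df i))
  (wzsd : forall gamma, Lambda X fhat (fun i => to_R1 (eta i)) gamma ->
     forall (fg : 'I_N -> R -> 'rV[R]_n -> 'rV[R]_n)
            (hg : 'I_N -> R -> 'rV[R]_n -> 'rV[R]_1),
       (forall i, limiting_function X (fhat i) gamma (fg i)) ->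
       (forall i, limiting_function X (to_R1 (eta i)) gamma (hg i)) ->
       WZSD X fg hg).

Lemma no_nondissipating_windows eps (p : nat -> switched_path R n N) (tau : nat -> R) :
  compact K -> K `<=` X -> 0 < eps -> (forall v, K v -> eps <= enorm v) ->
  (forall k, solution X f (p k)) -> (forall k, switching_signal (signal (p k))) ->
  times_to_infinity tau ->
  (forall a : R, \forall k \near \oo,
    [/\ t0 (p k) <= tau k - a, ((tau k + a)%:E < tf (p k))%E &
      forall s, - a <= s <= a -> K (state (p k) (tau k + s))]) ->
  (forall a : R, V (tau k - a) (state (p k) (tau k - a)) -
     V (tau k + a) (state (p k) (tau k + a)) @[k --> \oo] --> (0 : R)) ->
  False.
Proof.
move=> cK KX eps0 Keps sol_ sw_ tau_oo_ win_ drop_.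
have fhat_pc i : precompact_fun X (fhat i) by have [] := fhatreg i.
have eta_pc i : precompact_fun X (to_R1 (eta i)) by have [] := etareg i.
have fhat_ub i : uniformly_bounded (@Rge0 R) X (fhat i) by have [] := fhatreg i.
(* Three nested extractions: [phi1] for the limits of [fhat], [phi2] for those of [eta], and later
   [phi3] for the states and the occupation times. *)
have [phi1 Hphi1 adm1] := precompact_family fhat_pc tau_oo_.
have [phi2 Hphi2 adm2] := precompact_family eta_pc (times_to_infinity_sub Hphi1 tau_oo_).
pose sg k s := signal (p (phi1 (phi2 k))) (tau (phi1 (phi2 k)) + s).
have [|U_' [U_lip' U_der' U_0']] := @occupation_times R N sg.
  move=> k i; apply: (ae_borel_shift (tau (phi1 (phi2 k)))
    (g := fun t => (signal (p (phi1 (phi2 k))) t == i)%:R)).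
  exact: switching_signal_ae_borel.
pose y' k s := state (p (phi1 (phi2 k))) (tau (phi1 (phi2 k)) + s).
have Hphi12 := homo_comp Hphi1 Hphi2.
have win' (a : R) : \forall k \near \oo,
    [/\ t0 (p (phi1 (phi2 k))) <= tau (phi1 (phi2 k)) - a,
        ((tau (phi1 (phi2 k)) + a)%:E < tf (p (phi1 (phi2 k))))%E &
      forall s, - a <= s <= a -> K (y' k s)].
  exact: (near_subseq Hphi12 (win_ a)).
have [M M0 HM] := @window_lip R n N X K f cK KX fbnd (p \o (phi1 \o phi2))
  (tau \o (phi1 \o phi2)) (fun k => sol_ _) win'.
(* A sum type puts coordinates and occupation times into one family, so that one extraction serves
   both; [M + 1] is a common Lipschitz constant. *)
pose F k (ji : 'I_n + 'I_N) s := match ji with inl j => y' k s 0 j | inr i => U_' k i s end.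
have [||phi3 Hphi3 [l Hl]] := @equilip_subsequence R ('I_n + 'I_N)%type (M + 1) F.
- move=> a [j|i] /=.
    apply: filterS (HM a) => k Hk u v au uv va; apply: (le_trans (Hk j u v au uv va)).
    by apply: ler_wpM2r; lra.
  apply: filterS (U_lip' a) => k Hk u v au uv va; apply: (le_trans (Hk i u v au uv va)).
  by apply: ler_wpM2r; lra.
- move=> [j|i] s /=.
    have [B HB] := bounded_coord cK; exists B.
    apply: filterS (win' `|s|) => k [_ _ H]; apply: HB; apply: H.
    by rewrite -ler_norml.
  (* Occupation times vanish at 0 and are 1-Lipschitz. *)
  exists `|s|; apply: filterS (U_lip' `|s|) => k Hk.
  have [s0|/ltW s0] := leP 0 s.
    have := Hk i 0 s _ s0 (ler_norm s); rewrite U_0' subr0 mul1r subr0 => h.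
    by rewrite [leRHS]ger0_norm //; apply: h; rewrite oppr_le0.
  have := Hk i s 0 _ s0 (normr_ge0 s); rewrite U_0' sub0r normrN mul1r sub0r => h.
  by rewrite [leRHS](ler0_norm s0); apply: h; rewrite lerNl -normrN ler_norm.
pose phi := phi1 \o (phi2 \o phi3).
have Hphi : {homo phi : k l / (k < l)%N} := homo_comp Hphi1 (homo_comp Hphi2 Hphi3).
pose q k := p (phi k); pose ta k := tau (phi k).
pose U_ k := U_' (phi3 k); pose U i := l (inr i).
pose x s : 'rV[R]_n := \row_j l (inl j) s.
have sol k : solution X f (q k) by exact: sol_.
have ta_oo : times_to_infinity ta := times_to_infinity_sub Hphi tau_oo_.
have win (a : R) : \forall k \near \oo,
  [/\ t0 (q k) <= ta k - a, ((ta k + a)%:E < tf (q k))%E &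
      forall s, - a <= s <= a -> K (state (q k) (ta k + s))] := near_subseq Hphi (win_ a).
have drop (a : R) : V (ta k + - a) (state (q k) (ta k + - a)) -
     V (ta k + a) (state (q k) (ta k + a)) @[k --> \oo] --> (0 : R).
  exact: (cvg_comp _ _ (homo_cvg_infty Hphi) (drop_ a)).
have x_cvg s j : state (q k) (ta k + s) 0 j @[k --> \oo] --> x s 0 j.
  by rewrite mxE; exact: (Hl (inl j) s).
have U_lip (a : R) : \forall k \near \oo, forall i, lip_on (- a) a 1 (U_ k i).
  exact: (near_subseq Hphi3 (U_lip' a)).
have U_der (a : R) : \forall k \near \oo, {ae mu, forall s, - a < s < a ->
     forall i, is_derive s (1 : R) (U_ k i) (signal (q k) (ta k + s) == i)%:R}.
  exact: (near_subseq Hphi3 (U_der' a)).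
have U_cvg i s : U_ k i s @[k --> \oo] --> U i s by exact: (Hl (inr i) s).
have inab (u v : R) : u <= v -> exists2 a : R, 0 <= a & - a <= u /\ v <= a.
  move=> uv; exists (`|u| + `|v|); first exact: addr_ge0.
  have := ler_norm v; have := ler_norm (- u); rewrite normrN.
  by have := normr_ge0 u; have := normr_ge0 v; split; lra.
have Und i : {homo U i : u v / u <= v}.
  move=> u v uv; have [a a0 [au va]] := inab u v uv.
  apply: (ler_cvg_to (@U_cvg i u) (@U_cvg i v)).
  apply: filterS (filterI (U_lip a) (U_der a)) => k [h1 h2].
  apply: (lip_derivative_ge0 uv (lip_on_sub au va (h1 i))).
  apply: ae_mono h2 => s H /andP[us sv]; exists (signal (q k) (ta k + s) == i)%:R => //.
  by apply: H; apply/andP; split; lra.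
have UL i u v : u <= v -> `|U i v - U i u| <= v - u.
  move=> uv; have [a a0 [au va]] := inab u v uv.
  have h : `|U_ k i v - U_ k i u| @[k --> \oo] --> `|U i v - U i u|.
    by apply: cvg_norm; apply: cvgB; exact: U_cvg.
  apply: (ler_cvg_to h (cvg_cst _)).
  by apply: filterS (U_lip a) => k Hk; rewrite -[leRHS]mul1r; exact: Hk.
have /choice[ud Hud] : forall i, exists h : R -> R, measurable_fun [set: R] h /\
    {ae mu, forall t, is_derive t (1 : R) (U i) (h t)}.
  by move=> i; have [h] := nondecreasing_lip_density (@Und i) (@UL i); exists h.
have Ud : {ae mu, forall s i, is_derive s (1 : R) (U i) (ud i s)}.
  by apply: ae_count => i; have [] := Hud i.
have adm_f i : admissible X (fhat i) ta.
  exact: (admissible_sub (homo_comp Hphi2 Hphi3) (adm1 i)).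
have adm_h i : admissible X (to_R1 (eta i)) ta := admissible_sub Hphi3 (adm2 i).
have /choice[fg Hfg] : forall i, exists g, limiting_function X (fhat i) ta g by move=> i; have [] := adm_f i.
have /choice[hg Hhg] : forall i, exists g, limiting_function X (to_R1 (eta i)) ta g by move=> i; have [] := adm_h i.
have sumud : {ae mu, forall s, \sum_i ud i s = 1}.
  exact: (occupation_sum cK KX Xopen VC1 fbnd eta0 Vdot sol ta_oo win drop x_cvg U_lip U_der U_cvg Ud).
have [u cu uE] : exists2 u : R -> 'rV[R]_N, control u & {ae mu, forall s i, u s 0 i = ud i s}.
  apply: control_of_ae; [exact: (signal (p 0%N) 0) | by move=> i; have [] := Hud i |].
  apply: ae_mono (ae_and Ud sumud) => s [h1 h2]; split=> [i|].
    by rewrite mxE; exact: is_derive_nondecreasing_ge0 (@Und i) (h1 i).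
  by rewrite -h2; apply: eq_bigr => i _; rewrite mxE.
have xK s : K (x s) by exact: (limit_in_K cK win x_cvg).
have [L L0 xL] := limit_enorm_lip cK KX fbnd sol win x_cvg.
have xder : {ae mu, forall s (j : 'I_n),
    is_derive s (1 : R) (fun t => x t 0 j) (\sum_i ud i s * fg i s (x s) 0 j)}.
  apply: ae_count => j.
  apply: (limit_equation_coord cK KX Xopen VC1 fbnd eta0 Vdot sol ta_oo win drop x_cvg
    U_lip U_der U_cvg Ud (j := j) (Q_ := fun k s => state (q k) (ta k + s) 0 j) fhatreg Hfg).
  - move=> a; have [M' _ HM'] := window_lip cK KX fbnd sol win.
    by apply: filterS (HM' a) => k Hk; exists M'; exact: Hk.
  - by move=> s; exact: x_cvg.
  move=> a e e0.
  (* The distance [eps] of [K] from the origin is what makes the zeroing pair bound available. *)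
  have [T [C [T0 C0 HTC]]] := zeroing_pair_bound eta0 fdec fbnd fhat_ub etaDf cK KX eps0 Keps e0.
  exists C => //; near=> k.
  have [w1 w2 w3] : [/\ t0 (q k) <= ta k - a, ((ta k + a)%:E < tf (q k))%E &
      forall s, - a <= s <= a -> K (state (q k) (ta k + s))] by near: k; exact: win.
  have tk : T + a <= ta k by near: k; exact: times_to_infinity_near.
  have [q0 _ qX _ qd] := sol k.
  apply: ae_mono (ae_and (ae_shift (ta k) qd) (ae_shift (ta k) HTC)) => s [h1 h2].
  move=> /andP[as_ sa] dw _ dwle.
  have ts0 : t0 (q k) <= ta k + s by lra.
  have tsf : ((ta k + s)%:E < tf (q k))%E by apply: lt_trans w2; rewrite lte_fin; lra.
  have tsT : T <= ta k + s by lra.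
  have ts : 0 <= ta k + s by exact: le_trans tsT.
  have Ks : K (state (q k) (ta k + s)) by apply: w3; apply/andP; split; lra.
  exists (f (signal (q k) (ta k + s)) (ta k + s) (state (q k) (ta k + s)) 0 j).
    exact: is_derive_shift (is_derive_coord j (h1 ts0 tsf)).
  (* The rate of the state minus [fhat] is [Df], which is at most [e + C * eta], and [eta] is at
     most [- dw]. *)
  rewrite fdec //; last exact: KX.
  rewrite mxE [fhat _ _ _ 0 j + _]addrC addrK; apply: (le_trans (h2 tsT _ _ Ks j)).
  by rewrite lerD2l -mulrN; apply: ler_wpM2l => //; lra.
have hder : {ae mu, forall s,
    is_derive s (1 : R) (fun=> 0 : R) (\sum_i ud i s * hg i s (x s) 0 0)}.
  apply: (limit_equation_coord cK KX Xopen VC1 fbnd eta0 Vdot sol ta_oo win drop x_cvg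
    U_lip U_der U_cvg Ud (j := 0) (Q_ := fun k => fun=> 0) etareg Hhg).
  - by move=> a; apply: nearW => k; exists 0 => u' v' *; rewrite subrr normr0 mul0r.
  - by move=> s; exact: cvg_cst.
  (* Here the error is [eta] itself, hence at most [- dw]: the constant 1 suffices. *)
  move=> a e e0; exists 1 => //; near=> k.
  have [w1 w2 w3] : [/\ t0 (q k) <= ta k - a, ((ta k + a)%:E < tf (q k))%E &
      forall s, - a <= s <= a -> K (state (q k) (ta k + s))] by near: k; exact: win.
  have tk : a <= ta k by near: k; exact: times_to_infinity_near.
  apply: ae_all => s /andP[as_ sa] dw _ dwle; exists 0; first exact: is_derive_cst.
  rewrite mxE eqxx mulr1n sub0r normrN ger0_norm; first lra.
  by apply: eta0; [lra | apply/KX/w3/andP; split; lra].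
have hge0 : {ae mu, forall s i, 0 <= hg i s (x s) 0 0}.
  apply: ae_count => i; have [E nE HE] := Hhg i; apply: negligibleS nE => s /= ns.
  apply: contrapT => nEs; apply: ns.
  have /cvg_rVP/(_ 0) h := HE s (x s) nEs (KX _ (xK s)).
  apply: (ler_cvg_to (cvg_cst 0) h).
  apply: filterS (times_to_infinity_near (- s) ta_oo) => k hk.
  by rewrite mxE eqxx mulr1n; apply: eta0; [lra | exact: KX].
have ct : complete_trajectory X fg hg x u.
  split=> //.
  - by move=> s; exact: KX.
  - by move=> a b _; exact: (enorm_lip_abs_continuous _ _ L0 xL).
  apply: ae_mono (ae_and (ae_and xder hder) (ae_and hge0 uE)) => s [[h1 h2] [h3 h4]].
  split.
    apply: is_derive_rV => j.
    have -> : limit_dynamics fg s (x s) (u s) 0 j = \sum_i ud i s * fg i s (x s) 0 j.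
      by rewrite /limit_dynamics summxE; apply: eq_bigr => i _; rewrite mxE h4.
    exact: h1.
  (* The weighted output is the derivative of the constant 0. As the limits of [eta] are
     nonnegative, the norms in [limit_output] change nothing. *)
  have h20 := is_derive_unique h2 (is_derive_cst 0 s 1).
  rewrite /limit_output -[RHS]h20; apply: eq_bigr => i _.
  by rewrite h4 mulrC [hg i s (x s)]mx11_scalar enorm_scalar ger0_norm // mxE eqxx mulr1n.
have bt : bounded_trajectory X x.
  by exists K; split=> // _ [s _ <-].
have Lam : Lambda X fhat (fun i => to_R1 (eta i)) ta by move=> i; split.
have := wzsd Lam Hfg Hhg ct bt.
have : eps <= inf (range (fun t => enorm (x t))).
  apply: lb_le_inf; first by exists (enorm (x 0)); exists 0.
  by move=> _ [s _ <-]; exact: Keps.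
by move=> h1 h2; rewrite h2 in h1; lra.
Unshelve. all: by end_near. Qed.

End Contradiction.

(** * Comparison functions *)

Section ComparisonFunctions.
Context {R : realType}.
Implicit Types (al ps : R -> R).

Lemma within_Rge0_continuousP al : {within @Rge0 R, continuous al} <->
  forall x e, 0 <= x -> 0 < e -> exists2 d, 0 < d &
    forall y, 0 <= y -> `|y - x| < d -> `|al y - al x| < e.
Proof.
split=> [H x e x0 e0|H].
  have /cvgrPdist_lt/(_ e e0) := (subspace_continuousP _ _).1 H x x0.
  rewrite near_withinE => /nbhs_ballP[d /= d0 Hd]; exists d => // y y0 yx.
  by rewrite distrC; apply: (Hd y) => //; rewrite /ball /= distrC.
apply/subspace_continuousP => x x0; apply/cvgrPdist_lt => e e0.
have [d d0 Hd] := H x e x0 e0; rewrite near_withinE; apply/nbhs_ballP; exists d => //= y.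
by rewrite /ball /= distrC => yx y0; rewrite distrC; exact: Hd.
Qed.

Lemma classK_le al r s : classK al -> 0 <= r -> r <= s -> al r <= al s.
Proof.
by move=> [_ inc _] r0; rewrite le_eqVlt => /orP[/eqP ->//|rs]; apply/ltW/inc.
Qed.

Lemma classK_lt_inv al r s : classK al -> 0 <= s -> al r < al s -> r < s.
Proof.
move=> Ka s0 ars; rewrite ltNge; apply/negP => sr.
by have := classK_le Ka s0 sr; rewrite leNgt ars.
Qed.

Lemma classK_le_inv al r s : classK al -> 0 <= s -> al r <= al s -> r <= s.
Proof.
move=> [_ inc _] s0 ars; rewrite leNgt; apply/negP => sr.
by have := inc _ _ s0 sr; rewrite ltNge ars.
Qed.

Lemma classK_gt0 al r : classK al -> 0 < r -> 0 < al r.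
Proof. by move=> [_ inc a0] r0; rewrite -a0; exact: inc. Qed.

(** The function is continued with slope 1 beyond [rho]. The local estimate has bounds of class K
    only, while a KL function must be unbounded in its first argument. *)
Lemma classKinf_extension al (rho : R) : classK al -> 0 < rho ->
  exists2 ps, classKinf ps & forall r, 0 <= r -> r <= rho -> ps r = al r.
Proof.
move=> Ka rho0; have [ca inc a0] := Ka.
pose ps r := al (Num.min r rho) + Num.max 0 (r - rho).
exists ps; last first.
  move=> r r0 rr; rewrite /ps min_l // max_l ?addr0 //; lra.
have psl r : r <= rho -> ps r = al r.
  by move=> rr; rewrite /ps min_l // max_l ?addr0 //; lra.
have psr r : rho <= r -> ps r = al rho + (r - rho).
  by move=> rr; rewrite /ps min_r // max_r //; lra.
split; first split.
- apply/within_Rge0_continuousP => r e r0 e0.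
  have e20 : 0 < e / 2 by lra.
  have m0 : 0 <= Num.min r rho by rewrite le_min r0 ltW.
  have [d d0 Hd] := (within_Rge0_continuousP al).1 ca _ _ m0 e20.
  exists (Num.min d (e / 2)); first by rewrite lt_min d0.
  move=> y y0; rewrite lt_min => /andP[yd ye].
  have mm : `|Num.min y rho - Num.min r rho| <= `|y - r|.
    by rewrite /Num.min; case: ltP => ?; case: ltP => ?; rewrite ?subrr ?normr0 //;
      rewrite ler_norml; apply/andP; split; have := ler_norm (y - r);
      have := ler_norm (- (y - r)); rewrite normrN; lra.
  have MM : `|Num.max 0 (y - rho) - Num.max 0 (r - rho)| <= `|y - r|.
    by rewrite /Num.max; case: ltP => ?; case: ltP => ?; rewrite ?subrr ?normr0 //;
      rewrite ler_norml; apply/andP; split; have := ler_norm (y - r);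
      have := ler_norm (- (y - r)); rewrite normrN; lra.
  have h1 : `|al (Num.min y rho) - al (Num.min r rho)| < e / 2.
    apply: Hd; first by rewrite le_min y0 ltW.
    exact: le_lt_trans mm yd.
  rewrite /ps; have -> : al (Num.min y rho) + Num.max 0 (y - rho) -
     (al (Num.min r rho) + Num.max 0 (r - rho)) =
    (al (Num.min y rho) - al (Num.min r rho)) + (Num.max 0 (y - rho) - Num.max 0 (r - rho)) by ring.
  by apply: (le_lt_trans (ler_normD _ _)); lra.
- move=> r s r0 rs; have [sr|/ltW rs'] := leP s rho.
    by rewrite !psl ?inc //; lra.
  have [rr|/ltW rr] := leP r rho; last by rewrite !psr //; lra.
  have [E|ne] := eqVneq r rho; first by rewrite psl // psr // E; lra.
  have rl : r < rho by rewrite lt_neqAle ne.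
  by rewrite psl // psr //; have := inc _ _ r0 rl; lra.
- by rewrite psl //; lra.
- move=> M; have al0 := classK_ge0 Ka (ltW rho0).
  exists (rho + `|M| + 1); first by have := normr_ge0 M; lra.
  by rewrite psr; have := normr_ge0 M; have := ler_norm M; lra.
Qed.

(** [al] is [ps2] followed by the inverse of [ps1]. The intermediate value theorem gives its values,
    and comparisons through [ps1] give its regularity. *)
Lemma classKinf_transfer ps1 ps2 : classKinf ps1 -> classKinf ps2 ->
  exists2 al, classKinf al & forall r, 0 <= r -> ps1 (al r) = ps2 r.
Proof.
move=> [K1 unb1] [K2 unb2]; have [c1 inc1 z1] := K1; have [c2 inc2 z2] := K2.
have /choice[al Hal] : forall r, exists y, 0 <= r -> 0 <= y /\ ps1 y = ps2 r.
  move=> r; have [r0|r0] := leP 0 r; last by exists 0 => ?; exfalso; lra.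
  have [M M0 HM] := unb1 (ps2 r).
  have [|||y] := @IVT R ps1 0 M (ps2 r) => //.
  - apply: continuous_subspaceW c1 => t /=; rewrite in_itv /= => /andP[t0 _]; exact: t0.
  - rewrite z1 min_l ?max_r ?(classK_ge0 K1) // (ltW HM) andbT; exact: classK_ge0.
  by rewrite in_itv /= => /andP[y0 _] yE; exists y.
have al0 r : 0 <= r -> 0 <= al r by move=> /Hal[].
have alE r : 0 <= r -> ps1 (al r) = ps2 r by move=> /Hal[].
exists al => //; split; first split.
- apply/within_Rge0_continuousP => r e r0 e0.
  have up : ps2 r < ps1 (al r + e) by rewrite -alE //; apply: inc1; [exact: al0 | lra].
  have u0 : 0 < ps1 (al r + e) - ps2 r by lra.
  have [d d0 Hd] := (within_Rge0_continuousP ps2).1 c2 _ _ r0 u0.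
  have upper y : 0 <= y -> `|y - r| < d -> al y < al r + e.
    move=> y0 yr; apply: (classK_lt_inv K1); first by have := al0 r r0; lra.
    by rewrite alE //; have := Hd y y0 yr; rewrite ltr_norml => /andP[_]; lra.
  (* If [al r - e] is negative, [ps1] says nothing there, but [al y >= 0] settles the bound. *)
  have [d' d'0 lower] : exists2 d', 0 < d' & forall y, 0 <= y -> `|y - r| < d' -> al r - e < al y.
    have [er|re] := ltP (al r - e) 0.
      by exists 1 => // y y0 _; exact: lt_le_trans (al0 y y0).
    have dn : ps1 (al r - e) < ps2 r by rewrite -alE //; apply: inc1 => //; lra.
    have v0 : 0 < ps2 r - ps1 (al r - e) by lra.
    have [d' d'0 Hd'] := (within_Rge0_continuousP ps2).1 c2 _ _ r0 v0.
    exists d' => // y y0 yr; apply: (classK_lt_inv K1); first exact: al0.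
    by rewrite alE //; have := Hd' y y0 yr; rewrite ltr_norml => /andP[+ _]; lra.
  exists (Num.min d d'); first by rewrite lt_min d0.
  move=> y y0; rewrite lt_min => /andP[/(upper y y0) ? /(lower y y0) ?].
  by rewrite ltr_norml; apply/andP; split; lra.
- move=> r s r0 rs; have s0 : 0 <= s by exact: le_trans r0 (ltW rs).
  apply: (classK_lt_inv K1); first exact: al0.
  by rewrite !alE //; exact: inc2.
- have : ps1 (al 0) <= ps1 0 by rewrite alE // z1 z2.
  by move=> /(classK_le_inv K1 (lexx 0)) h; apply: le_anti; rewrite h al0.
- move=> M; have [r r0 Hr] := unb2 (ps1 `|M|); exists r => //.
  apply: (le_lt_trans (ler_norm M)); apply: (classK_lt_inv K1); first exact: al0.
  by rewrite alE.
Qed.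

(** [G] need not increase strictly: [al] does, and the positive lower bound [c] keeps the product
    strictly increasing and unbounded. *)
Lemma sqrt_mul_classKinf al (G : R -> R) (c : R) : classKinf al -> 0 < c ->
  (forall r, 0 <= r -> c <= G r) -> (forall r s, 0 <= r -> r <= s -> G r <= G s) ->
  {within @Rge0 R, continuous G} -> classKinf (fun r => Num.sqrt (al r * G r)).
Proof.
move=> [Ka unb] c0 Gc Gm cG; have [ca inc a0] := Ka.
have age0 r : 0 <= r -> 0 <= al r by exact: classK_ge0.
have Gpos r : 0 <= r -> 0 < G r by move=> /Gc; exact: lt_le_trans.
split; first split.
- apply/subspace_continuousP => x x0; apply: continuous_cvg; first exact: sqrt_continuous.
  by apply: cvgM; [exact: (subspace_continuousP _ _).1 ca x x0 | exact: (subspace_continuousP _ _).1 cG x x0].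
- move=> r s r0 rs; have s0 : 0 <= s by exact: le_trans r0 (ltW rs).
  have as0 : 0 < al s by apply: classK_gt0 => //; exact: le_lt_trans r0 rs.
  rewrite ltr_sqrt ?mulr_gt0 ?Gpos //.
  apply: (@le_lt_trans _ _ (al r * G s)).
    by apply: ler_wpM2l; [exact: age0 | apply: Gm => //; exact: ltW].
  by rewrite ltr_pM2r ?Gpos //; exact: inc.
- by rewrite a0 mul0r sqrtr0.
(* The product has to exceed [M ^+ 2]; the added 1 makes it positive even for [M = 0]. *)
- move=> M; have [r r0 Hr] := unb ((M ^+ 2 + 1) / c); exists r => //.
  apply: (le_lt_trans (ler_norm M)); rewrite -sqrtr_sqr.
  have h : M ^+ 2 + 1 < al r * c by rewrite -ltr_pdivrMr.
  have h2 : al r * c <= al r * G r by apply: ler_wpM2l; [exact: age0 | exact: Gc].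
  have M2 := sqr_ge0 M.
  by rewrite ltr_sqrt; lra.
Qed.

(** [G r t] is the sum of the [d m t] weighted by ramps [clip (r + 2 - m)]. A ramp vanishes for
    [m >= r + 2], so the sum is locally finite and continuous in [r]; it equals 1 at the integer
    following [r], so the sum dominates that [d m t]. *)
Lemma ramp_interpolation (d : nat -> R -> R) :
  (forall m t, 0 <= t -> 0 <= d m t) ->
  (forall m s t, 0 <= s -> s <= t -> d m t <= d m s) ->
  (forall m, d m t @[t --> +oo] --> (0 : R)) ->
  exists G : R -> R -> R, [/\
    (forall r t, 0 <= r -> 0 <= t -> 0 <= G r t),
    (forall t, 0 <= t -> (forall r s, 0 <= r -> r <= s -> G r t <= G s t) /\
       {within @Rge0 R, continuous (G ^~ t)}),
    (forall r s t, 0 <= r -> 0 <= s -> s <= t -> G r t <= G r s),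
    (forall r, 0 <= r -> G r t @[t --> +oo] --> (0 : R)) &
    (forall r t, 0 <= r -> 0 <= t -> exists2 m : nat, r <= m%:R & d m t <= G r t)].
Proof.
move=> d0 dm dl.
pose clip (r : R) := Num.min 1 (Num.max 0 r).
have clip0 r : 0 <= clip r by rewrite /clip le_min ler01 le_max lexx.
have clipm r s : r <= s -> clip r <= clip s.
  move=> rs; rewrite /clip; apply: le_min2 => //.
  exact: le_max2.
have clipc : continuous clip.
  move=> x; apply: continuous_min; first exact: cst_continuous.
  by apply: continuous_max; [exact: cst_continuous | exact: cvg_id].
have clipz r : r <= 0 -> clip r = 0 by move=> r0; rewrite /clip max_l // min_r.
have clip1 r : 1 <= r -> clip r = 1.
  by move=> r1; rewrite /clip max_r ?min_l //; lra.
pose P (K : nat) r t := \sum_(m < K) clip (r + 2 - m%:R) * d m t.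
pose bd (r : R) := Num.bound (r + 2).
pose G r t := P (bd r) r t.
have PE (K K' : nat) (r t : R) : (K <= K')%N -> r + 2 <= K%:R -> P K' r t = P K r t.
  move=> KK rK; rewrite /P -(big_mkord xpredT (fun m => clip (r + 2 - m%:R) * d m t)).
  rewrite (big_cat_nat (leq0n K) KK) /= big_mkord [X in _ + X]big_nat_cond [X in _ + X]big1 ?addr0 //.
  move=> m; rewrite andbT => /andP[Km _]; rewrite clipz ?mul0r //.
  have : K%:R <= m%:R :> R by rewrite ler_nat.
  move: rK; lra.
have bdP (r : R) : 0 <= r -> r + 2 <= (bd r)%:R by move=> r0; apply/ltW/archi_boundP; lra.
have GE (K : nat) (r t : R) : 0 <= r -> r + 2 <= K%:R -> G r t = P K r t.
  move=> r0 rK; rewrite /G; have [h|/ltnW h] := leqP (bd r) K.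
    by rewrite (PE _ _ _ _ h) // bdP.
  by rewrite (PE _ _ _ _ h).
have Pm (K : nat) (r s t : R) : 0 <= t -> r <= s -> P K r t <= P K s t.
  move=> tge rs; apply: ler_sum => m _; apply: ler_wpM2r; first exact: d0.
  by apply: clipm; lra.
have nbd (x : R) : 0 <= x -> exists K : nat, x <= K%:R.
  by move=> x0; exists (Num.bound x); apply/ltW/archi_boundP.
exists G; split.
- by move=> r t r0 tge; apply: sumr_ge0 => m _; rewrite mulr_ge0 // d0.
- move=> t tge; split.
    move=> r s r0 rs; have [|K HK] := nbd (s + 2); first by lra.
    have s0 : 0 <= s by exact: le_trans rs.
    have rK : r + 2 <= K%:R by apply: le_trans HK; rewrite lerD2r.
    by rewrite (GE K r) // (GE K s) //; exact: Pm.
  apply/within_Rge0_continuousP => x e x0 e0.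
  (* A cutoff beyond [x + 3] is valid for all radii within distance 1 of [x], and there [G] is one
     finite sum. *)
  have [|K HK] := nbd (x + 3); first by lra.
  have Pc : continuous (fun r => P K r t).
    apply: continuous_big => [|m _ r]; first exact: add_continuous.
    apply: cvgM; last exact: cvg_cst.
    apply: (@continuous_comp _ _ _ (fun r : R => r + 2 - m%:R) clip); last exact: clipc.
    by apply: cvgD; [apply: cvgD; [exact: cvg_id | exact: cvg_cst] | exact: cvg_cst].
  have /cvgrPdist_lt/(_ e e0)/nbhs_ballP[q /= q0 Hq] := Pc x.
  exists (Num.min q 1); first by rewrite lt_min q0 ltr01.
  move=> y y0; rewrite lt_min => /andP[yq y1].
  move: (y1); rewrite ltr_norml => /andP[_ y1'].
  have xK : x + 2 <= K%:R by lra.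
  have yK : y + 2 <= K%:R by lra.
  rewrite (GE K x) // (GE K y) //.
  by rewrite distrC; apply: Hq; rewrite /ball /= distrC.
- move=> r s t r0 s0 st; apply: ler_sum => m _; apply: ler_wpM2l => //; exact: dm.
- move=> r r0; rewrite [X in _ --> X](_ : 0 = \sum_(m < bd r) clip (r + 2 - m%:R) * 0).
    apply: cvg_big => [|m _]; first exact: add_continuous.
    by apply: cvgM; [exact: cvg_cst | exact: dl].
  by rewrite big1 // => m _; rewrite mulr0.
- move=> r t r0 tge; pose m := Num.truncn r.
  have /andP[m1 m2] : m%:R <= r < m.+1%:R by exact: truncn_itv.
  exists m.+1; first exact: ltW.
  have mb : (m.+1 < bd r)%N.
    rewrite -(ltr_nat R); apply: lt_le_trans (bdP r r0).
    by rewrite -natr1; lra.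
  rewrite /G /P (bigD1 (Ordinal mb)) //= clip1; last by rewrite -natr1; lra.
  by rewrite mul1r lerDl; apply: sumr_ge0 => k _; rewrite mulr_ge0 // d0.
Qed.

(* [beta r t] is the geometric mean of the bounds [al r] and [G r t]; the term
   [expR (- t)] keeps the second factor positive. *)
Lemma classKL_of_decay al (d : nat -> R -> R) : classKinf al ->
  (forall m t, 0 <= t -> 0 <= d m t) ->
  (forall m s t, 0 <= s -> s <= t -> d m t <= d m s) ->
  (forall m, d m t @[t --> +oo] --> (0 : R)) ->
  exists2 beta, classKL beta & forall r t z, 0 <= r -> 0 <= t -> 0 <= z ->
    z <= al r -> (forall m : nat, r <= m%:R -> z <= d m t) -> z <= beta r t.
Proof.
move=> Ka d0 dm dl; have [G [G0 Gr Gt Gl Gd]] := ramp_interpolation d0 dm dl.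
pose H r t := G r t + expR (- t).
have al0 r : 0 <= r -> 0 <= al r by have [K1 _] := Ka; exact: classK_ge0.
have H0 r t : 0 <= r -> 0 <= t -> 0 <= H r t.
  by move=> r0 t0_; rewrite addr_ge0 ?expR_ge0 // G0.
exists (fun r t => Num.sqrt (al r * H r t)); first split.
- move=> t t0_; have [Gm Gc] := Gr t t0_.
  apply: (@sqrt_mul_classKinf al (H ^~ t) (expR (- t))) => //.
  + exact: expR_gt0.
  + by move=> r r0; rewrite lerDr G0.
  + by move=> r s r0 rs; rewrite lerD2r; exact: Gm.
  + apply/subspace_continuousP => x x0; apply: cvgD; last exact: cvg_cst.
    exact: (subspace_continuousP _ _).1 Gc x x0.
- move=> r r0; split.
    move=> s t s0 st; apply: ler_wsqrtr; apply: ler_wpM2l; first exact: al0.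
    by apply: lerD; [exact: Gt | rewrite ler_expR lerN2].
  have -> : 0 = Num.sqrt (al r * (0 + 0)) :> R by rewrite addr0 mulr0 sqrtr0.
  apply: continuous_cvg; first exact: sqrt_continuous.
  apply: cvgM; first exact: cvg_cst.
  by apply: cvgD; [exact: Gl | exact: cvgr_expR].
move=> r t z r0 t0_ z0 za zd; have [m rm dmG] := Gd r t r0 t0_.
have zH : z <= H r t.
  by apply: (le_trans (zd m rm)); apply: (le_trans dmG); rewrite lerDl expR_ge0.
rewrite -[z]ger0_norm // -sqrtr_sqr; apply: ler_wsqrtr.
by rewrite expr2; apply: ler_pM.
Qed.

End ComparisonFunctions.

(** * Uniform attractivity *)

Section Decay.
Context {R : realType} {n N : nat}.
Implicit Types (A : switched_path R n N -> R -> Prop).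

(* The value 0 makes the set nonempty, since the supremum of the empty set is a junk value. *)
Definition excursions A (t : R) : set R := [set z | z = 0 \/ exists p s t',
  [/\ A p s, t <= t', ((s + t')%:E < tf p)%E & z = enorm (state p (s + t'))]].

(** Taking the supremum over all later times makes [d] nonincreasing; the attraction time, common to
    all members of [A], makes it tend to 0. *)
Lemma excursion_decay A (B : R) :
  (forall p s t', A p s -> 0 <= t' -> ((s + t')%:E < tf p)%E -> enorm (state p (s + t')) <= B) ->
  (forall e, 0 < e -> exists2 T : R, 0 <= T & forall p s t', A p s -> T <= t' ->
     ((s + t')%:E < tf p)%E -> enorm (state p (s + t')) <= e) ->
  let d t := sup (excursions A t) in
  [/\ forall t, 0 <= t -> 0 <= d t, forall s t, 0 <= s -> s <= t -> d t <= d s,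
      d t @[t --> +oo] --> (0 : R) &
      forall p s t, A p s -> 0 <= t -> ((s + t)%:E < tf p)%E -> enorm (state p (s + t)) <= d t].
Proof.
move=> bnd attr d.
have hs t : 0 <= t -> has_sup (excursions A t).
  move=> t0_; split; first by exists 0; left.
  exists `|B| => _ [->|[p [s [t' [Aps tt' tf_ ->]]]]] //.
  by apply: le_trans (ler_norm B); apply: bnd => //; exact: le_trans tt'.
have d_ge0 t : 0 <= t -> 0 <= d t.
  by move=> t0_; apply: ub_le_sup; [have [] := hs t t0_ | left].
split=> //.
- move=> s t s0 st; apply: ge_sup; first by exists 0; left.
  move=> z [->|[p [s' [t' [Aps tt' tf_ zE]]]]]; first exact: d_ge0.
  apply: ub_le_sup; first by have [] := hs s s0.
  by right; exists p, s', t'; split=> //; exact: le_trans tt'.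
- apply/cvgrPdist_lt => e e0; have e20 : 0 < e / 2 by lra.
  have [T T0 HT] := attr _ e20.
  exists T; split; first exact: num_real.
  move=> t Tt; have t0_ : 0 <= t by exact: le_trans T0 (ltW Tt).
  rewrite sub0r normrN ger0_norm ?d_ge0 //.
  apply: (@le_lt_trans _ _ (e / 2)); last by lra.
  apply: ge_sup; first by exists 0; left.
  move=> z [->|[p [s' [t' [Aps tt' tf_ ->]]]]]; first exact: ltW.
  by apply: HT => //; apply: le_trans tt'; exact: ltW.
- move=> p s t Aps t0_ tf_; apply: ub_le_sup; first by have [] := hs t t0_.
  by right; exists p, s, t.
Qed.

End Decay.

(** * Exit from annuli and uniform attraction times *)

Section Attractivity.
Context {R : realType} {n N : nat}.

(** If all [M] steps dropped by more than [c / M], the telescoped drop would exceed [c]. *)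
Lemma small_drop (g : nat -> R) (M : nat) (c : R) : (0 < M)%N -> g 0%N - g M <= c ->
  exists2 j, (j < M)%N & g j - g j.+1 <= c / M%:R.
Proof.
move=> M0 gc; apply: contrapT => H.
have M0' : 0 < M%:R :> R by rewrite ltr0n.
have : \sum_(j < M) (c / M%:R) < \sum_(j < M) (g j - g j.+1).
  apply: ltr_sum; first by apply/hasP; exists (Ordinal M0) => //; exact: mem_index_enum.
  by move=> j _; rewrite ltNge; apply/negP => h; apply: H; exists j.
have -> : \sum_(j < M) (g j - g j.+1) = g 0%N - g M.
  rewrite -(big_mkord xpredT (fun j => g j - g j.+1)).
  rewrite -[RHS]opprB -telescope_sumr // -sumrN.
  by apply: eq_bigr => j _; rewrite opprB.
rewrite sumr_const card_ord -[X in X < _]mulr_natr divfK ?gt_eqF //.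
by rewrite ltNge gc.
Qed.

Lemma enorm_annulus_compact (e B : R) :
  compact [set v : 'rV[R]_n | e <= enorm v /\ enorm v <= B].
Proof.
apply: bounded_closed_compact.
  exists `|B|; split; first exact: num_real.
  move=> M BM v [_ vB] /=; rewrite [leLHS]/Num.Def.normr /= mx_normrE.
  have M0 : 0 <= M by apply: le_trans (ltW BM).
  apply: bigmax_le => // -[i j] _; rewrite ord1 /=.
  apply: (le_trans (coord_le_enorm v j)); apply: (le_trans vB).
  by apply: (le_trans (ler_norm B)); exact: ltW.
apply: closedI.
  exact: ((continuous_closedP _).1 (@continuous_enorm R n) _ (@closed_ge R e)).
exact: ((continuous_closedP _).1 (@continuous_enorm R n) _ (@closed_le R B)).
Qed.

Variables (X : set 'rV[R]_n) (f : 'I_N -> R -> 'rV[R]_n -> 'rV[R]_n).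
Variables (V Vt : R -> 'rV[R]_n -> R) (Vx : R -> 'rV[R]_n -> 'rV[R]_n)
  (phi1 phi2 : R -> R)
  (eta : 'I_N -> R -> 'rV[R]_n -> R) (fhat Df : 'I_N -> R -> 'rV[R]_n -> 'rV[R]_n).
Hypotheses (Xopen : open X) (VC1 : C1_with X V Vt Vx).
Hypothesis fbnd : forall i, uniformly_bounded (@Rge0 R) X (f i).
Hypotheses (V0 : forall (t : R) (xi : 'rV[R]_n), 0 <= t -> X xi -> 0 <= V t xi)
  (phi1K : classK phi1) (phi2K : classK phi2)
  (Vphi : forall (t : R) (xi : 'rV[R]_n), 0 <= t -> X xi ->
     phi1 (enorm xi) <= V t xi /\ V t xi <= phi2 (enorm xi)).
Hypotheses (eta0 : forall i t xi, 0 <= t -> X xi -> 0 <= eta i t xi)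
  (Vdot : forall i (t : R) (xi : 'rV[R]_n), 0 <= t -> X xi ->
     Vt t xi + \sum_(j < n) Vx t xi 0 j * f i t xi 0 j <= - eta i t xi).
Hypotheses (etareg : forall i,
     [/\ uniformly_bounded (@Rge0 R) X (to_R1 (eta i)),
         measurable_in_t (@Rge0 R) X (to_R1 (eta i)),
         continuous_in_xi_uniformly (@Rge0 R) X (to_R1 (eta i))
       & precompact_fun X (to_R1 (eta i))])
  (fdec : forall i (t : R) (xi : 'rV[R]_n), 0 <= t -> X xi ->
     f i t xi = fhat i t xi + Df i t xi)
  (fhatreg : forall i,
     [/\ uniformly_bounded (@Rge0 R) X (fhat i),
         measurable_in_t (@Rge0 R) X (fhat i),
         continuous_in_xi_uniformly (@Rge0 R) X (fhat i)
       & precompact_fun X (fhat i)])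
  (etaDf : forall i, zeroing_pair X (to_R1 (eta i)) (Df i))
  (wzsd : forall gamma, Lambda X fhat (fun i => to_R1 (eta i)) gamma ->
     forall (fg : 'I_N -> R -> 'rV[R]_n -> 'rV[R]_n)
            (hg : 'I_N -> R -> 'rV[R]_n -> 'rV[R]_1),
       (forall i, limiting_function X (fhat i) gamma (fg i)) ->
       (forall i, limiting_function X (to_R1 (eta i)) gamma (hg i)) ->
       WZSD X fg hg).

Lemma trajectory_bound p s t : solution X f p -> t0 p <= s -> s <= t -> (t%:E < tf p)%E ->
  phi1 (enorm (state p t)) <= phi2 (enorm (state p s)).
Proof.
move=> sp ps st tp; have [p0 _ pX _ _] := sp.
have sf : (s%:E < tf p)%E by apply: le_lt_trans tp; rewrite lee_fin.
have s0 : 0 <= s by exact: le_trans ps.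
have [h1 _] := Vphi (le_trans s0 st) (pX _ (le_trans ps st) tp).
have [_ h2] := Vphi s0 (pX _ ps sf).
apply: (le_trans h1); apply: le_trans h2.
exact: (solution_V_nonincreasing fbnd Xopen VC1 eta0 Vdot sp).
Qed.

Lemma annulus_exit (e B : R) : 0 < e -> 0 <= B ->
  [set v : 'rV[R]_n | enorm v <= B] `<=` X ->
  exists2 T : R, 0 <= T & forall p s, solution X f p -> switching_signal (signal p) ->
    t0 p <= s -> ((s + T)%:E < tf p)%E ->
    (forall t, s <= t <= s + T -> enorm (state p t) <= B) ->
    exists2 t, s <= t <= s + T & enorm (state p t) < e.
Proof.
move=> e0 B0 BX; apply: contrapT => H.
pose c := phi2 B; have c0 : 0 <= c by exact: classK_ge0.
pose K := [set v : 'rV[R]_n | e <= enorm v /\ enorm v <= B].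
(* The successor makes the number of windows [M m] positive, and the factor [bc] gives
   [c / M m <= 1 / (m + 1)]. *)
pose bc := (Num.bound c).+1.
have bcP : c <= bc%:R.
  by apply: (@le_trans _ _ (Num.bound c)%:R); [exact/ltW/archi_boundP | rewrite ler_nat].
pose M (m : nat) := (m.+1 * bc)%N.
have M0 m : (0 < M m)%N by rewrite muln_gt0.
have cM m : c / (M m)%:R <= m.+1%:R^-1.
  rewrite ler_pdivrMr ?ltr0n // /M natrM mulrA mulVf ?mul1r // gt_eqF // ltr0Sn.
(* The negated claim is used with a duration of [M m] consecutive windows, each of width
   [2 * (m + 1)]. *)
have /choice[pm /choice[sm Hm]] : forall m : nat, exists p s,
   [/\ solution X f p, switching_signal (signal p), t0 p <= s,
     ((s + (2 * m.+1%:R) * (M m)%:R)%:E < tf p)%E &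
     forall t, s <= t <= s + (2 * m.+1%:R) * (M m)%:R -> K (state p t)].
  move=> m; apply: contrapT => nm; apply: H.
  exists ((2 * m.+1%:R) * (M m)%:R); first by rewrite !mulr_ge0.
  move=> p s sp sw ps tp pB; apply: contrapT => ne; apply: nm.
  exists p, s; split=> // t st; split; last exact: pB.
  by rewrite leNgt; apply/negP => h; apply: ne; exists t.
pose w m (j : nat) := sm m + (2 * m.+1%:R) * j%:R.
pose Vm m (j : nat) := V (w m j) (state (pm m) (w m j)).
have wS m j : w m j.+1 = w m j + 2 * m.+1%:R by rewrite /w -natr1; ring.
have wmono m j k : (j <= k)%N -> w m j <= w m k.
  by move=> jk; rewrite /w lerD2l ler_wpM2l // ?ler_nat // mulr_ge0.
have w0 m : w m 0%N = sm m by rewrite /w mulr0 addr0.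
have dom m t : sm m <= t -> t <= w m (M m) ->
    [/\ t0 (pm m) <= t, (t%:E < tf (pm m))%E, K (state (pm m) t), X (state (pm m) t) & 0 <= t].
  move=> st tw; have [sp _ ps tp HK] := Hm m; have [p0 _ _ _ _] := sp.
  have Kt : K (state (pm m) t) by apply: HK; rewrite st.
  split=> //.
  - exact: le_trans st.
  - by apply: le_lt_trans tp; rewrite lee_fin.
  - by apply: BX; have [] := Kt.
  - by apply: le_trans st; exact: le_trans ps.
have mono m u v : sm m <= u -> u <= v -> v <= w m (M m) ->
    V v (state (pm m) v) <= V u (state (pm m) u).
  move=> su uv vw; have [sp _ _ _ _] := Hm m.
  have [pu _ _ _ _] := dom m u su (le_trans uv vw).
  have [_ vf _ _ _] := dom m v (le_trans su uv) vw.
  exact: (solution_V_nonincreasing fbnd Xopen VC1 eta0 Vdot sp).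
have /choice[jm Hj] : forall m, exists j, (j < M m)%N /\ Vm m j - Vm m j.+1 <= m.+1%:R^-1.
  move=> m; have [|j jM Hj] := @small_drop (Vm m) (M m) c (M0 m).
    have hw0 : sm m <= w m 0%N by rewrite w0.
    have hwM : sm m <= w m (M m) by rewrite -w0; exact: wmono.
    have [_ _ K0 X0 t00] := dom m (w m 0%N) hw0 (wmono m _ _ (leq0n _)).
    have [_ _ _ XM tM0] := dom m (w m (M m)) hwM (lexx _).
    have [_ h1] := Vphi t00 X0; have h2 := V0 tM0 XM.
    have [_ K0'] := K0.
    have h3 := classK_le phi2K (enorm_ge0 _) K0'.
    by rewrite /Vm /c; lra.
  by exists j; split=> //; exact: le_trans (cM m).
(* Centre of the window selected by the pigeonhole, with half-width [m + 1]. Windows start at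
   nonnegative times, whence [tau m >= m + 1]. *)
pose tau m := w m (jm m) + m.+1%:R.
have m1 (m : nat) : 0 < m.+1%:R :> R by rewrite ltr0Sn.
have lo m : w m (jm m) = tau m - m.+1%:R by rewrite /tau; ring.
have hi m : w m (jm m).+1 = tau m + m.+1%:R by rewrite wS /tau; ring.
have los m : sm m <= tau m - m.+1%:R by rewrite -lo -w0; exact: wmono.
have hiw m : tau m + m.+1%:R <= w m (M m) by rewrite -hi; apply: wmono; have [] := Hj m.
have s0 m : 0 <= sm m.
  have [sp _ ps _ _] := Hm m; have [p0 _ _ _ _] := sp; exact: le_trans ps.
have tau_ge m : m.+1%:R <= tau m by have := los m; have := s0 m; lra.
have big (a : R) : \forall m \near \oo, a <= m.+1%:R.
  by apply: filterS (nbhs_infty_ger a) => m h; apply: (le_trans h); rewrite ler_nat.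
apply: (@no_nondissipating_windows R n N X K f V Vt Vx eta fhat Df Xopen VC1 fbnd eta0 Vdot
  etareg fdec fhatreg etaDf wzsd e pm tau) => //.
- exact: enorm_annulus_compact.
- by move=> v [_ vB]; exact: BX.
- by move=> v [].
- by move=> m; have [] := Hm m.
- by move=> m; have [] := Hm m.
- split=> [m|]; first by apply: le_trans (tau_ge m); exact: ltW.
  apply/cvgryPge => a; apply: filterS (big a) => m h; exact: le_trans (tau_ge m).
- move=> a; apply: filterS (big `|a|) => m am.
  have := ler_norm a; have := ler_norm (- a); rewrite normrN => a1 a2.
  have := los m; have := hiw m => h1 h2.
  have h3 : sm m <= tau m + a by have := m1 m; lra.
  have h4 : tau m + a <= w m (M m) by lra.
  have h5 : sm m <= tau m - a by lra.
  have h6 : tau m - a <= w m (M m) by lra.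
  have [_ f1 _ _ _] := dom m _ h3 h4; have [f2 _ _ _ _] := dom m _ h5 h6.
  split=> // t /andP[at_ ta].
  by have [] := dom m (tau m + t); [lra | lra |].
- move=> a; apply/cvgrPdist_lt => q q0.
  apply: filterS (filterI (big `|a|) (near_infty_natSinv_lt (PosNum q0))) => m [am /= mq].
  (* By monotonicity of [V], the drop over a radius [b <= m + 1] is at most that over the whole
     window. *)
  have key b : 0 <= b -> b <= m.+1%:R ->
      `|V (tau m - b) (state (pm m) (tau m - b)) - V (tau m + b) (state (pm m) (tau m + b))| < q.
    move=> b0 bm; have := los m; have := hiw m => h1 h2.
    have k1 : V (tau m - b) (state (pm m) (tau m - b)) <= Vm m (jm m).
      by rewrite /Vm lo; apply: (mono m) => //; lra.
    have k2 : Vm m (jm m).+1 <= V (tau m + b) (state (pm m) (tau m + b)).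
      by rewrite /Vm hi; apply: (mono m) => //; lra.
    have k3 : V (tau m + b) (state (pm m) (tau m + b)) <= V (tau m - b) (state (pm m) (tau m - b)).
      by apply: (mono m); lra.
    have [_ k4] := Hj m.
    by rewrite ger0_norm ?subr_ge0 //; move: mq k4; move: (m.+1%:R^-1) => z; lra.
  rewrite sub0r normrN.
  have [a0|a0] := leP 0 a; first by apply: key => //; rewrite -(ger0_norm a0).
  (* For negative [a] the two ends of the window are exchanged. *)
  have := key (- a); rewrite opprK distrC; apply; first by lra.
  by rewrite -(ltr0_norm a0).
Qed.

(** Once the state enters the ball of radius [d], where [phi2] is below [phi1 e], [trajectory_bound]
    restarted at the entry time keeps it below [e] forever. *)
Lemma attractivity (B e : R) : 0 <= B -> [set v : 'rV[R]_n | enorm v <= B] `<=` X -> 0 < e ->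
  exists2 T : R, 0 <= T & forall p s t', solution X f p -> switching_signal (signal p) ->
    t0 p <= s -> (forall t, s <= t -> (t%:E < tf p)%E -> enorm (state p t) <= B) ->
    T <= t' -> ((s + t')%:E < tf p)%E -> enorm (state p (s + t')) <= e.
Proof.
move=> B0 BX e0; have p1e : 0 < phi1 e by exact: classK_gt0.
have [d d0 Hd] := classK_near0 phi2K p1e.
have [T T0 HT] := annulus_exit d0 B0 BX; exists T => // p s t' sp sw ps pB Tt' tf_.
have sTf : ((s + T)%:E < tf p)%E by apply: le_lt_trans tf_; rewrite lee_fin; lra.
have [|t1 /andP[st1 t1T] t1d] := HT p s sp sw ps sTf.
  move=> t /andP[st tT]; apply: pB => //.
  by apply: le_lt_trans sTf; rewrite lee_fin.
apply/ltW/(classK_lt_inv phi1K (ltW e0)).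
apply: (le_lt_trans (trajectory_bound sp (le_trans ps st1) _ tf_)); first by lra.
by apply: Hd => //; exact: enorm_ge0.
Qed.

End Attractivity.

(** * Assembly of the local and the global KL estimates *)

Theorem mainTheorem4 (R : realType) (n N : nat) (X : set 'rV[R]_n)
  (f : 'I_N -> R -> 'rV[R]_n -> 'rV[R]_n)
  (V Vt : R -> 'rV[R]_n -> R) (Vx : R -> 'rV[R]_n -> 'rV[R]_n)
  (phi1 phi2 : R -> R) (eta : 'I_N -> R -> 'rV[R]_n -> R)
  (fhat Df : 'I_N -> R -> 'rV[R]_n -> 'rV[R]_n)
  (hXopen : open X) (hX0 : X 0)
  (hfcar : forall i, caratheodory X (f i))
  (hfbnd : forall i, uniformly_bounded (@Rge0 R) X (f i))
  (hV0 : forall (t : R) (xi : 'rV[R]_n), 0 <= t -> X xi -> 0 <= V t xi)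
  (hphi1 : classK phi1) (hphi2 : classK phi2)
  (hVphi : forall (t : R) (xi : 'rV[R]_n), 0 <= t -> X xi ->
     phi1 (enorm xi) <= V t xi /\ V t xi <= phi2 (enorm xi))
  (hVC1 : C1_with X V Vt Vx)
  (heta0 : forall i (t : R) (xi : 'rV[R]_n), 0 <= t -> X xi -> 0 <= eta i t xi)
  (hetameas : forall i, measurable_in_t (@Rge0 R) X (to_R1 (eta i)))
  (hetacont : forall i, continuous_in_xi (@Rge0 R) X (to_R1 (eta i)))
  (hVdot : forall i (t : R) (xi : 'rV[R]_n), 0 <= t -> X xi ->
     Vt t xi + \sum_(j < n) Vx t xi 0 j * f i t xi 0 j <= - eta i t xi)
  (hVswitch : forall p (t s : R), trajectories X f p ->
     t0 p <= t -> t < s -> (s%:E < tf p)%E -> signal p t = signal p s ->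
     V s (state p s) <= V t (state p t))
  (hh : forall i,
     [/\ uniformly_bounded (@Rge0 R) X (to_R1 (eta i)),
         measurable_in_t (@Rge0 R) X (to_R1 (eta i)),
         continuous_in_xi_uniformly (@Rge0 R) X (to_R1 (eta i))
       & precompact_fun X (to_R1 (eta i))])
  (hfdec : forall i (t : R) (xi : 'rV[R]_n), 0 <= t -> X xi ->
     f i t xi = fhat i t xi + Df i t xi)
  (hfhat : forall i,
     [/\ uniformly_bounded (@Rge0 R) X (fhat i),
         measurable_in_t (@Rge0 R) X (fhat i),
         continuous_in_xi_uniformly (@Rge0 R) X (fhat i)
       & precompact_fun X (fhat i)])
  (hDf : forall i, zeroing_pair X (to_R1 (eta i)) (Df i))
  (hWZSD : forall gamma, Lambda X fhat (fun i => to_R1 (eta i)) gamma ->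
     forall (fg : 'I_N -> R -> 'rV[R]_n -> 'rV[R]_n)
            (hg : 'I_N -> R -> 'rV[R]_n -> 'rV[R]_1),
       (forall i, limiting_function X (fhat i) gamma (fg i)) ->
       (forall i, limiting_function X (to_R1 (eta i)) gamma (hg i)) ->
       WZSD X fg hg) :
  UAS (trajectories X f) /\
  (X = setT -> classKinf phi1 -> classKinf phi2 -> GUAS X (trajectories X f)).
Proof.
have tb := @trajectory_bound R n N X f V Vt Vx phi1 phi2 eta hXopen hVC1 hfbnd hVphi heta0 hVdot.
have attr := @attractivity R n N X f V Vt Vx phi1 phi2 eta fhat Df hXopen hVC1 hfbnd hV0
  hphi1 hphi2 hVphi heta0 hVdot hh hfdec hfhat hDf hWZSD.
split; last first.
  move=> XT K1 K2; split=> //.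
  have [al alK alE] := classKinf_transfer K1 K2.
  have al0 r : 0 <= r -> 0 <= al r by have [h _] := alK; exact: classK_ge0.
  (* Attraction times are uniform on each bounded set of initial states only, hence one decay
     function for each integer radius. *)
  pose A (m : nat) (p : switched_path R n N) (s : R) := [/\ trajectories X f p, t0 p <= s &
    enorm (state p s) <= m%:R].
  have Abnd m p s t : A m p s -> s <= t -> (t%:E < tf p)%E -> enorm (state p t) <= al m%:R.
    move=> [[_ [sp _]] ps sm] st tp; apply: (classK_le_inv hphi1 (al0 _ _)) => //.
    rewrite alE //; apply: (le_trans (tb p s t sp ps st tp)).
    exact: (classK_le hphi2 (enorm_ge0 _)).
  pose d m t := sup (excursions (A m) t).
  have dP m : [/\ forall t, 0 <= t -> 0 <= d m t, forall s t, 0 <= s -> s <= t -> d m t <= d m s,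
      d m t @[t --> +oo] --> (0 : R) &
      forall p s t, A m p s -> 0 <= t -> ((s + t)%:E < tf p)%E -> enorm (state p (s + t)) <= d m t].
    apply: (@excursion_decay R n N (A m) (al m%:R)).
      by move=> p s t' Aps t0_; apply: (Abnd m p s) => //; rewrite lerDl.
    move=> e e0; have [|T T0 HT] := attr (al m%:R) e (al0 _ (ler0n _ _)) _ e0.
      by rewrite XT.
    exists T => // p s t' Aps; have [[sw [sp _]] ps _] := Aps.
    by apply: HT => // t; exact: (Abnd m p s t Aps).
  have [||| beta bK bP] := @classKL_of_decay R al d alK.
  - by move=> m t; have [h _ _ _] := dP m; exact: h.
  - by move=> m s t; have [_ h _ _] := dP m; exact: h.
  - by move=> m; have [_ _ h _] := dP m.
  exists beta => // p s Tp ps sf t st tp.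
  have st0 : 0 <= t - s by lra.
  apply: bP => //; try exact: enorm_ge0.
    have [_ [sp _]] := Tp.
    apply: (classK_le_inv hphi1 (al0 _ (enorm_ge0 _))).
    by rewrite alE ?enorm_ge0 //; exact: tb.
  move=> m sm; have [_ _ _ h] := dP m.
  by have := h p s (t - s); rewrite [s + _]addrC subrK; apply.
have /nbhs_ballP[r0 /= r00 Hr0] : nbhs (0 : 'rV[R]_n) X by exact: open_nbhs_nbhs.
(* Halving puts the closed Euclidean ball of radius [rho] inside the open sup-norm ball of radius
   [r0]. *)
pose rho := r0 / 2; have rho0 : 0 < rho by rewrite divr_gt0.
have rhoX : [set v : 'rV[R]_n | enorm v <= rho] `<=` X.
  move=> v vr; apply: Hr0; apply/ball_rVP => // j; rewrite mxE sub0r normrN.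
  apply: (le_lt_trans (coord_le_enorm v j)); apply: (le_lt_trans vr).
  by rewrite /rho; lra.
have [ps1 ps1K ps1E] := classKinf_extension hphi1 rho0.
have [ps2 ps2K ps2E] := classKinf_extension hphi2 rho0.
have [al alK alE] := classKinf_transfer ps1K ps2K.
have al0 r : 0 <= r -> 0 <= al r by have [h _] := alK; exact: classK_ge0.
have [d1 d10 Hd1] := classK_near0 hphi2 (classK_gt0 hphi1 rho0).
(* [d1] confines the trajectory to the ball of radius [rho], and the minimum puts the initial state
   there too: the extensions then agree with [phi1] and [phi2] where they are evaluated. *)
pose delta0 := Num.min d1 rho.
have delta00 : 0 < delta0 by rewrite lt_min d10.
pose A (p : switched_path R n N) (s : R) := [/\ trajectories X f p, t0 p <= s &
    enorm (state p s) < delta0].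
have Abnd p s t : A p s -> s <= t -> (t%:E < tf p)%E -> enorm (state p t) <= rho.
  move=> [[_ [sp _]] ps]; rewrite lt_min => /andP[sd _] st tp.
  apply/ltW/(classK_lt_inv hphi1 (ltW rho0)).
  by apply: (le_lt_trans (tb p s t sp ps st tp)); apply: Hd1 => //; exact: enorm_ge0.
(* One ball of initial states is enough here, so the sequence is constant in [m]. *)
pose d (m : nat) t := sup (excursions A t).
have dP m : [/\ forall t, 0 <= t -> 0 <= d m t, forall s t, 0 <= s -> s <= t -> d m t <= d m s,
      d m t @[t --> +oo] --> (0 : R) &
      forall p s t, A p s -> 0 <= t -> ((s + t)%:E < tf p)%E -> enorm (state p (s + t)) <= d m t].
  apply: (@excursion_decay R n N A rho).
    by move=> p s t' Aps t0_; apply: (Abnd p s) => //; rewrite lerDl.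
  move=> e e0; have [T T0 HT] := attr rho e (ltW rho0) rhoX e0.
  exists T => // p s t' Aps; have [[sw [sp _]] ps _] := Aps.
  by apply: HT => // t; exact: (Abnd p s t Aps).
have [||| beta bK bP] := @classKL_of_decay R al d alK.
- by move=> m t; have [h _ _ _] := dP m; exact: h.
- by move=> m s t; have [_ h _ _] := dP m; exact: h.
- by move=> m; have [_ _ h _] := dP m.
exists beta, delta0; split=> // p s Tp ps sf sdel t st tp.
have Aps : A p s by [].
have st0 : 0 <= t - s by lra.
apply: bP => //; try exact: enorm_ge0.
  have [_ [sp _]] := Tp; have [ps1K' _] := ps1K.
  apply: (classK_le_inv ps1K' (al0 _ (enorm_ge0 _))).
  rewrite alE ?enorm_ge0 // ps1E ?enorm_ge0 //; last exact: Abnd Aps st tp.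
  rewrite ps2E ?enorm_ge0 //; first exact: tb.
  by move: sdel; rewrite lt_min => /andP[_ /ltW].
move=> m _; have [_ _ _ h] := dP m.
by have := h p s (t - s); rewrite [s + _]addrC subrK; apply.
Qed.
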